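(* Let $f:[0,1]\to[0,\infty)$ be continuous and non-decreasing with $f(u)>0$ for $u\in(0,1]$, and for each $n$ let $w_i=f(i/n)$, $i=1,\dots,n$, and $\mathcal{P}=\{\mathbf{x}\in\mathbb{R}^n:\sum_i w_i|x_i|\le1\}$. Let $0<\delta<\tau<1$, and for $n$ with $k=\delta n$, $l=\tau n$ integers let $G_0^l$ be the face of $\mathcal{P}$ with vertices $\frac{1}{w_1}e_1,\dots,\frac{1}{w_l}e_l$ and $F_0^k\subset G_0^l$ the face with vertices $\frac{1}{w_1}e_1,\dots,\frac1{w_k}e_k$. With $\bar\psi_{int}(\delta,\tau)$ and $\bar\psi_{ext}(\tau)$ as defined in the context, for every $\epsilon>0$ there are integers $n_0(\epsilon),n_1(\epsilon)$ such that $n^{-1}\log\beta(F_0^k,G_0^l)<\bar\psi_{int}(\delta,\tau)+\epsilon$ for all $n>n_0(\epsilon)$, and $n^{-1}\log\gamma(G_0^l,\mathcal{P})<\bar\psi_{ext}(\tau)+\epsilon$ for all $n>n_1(\epsilon)$.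
   Context: Internal angle: for faces $F\subseteq G$ of a polytope, take $\mathbf{x}$ in the relative interior of $F$, let $C=\{t(\mathbf{g}-\mathbf{x}):\mathbf{g}\in G,t\ge0\}$ and $V$ the linear span of $G-\mathbf{x}$; $\beta(F,G)$ is the fraction of the volume of the unit ball of $V$ covered by $C$ ($\beta(F,F)=1$). External angle: for a face $G$ of $\mathcal{P}$ and $\mathbf{x}$ in its relative interior, the normal cone $N=\{\mathbf{v}:\langle \mathbf{v},\mathbf{z}-\mathbf{x}\rangle\le0\ \forall \mathbf{z}\in\mathcal{P}\}$; $\gamma(G,\mathcal{P})$ is the fraction of the volume of the unit ball of the linear span of $N$ covered by $N$. Let $\Phi$ be the standard normal distribution function, $\lambda(s)=\frac{s^2}{2}+\log(2\Phi(s))$, $\operatorname{erf}(x)=\frac{2}{\sqrt\pi}\int_0^xe^{-t^2}dt$. Define $c_0=\int_\delta^\tau f(u)du$, $c_1=\int_0^\delta f^2(u)du$, $\lambda_0(s)=\frac1{c_0}\int_\delta^\tau\lambda(sf(u))du$, $\lambda_0^*(y)=\sup_{s\in\mathbb{R}}(sy-\lambda_0(s))$, $\eta(y)=\frac{c_0^2}{2c_1}y^2+c_0\lambda_0^*(y)$ and $\bar\psi_{int}(\delta,\tau)=-(\tau-\delta)\log2-\inf_{y\in\mathbb{R}}\eta(y)$. Define $c_2=\int_0^\tau f^2(u)du$, $\zeta(x)=c_2x^2-\int_\tau^1\log\operatorname{erf}(xf(u))du$ and $\bar\psi_{ext}(\tau)=-\inf_{x>0}\zeta(x)$. *)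

(* Defs.v *)
From HB Require Import structures.
From mathcomp Require Import all_boot all_order all_algebra.
From mathcomp Require Import all_classical all_reals all_analysis.
Set Implicit Arguments. Unset Strict Implicit. Unset Printing Implicit Defensive.
Import Order.TTheory GRing.Theory Num.Theory.
Import numFieldNormedType.Exports.
Local Open Scope classical_set_scope.
Local Open Scope ring_scope.

Section Defs.
Variable R : realType.

Definition dotv n (x y : 'rV[R]_n) : R := \sum_(i < n) x 0 i * y 0 i.
Definition enorm n (x : 'rV[R]_n) : R := Num.sqrt (dotv x x).

Fixpoint iter_int (d : nat) (g : (nat -> R) -> \bar R) (x : nat -> R) : \bar R :=
  match d with
  | 0 => g x
  | d'.+1 => (\int[@lebesgue_measure R]_(t in [set: R])
                 iter_int d' g (fun j => if j == d' then t else x j))%E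
  end.

Definition vol d (S : set 'rV[R]_d) : \bar R :=
  iter_int d (fun x => (\1_S (\row_(i < d) x i) : R)%:E) (fun _ => 0).

Definition span n (S : set 'rV[R]_n) : set 'rV[R]_n :=
  [set y | exists m (s : 'I_m -> 'rV[R]_n) (c : 'I_m -> R),
     (forall i, S (s i)) /\ y = \sum_(i < m) c i *: s i].

Definition aff n (S : set 'rV[R]_n) : set 'rV[R]_n :=
  [set y | exists m (s : 'I_m -> 'rV[R]_n) (c : 'I_m -> R),
     (forall i, S (s i)) /\ \sum_(i < m) c i = 1 /\ y = \sum_(i < m) c i *: s i].

Definition relint n (S : set 'rV[R]_n) : set 'rV[R]_n :=
  [set x | S x /\ exists e : R, 0 < e /\
     forall y, aff S y -> enorm (y - x) < e -> S y].

Definition is_onb n (V : set 'rV[R]_n) d (Q : 'M[R]_(d, n)) : Prop :=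
  Q *m Q^T = 1%:M /\ V = [set y *m Q | y in [set: 'rV[R]_d]].

(* fraction of the volume of the unit ball of the subspace V covered by C,
   computed in the coordinates of a (chosen) orthonormal basis of V *)
Definition ball_fraction n (V C : set 'rV[R]_n) : R :=
  match pselect (exists dQ : {d : nat & 'M[R]_(d, n)}, is_onb V (projT2 dQ)) with
  | left H =>
      let dQ := projT1 (cid H) in
      fine (vol [set y : 'rV[R]_(projT1 dQ) | enorm y <= 1 /\ C (y *m projT2 dQ)])
      / fine (vol [set y : 'rV[R]_(projT1 dQ) | enorm y <= 1])
  | right _ => 0
  end.

Definition int_angle n (F G : set 'rV[R]_n) : R :=
  let x := xget 0 (relint F) in
  ball_fraction (span [set g - x | g in G])
                [set v | exists t g, 0 <= t /\ G g /\ v = t *: (g - x)].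

Definition normal_cone n (P : set 'rV[R]_n) (x : 'rV[R]_n) : set 'rV[R]_n :=
  [set v | forall z, P z -> dotv v (z - x) <= 0].

Definition ext_angle n (G P : set 'rV[R]_n) : R :=
  let x := xget 0 (relint G) in
  ball_fraction (span (normal_cone P x)) (normal_cone P x).

(* w_i = f(i/n), i = 1..n; index i : 'I_n stands for i+1 *)
Definition wt (f : R -> R) n (i : 'I_n) : R := f ((i.+1)%:R / n%:R).

Definition wl1_ball (f : R -> R) n : set 'rV[R]_n :=
  [set x | \sum_(i < n) wt f i * `|x 0 i| <= 1].

Definition face0 (f : R -> R) n (m : nat) : set 'rV[R]_n :=
  [set x | exists c : 'I_n -> R,
     (forall i, 0 <= c i) /\ (forall i : 'I_n, (m <= i)%N -> c i = 0) /\
     \sum_(i < n) c i = 1 /\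
     x = \sum_(i < n) c i *: ((wt f i)^-1 *: (delta_mx 0 i : 'rV[R]_n))].

Definition RInt (a b : R) (g : R -> R) : R :=
  Rintegral (@lebesgue_measure R) `[a, b] g.

Definition Phi (s : R) : R :=
  (Num.sqrt (2 * pi))^-1 *
  Rintegral (@lebesgue_measure R) `]-oo, s] (fun t => expR (- (t ^+ 2) / 2)).

Definition erf (x : R) : R :=
  2 / Num.sqrt pi * RInt 0 x (fun t => expR (- (t ^+ 2))).

Definition lam (s : R) : R := s ^+ 2 / 2 + ln (2 * Phi s).

Definition psi_int (f : R -> R) (delta tau : R) : \bar R :=
  let c0 := RInt delta tau f in
  let c1 := RInt 0 delta (fun u => f u ^+ 2) in
  let lam0 := fun s => c0^-1 * RInt delta tau (fun u => lam (s * f u)) in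
  let lam0s := fun y => ereal_sup [set (s * y - lam0 s)%:E | s in [set: R]] in
  let eta := fun y => ((c0 ^+ 2 / (2 * c1) * y ^+ 2)%:E + c0%:E * lam0s y)%E in
  ((- ((tau - delta) * ln 2))%:E - ereal_inf [set eta y | y in [set: R]])%E.

Definition psi_ext (f : R -> R) (tau : R) : \bar R :=
  let c2 := RInt 0 tau (fun u => f u ^+ 2) in
  let zeta := fun x => c2 * x ^+ 2 - RInt tau 1 (fun u => ln (erf (x * f u))) in
  (- ereal_inf [set (zeta z)%:E | z in [set z0 : R | (0 < z0)%R]])%E.

End Defs.

Arguments face0 {R} f n m.
Arguments wl1_ball {R} f n.

(* Main.v *)
(** Both angles are fractions of a cone, and for a cone the unit ball may be
    replaced by a centred Gaussian weight, written in any basis of its span.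

    Internal angle: the density is [exp(-(|x|^2 + (sum a_j x_j)^2 / W^2) / 2)]
    over the orthant in the last [l - k] coordinates.  Bounding the concave term
    [- T^2 / (2 W^2)] by its tangent of slope [s] decouples the coordinates, and
    one-dimensional Gaussian integrals give the factors [2 Phi(s w_i)], i.e. the
    exponent [n (c_1 s^2 / 2 + int lambda(s f) - (tau - delta) log 2)].  At the
    minimiser [s <= 0] of the convex function [c_1 s^2 / 2 + int lambda(s f)] this
    is at most [psi_int] by Fenchel duality.

    External angle: slicing the normal cone by [t = v_i / w_i] on the face gives
    [int_(t >= 0) exp(- t^2 sum_(i <= l) w_i^2) prod_(i > l) erf(t w_i) dt] up to
    normalisation, whose integrand is at most a constant times [exp(-n zeta(t))].

    Monotonicity of [f] turns Riemann sums into integrals up to bounded errors. *)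
Require Import Defs.
From HB Require Import structures.
From mathcomp Require Import all_boot all_order all_algebra.
From mathcomp Require Import all_classical all_reals all_analysis.
From mathcomp Require Import measurable_realfun ring lra.
Set Implicit Arguments. Unset Strict Implicit. Unset Printing Implicit Defensive.
Import Order.TTheory GRing.Theory Num.Theory.
Import numFieldNormedType.Exports.
Local Open Scope classical_set_scope.
Local Open Scope ring_scope.

(** * Iterated Lebesgue integrals *)

(** The volume behind an angle is a nested integral over sequences, in coordinates of an orthonormal
    basis obtained by choice, so the computation must not depend on the basis. Determinants are
    avoided: an identity with two test functions, proved from Tonelli and translations, makes every
    Jacobian cancel in a quotient. The cone identities are cross-multiplied in the extended reals,
    and finiteness is settled before dividing.

    The sign of the minimiser [s] serves the internal Riemann sum: weights are sampled at right end
    points, and [u |-> lam (s * f u)] is non-increasing for [s <= 0], so the sum lies below the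
    integral. No derivative of [lam] is taken: its continuity and the optimality condition at [s]
    come from convexity inequalities.

    In the external sum the monotonicity goes the other way, and the boundary term must be bounded
    uniformly in the integration variable, down to 0 where the logarithm diverges; this is the role
    of the star-shapedness of [erf]. All remaining losses are constants or linear factors in [n],
    which [n * eps] absorbs. *)

Section IteratedIntegral.
Variable R : realType.
Local Notation mu := (@lebesgue_measure R).

(* One measurable space of sequences serves all dimensions, so that Tonelli can be
   proved by induction on the number of integrated coordinates. *)
Definition env_cylinders : set (set (nat -> R)) :=
  [set A | exists i B, measurable B /\ A = [set x | B (x i)]].

Definition env : Type := nat -> R.

HB.instance Definition _ := Pointed.on env.
HB.instance Definition _ := Measurable.copy env (g_sigma_algebraType env_cylinders).

Lemma measurable_env d (T : measurableType d) (h : T -> env) :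
  (forall i, measurable_fun [set: T] (fun t => h t i)) -> measurable_fun [set: T] h.
Proof.
move=> mh; apply: (@measurability _ _ T env setT h env_cylinders) => //.
move=> _ [_ [i [B [mB ->]]] <-].
exact: (mh i measurableT B mB).
Qed.

Lemma measurable_coord (i : nat) : measurable_fun [set: env] (fun x : env => x i).
Proof.
move=> _ B mB; rewrite setTI; apply: sub_sigma_algebra; by exists i, B.
Qed.

(** Convertible to the sequence that [iter_int] hands to its inner integral, so facts about [upd]
    apply to one unfolding of the recursion. *)
Definition upd (x : nat -> R) (j : nat) (t : R) : nat -> R :=
  fun i => if i == j then t else x i.

Lemma measurable_upd d (T : measurableType d) (h : T -> env) (u : T -> R) j :
  measurable_fun [set: T] h -> measurable_fun [set: T] u ->
  measurable_fun [set: T] (fun t => upd (h t) j (u t) : env).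
Proof.
move=> mh mu_; apply: measurable_env => i; rewrite /upd; case: eqP => // _.
exact: (measurableT_comp (measurable_coord i) mh).
Qed.

Lemma iter_int_ge0 d (g : env -> \bar R) (x : env) :
  (forall y, 0 <= g y)%E -> (0 <= iter_int d g x)%E.
Proof.
move=> g0; elim: d x => [|d IH] x //=; exact: integral_ge0.
Qed.

(** Measurability is joint in a parameter and in the base point, because the recursion changes the
    base point; each step is the measurability half of Tonelli's theorem. *)
Lemma measurable_iter_int d1 (T : measurableType d1) d (g : T * env -> \bar R) :
  measurable_fun [set: T * env] g -> (forall z, 0 <= g z)%E ->
  measurable_fun [set: T * env] (fun p => iter_int d (fun x => g (p.1, x)) p.2).
Proof.
move=> mg g0; elim: d => [|d IH] /=.
  by rewrite (_ : (fun _ => _) = g)//; apply/funext => -[].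
pose H (q : (T * env) * R) := iter_int d (fun x => g (q.1.1, x)) (upd q.1.2 d q.2).
apply: (@measurable_fun_fubini_tonelli_F _ _ _ _ R mu H).
- have mm : measurable_fun [set: (T * env) * R]
      (fun q : (T * env) * R => (q.1.1, upd q.1.2 d q.2 : env)).
    apply/measurable_fun_pair => /=.
      exact: (measurableT_comp measurable_fst measurable_fst).
    apply: measurable_upd => //; exact: (measurableT_comp measurable_snd measurable_fst).
  exact: (measurableT_comp IH mm).
- by move=> z; apply: iter_int_ge0.
Qed.

Lemma measurable_iter_int_env d (g : env -> \bar R) :
  measurable_fun [set: env] g -> (forall z, 0 <= g z)%E ->
  measurable_fun [set: env] (iter_int d g : env -> \bar R).
Proof.
move=> mg g0.
have := @measurable_iter_int _ R d (fun p => g p.2).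
move=> /(_ (measurableT_comp mg measurable_snd) (fun z => g0 z.2)) H.
have mm : measurable_fun [set: env] (fun x : env => (0 : R, x)).
  by apply/measurable_fun_pair.
exact: (measurableT_comp H mm).
Qed.

Lemma eq_iter_int d (g h : env -> \bar R) (x : env) :
  (forall y, g y = h y) -> iter_int d g x = iter_int d h x.
Proof. by move=> gh; congr iter_int; apply/funext. Qed.

(** The outer variable passes one coordinate at a time; each exchange is Tonelli in the plane,
    applied to the integral over the lower coordinates. *)
Lemma iter_int_tonelli d (g : R * env -> \bar R) (x0 : env) :
  measurable_fun [set: R * env] g -> (forall z, 0 <= g z)%E ->
  (\int[mu]_(t in [set: R]) iter_int d (fun x => g (t, x)) x0 =
   iter_int d (fun x => \int[mu]_(t in [set: R]) g (t, x)) x0)%E.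
Proof.
move=> mg g0; elim: d x0 => [|d IH] x0 //=.
pose H (q : R * R) := iter_int d (fun x => g (q.1, x)) (upd x0 d q.2).
have mH : measurable_fun [set: R * R] H.
  have mm : measurable_fun [set: R * R] (fun q : R * R => (q.1, upd x0 d q.2 : env)).
    apply/measurable_fun_pair => //=.
    by apply: measurable_upd.
  exact: (measurableT_comp (measurable_iter_int d mg g0) mm).
rewrite (@fubini_tonelli _ _ _ _ R mu mu H mH) /=; last first.
  by move=> z; apply: iter_int_ge0.
by apply: eq_integral => s _; rewrite -IH.
Qed.

Lemma iter_int_swap d e (g : env * env -> \bar R) (x0 y0 : env) :
  measurable_fun [set: env * env] g -> (forall z, 0 <= g z)%E ->
  iter_int d (fun x => iter_int e (fun y => g (x, y)) y0) x0 =
  iter_int e (fun y => iter_int d (fun x => g (x, y)) x0) y0.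
Proof.
move=> mg g0; elim: e y0 => [|e IH] y0 //=.
pose H (q : R * env) := iter_int e (fun y => g (q.2, y)) (upd y0 e q.1).
have mH : measurable_fun [set: R * env] H.
  have mm : measurable_fun [set: R * env] (fun q : R * env => (q.2, upd y0 e q.1 : env)).
    apply/measurable_fun_pair => //=.
    by apply: measurable_upd.
  exact: (measurableT_comp (measurable_iter_int e mg g0) mm).
rewrite -(iter_int_tonelli d (g := H)) //; last by move=> z; apply: iter_int_ge0.
by apply: eq_integral => s _; rewrite -IH.
Qed.

Lemma le_iter_int d (g h : env -> \bar R) (x : env) :
  measurable_fun [set: env] g -> measurable_fun [set: env] h ->
  (forall y, 0 <= g y)%E -> (forall y, g y <= h y)%E ->
  (iter_int d g x <= iter_int d h x)%E.
Proof.
move=> mg mh g0 gh; elim: d x => [|d IH] x //=.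
have mm : measurable_fun [set: R] (fun t : R => upd x d t : env).
  by apply: measurable_upd.
have h0 y : (0 <= h y)%E by apply: le_trans (gh y).
apply: ge0_le_integral => //.
- by move=> t _; apply: iter_int_ge0.
- exact: (measurableT_comp (measurable_iter_int_env d mg g0) mm).
- exact: (measurableT_comp (measurable_iter_int_env d mh h0) mm).
Qed.

Lemma iter_intZl d (g : env -> \bar R) (k : \bar R) (x : env) :
  measurable_fun [set: env] g -> (forall y, 0 <= g y)%E -> (0 <= k)%E ->
  (iter_int d (fun y => k * g y) x = k * iter_int d g x)%E.
Proof.
move=> mg g0 k0; elim: d x => [|d IH] x //=.
have mm : measurable_fun [set: R] (fun t : R => upd x d t : env).
  by apply: measurable_upd.
rewrite -ge0_integralZl //.
- by apply: eq_integral => t _; rewrite IH.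
- exact: (measurableT_comp (measurable_iter_int_env d mg g0) mm).
- by move=> t _; apply: iter_int_ge0.
Qed.

Lemma measurable_fun_shift (c : R) : measurable_fun [set: R] (fun t : R => t + c).
Proof. by apply: measurable_funD. Qed.

(** Both measures agree on half-open intervals, which determine Lebesgue measure. *)
Lemma lebesgue_measure_shift (c : R) (A : set R) : measurable A ->
  pushforward mu ((fun t => t + c) : _ -> measurableTypeR R) A = mu A.
Proof.
move=> mA.
pose mphi := isMeasurableFun.Build _ _ (measurableTypeR R) (measurableTypeR R) _
  (measurable_fun_shift c).
pose phi : {mfun measurableTypeR R >-> measurableTypeR R} :=
  HB.pack ((fun t => t + c) : measurableTypeR R -> measurableTypeR R) mphi.
apply/esym; apply: (@lebesgue_measure_unique R (pushforward mu phi)) mA.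
move=> _ [[a b] _ <-] /=.
rewrite /pushforward /=.
have -> : (fun t : R => t + c) @^-1` `]a, b] = `]a - c, b - c]%classic.
  by apply/seteqP; split => t /=; rewrite !in_itv /= ltrBlDr lerBrDr.
rewrite !lebesgue_measure_itv /= !lte_fin ltrD2r; case: ifP => // _.
by rewrite -!EFinB; congr EFin; ring.
Qed.

Lemma integral_shift (c : R) (h : R -> \bar R) :
  measurable_fun [set: R] h -> (forall t, 0 <= h t)%E ->
  (\int[mu]_(t in [set: R]) h (t + c)%R = \int[mu]_(t in [set: R]) h t)%E.
Proof.
move=> mh h0.
rewrite (_ : (\int[mu]_(t in [set: R]) h (t + c)%R)%E =
  \int[mu]_(t in ((fun t => (t + c)%R) : _ -> measurableTypeR R) @^-1` setT)
     (h \o (fun t => (t + c)%R)) t)%E; last by rewrite preimage_setT.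
rewrite -ge0_integral_pushforward //=.
- apply: eq_measure_integral; first exact: measurable_fun_shift.
  by move=> ? A mA _; exact: lebesgue_measure_shift.
- exact: measurable_fun_shift.
Qed.

(** The base point moves as well, because the coordinates from [d] on are read from it. *)
Lemma iter_int_shift d (g : env -> \bar R) (a x0 : env) :
  measurable_fun [set: env] g -> (forall y, 0 <= g y)%E ->
  iter_int d (fun x => g (fun i => x i + a i : R)) x0 =
  iter_int d g (fun i => x0 i + a i).
Proof.
move=> mg g0; elim: d x0 => [|d IH] x0 //=.
have mm : measurable_fun [set: R] (fun t : R => upd (fun i => x0 i + a i) d t : env).
  by apply: measurable_upd.
rewrite -[RHS](integral_shift (a d)) //.
- apply: eq_integral => t _; rewrite IH; congr iter_int; apply/funext => i.
  by rewrite /upd; case: (i =P d) => [->|].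
- exact: (measurableT_comp (measurable_iter_int_env d mg g0) mm).
- by move=> t; apply: iter_int_ge0.
Qed.

End IteratedIntegral.

(** * Integrals over row vectors and linear changes of variables *)

Section RowIntegral.
Variable R : realType.
Local Notation mu := (@lebesgue_measure R).

(** Integrating the first [d] coordinates never alters the others, so only sequences with the tail
    of [x] are visited. *)
Lemma eq_iter_int_tail d (g h : env R -> \bar R) (x : env R) :
  (forall y, (forall j, (d <= j)%N -> y j = x j) -> g y = h y) ->
  iter_int d g x = iter_int d h x.
Proof.
elim: d x => [|d IH] x gh /=; first exact: gh.
apply: eq_integral => t _; apply: IH => y yx; apply: gh => j dj.
by rewrite yx ?(ltnW dj)// gtn_eqF.
Qed.

Lemma iter_int_base m d (g : env R -> \bar R) (x y : env R) :
  (forall u v : env R, (forall j, (j < m)%N -> u j = v j) -> g u = g v) ->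
  (forall j, (d <= j < m)%N -> x j = y j) ->
  iter_int d g x = iter_int d g y.
Proof.
move=> gm; elim: d x y => [|d IH] x y xy /=.
  by apply: gm => j jm; apply: xy.
apply: eq_integral => t _; apply: IH => j /andP[dj jm].
by case: (j =P d) => // /eqP jd; apply: xy; rewrite jm andbT ltn_neqAle eq_sym jd.
Qed.

Definition env_row d (x : env R) : 'rV[R]_d := \row_(i < d) x i.

(** A section of [env_row], padding with zeros. Measurability of functions of rows is always
    expressed through sequences, and this map brings it back. *)
Definition row_env d (v : 'rV[R]_d) : env R := fun i => oapp (v 0) 0 (insub i).

Lemma row_envE d (v : 'rV[R]_d) (i : 'I_d) : row_env v i = v 0 i.
Proof. by rewrite /row_env valK. Qed.

Lemma row_envK d (v : 'rV[R]_d) : env_row d (row_env v) = v.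
Proof. by apply/rowP => i; rewrite mxE row_envE. Qed.

Definition row_int d (f : 'rV[R]_d -> \bar R) : \bar R :=
  iter_int d (fun x => f (env_row d x)) (fun _ => 0).
Arguments row_int d f : clear implicits.

Lemma measurable_row d d1 (T : measurableType d1) (f : 'rV[R]_d -> \bar R)
    (h : T -> 'rV[R]_d) :
  measurable_fun [set: env R] (fun x => f (env_row d x)) ->
  (forall i, measurable_fun [set: T] (fun t => h t 0 i)) ->
  measurable_fun [set: T] (fun t => f (h t)).
Proof.
move=> mf mh.
have mm : measurable_fun [set: T] (fun t => row_env (h t) : env R).
  apply: measurable_env => i; rewrite /row_env.
  by case: insubP => [j _ _|_] /=.
have := measurableT_comp mf mm.
by apply: eq_measurable_fun => t _ /=; rewrite row_envK.
Qed.

Lemma measurable_env_row d1 (T : measurableType d1) d (h : T -> env R) (i : 'I_d) :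
  measurable_fun [set: T] h -> measurable_fun [set: T] (fun t => env_row d (h t) 0 i).
Proof.
move=> mh; apply: (eq_measurable_fun (fun t => h t i)).
  by move=> t _; rewrite mxE.
exact: (measurableT_comp (measurable_coord i) mh).
Qed.

Lemma measurable_mulmx d1 (T : measurableType d1) d n (h : T -> 'rV[R]_d)
    (A : 'M[R]_(d, n)) (i : 'I_n) :
  (forall j, measurable_fun [set: T] (fun t => h t 0 j)) ->
  measurable_fun [set: T] (fun t => (h t *m A) 0 i).
Proof.
move=> mh; apply: (eq_measurable_fun (fun t => \sum_j h t 0 j * A j i)).
  by move=> t _; rewrite mxE.
by apply: measurable_sum => j; apply: measurable_funM.
Qed.

Lemma measurable_dotv d1 (T : measurableType d1) d (h : T -> 'rV[R]_d) :
  (forall j, measurable_fun [set: T] (fun t => h t 0 j)) ->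
  measurable_fun [set: T] (fun t => dotv (h t) (h t)).
Proof.
by move=> mh; apply: measurable_sum => j; apply: measurable_funM.
Qed.

Lemma row_int_ge0 d (f : 'rV[R]_d -> \bar R) :
  (forall y, 0 <= f y)%E -> (0 <= row_int d f)%E.
Proof. by move=> f0; apply: iter_int_ge0. Qed.

Lemma eq_row_int d (f g : 'rV[R]_d -> \bar R) : f =1 g -> row_int d f = row_int d g.
Proof. by move=> fg; apply: eq_iter_int. Qed.

Lemma le_row_int d (f g : 'rV[R]_d -> \bar R) :
  measurable_fun [set: env R] (fun x => f (env_row d x)) ->
  measurable_fun [set: env R] (fun x => g (env_row d x)) ->
  (forall y, 0 <= f y)%E -> (forall y, f y <= g y)%E ->
  (row_int d f <= row_int d g)%E.
Proof. by move=> mf mg f0 fg; apply: le_iter_int. Qed.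

Lemma row_intZl d (f : 'rV[R]_d -> \bar R) (k : \bar R) :
  measurable_fun [set: env R] (fun x => f (env_row d x)) ->
  (forall y, 0 <= f y)%E -> (0 <= k)%E ->
  (row_int d (fun y => k * f y) = k * row_int d f)%E.
Proof. by move=> mf f0 k0; apply: iter_intZl. Qed.

Lemma row_int_shift d (f : 'rV[R]_d -> \bar R) (a : 'rV[R]_d) :
  measurable_fun [set: env R] (fun x => f (env_row d x)) ->
  (forall y, 0 <= f y)%E ->
  row_int d (fun y => f (y + a)) = row_int d f.
Proof.
move=> mf f0; rewrite /row_int.
transitivity (iter_int d (fun x => (f \o env_row d) (fun i => x i + row_env a i : R))
    (fun _ => 0 : R)).
  apply: eq_iter_int => y /=; congr f; apply/rowP => i.
  by rewrite !mxE row_envE.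
rewrite (iter_int_shift d (g := f \o env_row d)) //; last by move=> y; exact: f0.
apply: (iter_int_base (m := d)) => [u v uv|j]; last by case: ltngtP.
by congr f; apply/rowP => i; rewrite !mxE uv.
Qed.

Lemma row_int_swap d e (g : 'rV[R]_d -> 'rV[R]_e -> \bar R) :
  measurable_fun [set: env R * env R] (fun z => g (env_row d z.1) (env_row e z.2)) ->
  (forall x y, 0 <= g x y)%E ->
  row_int d (fun x => row_int e (g x)) = row_int e (fun y => row_int d (g ^~ y)).
Proof.
move=> mg g0.
exact: (iter_int_swap d e (g := fun z => g (env_row d z.1) (env_row e z.2))).
Qed.

(* Uniqueness of Haar measure: Tonelli and translation invariance alone determine
   how [row_int] transforms under a linear automorphism, without determinants. *)
Lemma row_int_linear d (f g : 'rV[R]_d -> \bar R) (A : 'M[R]_d) :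
  A \in unitmx ->
  measurable_fun [set: env R] (fun x => f (env_row d x)) ->
  measurable_fun [set: env R] (fun x => g (env_row d x)) ->
  (forall y, 0 <= f y)%E -> (forall y, 0 <= g y)%E ->
  (row_int d (fun x => f (x *m A)) * row_int d g =
   row_int d f * row_int d (fun x => g (- (x *m A))%R))%E.
Proof.
move=> uA mf mg f0 g0.
have mid i : measurable_fun [set: env R] (fun x : env R => env_row d x 0 i).
  exact: (@measurable_env_row _ (env R) d id).
have mfA : measurable_fun [set: env R] (fun x => f (env_row d x *m A)).
  by apply: measurable_row => // i; apply: measurable_mulmx.
have mgA a : measurable_fun [set: env R] (fun x => g (a - env_row d x *m A)).
  apply: measurable_row => // i.
  apply: (eq_measurable_fun (fun x => a 0 i - (env_row d x *m A) 0 i)).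
    by move=> t _; rewrite !mxE.
  by apply: measurable_funB => //; apply: measurable_mulmx.
have mz1 i : measurable_fun [set: env R * env R] (fun z => env_row d z.1 0 i).
  exact: measurable_env_row.
have mz2 i : measurable_fun [set: env R * env R] (fun z => env_row d z.2 0 i).
  exact: measurable_env_row.
have mzA i : measurable_fun [set: env R * env R] (fun z => (env_row d z.1 *m A) 0 i).
  by apply: measurable_mulmx.
(* Translating [x] by [y A^-1] does not change the inner integral. After an exchange, translating
   [y] by [- x A], a second exchange and one more translation of [x] lead to the right-hand side. *)
transitivity (row_int d (fun y => row_int d (fun x => g y * f (x *m A + y)%R)))%E.
  rewrite -row_intZl //; last by apply: row_int_ge0.
  apply: eq_row_int => y; rewrite row_intZl //; last first.
    apply: measurable_row => // i.
    apply: (eq_measurable_fun (fun x => (env_row d x *m A) 0 i + y 0 i)).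
      by move=> t _; rewrite !mxE.
    by apply: measurable_funD => //; apply: measurable_mulmx.
  rewrite muleC; congr (_ * _)%E.
  rewrite -(row_int_shift (y *m invmx A)) //.
  by apply: eq_row_int => x; rewrite mulmxDl mulmxKV.
rewrite -row_int_swap; last first.
- by move=> x y; apply: mule_ge0.
- apply: emeasurable_funM; first exact: measurable_row.
  apply: measurable_row => // i.
  apply: (eq_measurable_fun (fun z => (env_row d z.1 *m A) 0 i + env_row d z.2 0 i)).
    by move=> t _; rewrite [in RHS]mxE.
  by apply: measurable_funD.
transitivity (row_int d (fun x => row_int d (fun y => f y * g (y - x *m A)%R)))%E.
  apply: eq_row_int => x.
  rewrite -[RHS](row_int_shift (x *m A)).
  - by apply: eq_row_int => y; rewrite muleC addrK addrC.
  - apply: emeasurable_funM => //; apply: measurable_row => // i.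
    apply: (eq_measurable_fun (fun y => env_row d y 0 i - (x *m A) 0 i)).
      by move=> t _; rewrite [in RHS]mxE; congr (_ + _); rewrite [RHS]mxE.
    by apply: measurable_funB.
  - by move=> y; apply: mule_ge0.
rewrite row_int_swap; last first.
- by move=> x y; apply: mule_ge0.
- apply: emeasurable_funM; first exact: measurable_row.
  apply: measurable_row => // i.
  apply: (eq_measurable_fun (fun z => env_row d z.2 0 i - (env_row d z.1 *m A) 0 i)).
    by move=> t _; rewrite [in RHS]mxE; congr (_ + _); rewrite [RHS]mxE.
  by apply: measurable_funB.
rewrite muleC -row_intZl //; last by apply: row_int_ge0.
apply: eq_row_int => y; rewrite row_intZl // muleC; congr (_ * _)%E.
rewrite -[RHS](row_int_shift (- (y *m invmx A))) //.
  by apply: eq_row_int => x; rewrite mulmxDl mulNmx mulmxKV // opprD opprK addrC.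
have := mgA 0; by apply: eq_measurable_fun => x _; rewrite sub0r.
Qed.

End RowIntegral.

Arguments row_int {R} d f.

(** * One-dimensional integrals, products and the exponential layer cake *)

Section OneDim.
Variable R : realType.
Local Notation mu := (@lebesgue_measure R).

(** A zero integral would make [h] vanish almost everywhere, and [[a, b]] would be negligible in
    spite of its length [b - a]. *)
Lemma integral_itv_gt0 (h : R -> \bar R) (a b : R) :
  measurable_fun [set: R] h -> (forall t, 0 <= h t)%E -> a < b ->
  (forall t, (a <= t <= b)%R -> 0 < h t)%E ->
  (0 < \int[mu]_(t in [set: R]) h t)%E.
Proof.
move=> mh h0 ab hab; rewrite lt_neqAle integral_ge0// andbT eq_sym.
apply/negP => /eqP h00.
have : (\int[mu]_(t in [set: R]) `|h t| = 0)%E.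
  by rewrite -h00; apply: eq_integral => t _; rewrite gee0_abs.
move=> /(ae_eq_integral_abs mu measurableT mh).1 H.
have : mu.-negligible `[a, b].
  apply: negligibleS H => t /=; rewrite in_itv /= => /hab ht.
  by move=> /(_ I) ht0; move: ht; rewrite ht0 ltxx.
move=> /negligibleP => /(_ (measurable_itv _)) mu0.
have := lebesgue_measure_itv `[a, b]; rewrite /= lte_fin ab mu0 -EFinB => -[] /esym/eqP.
by rewrite subr_eq0 gt_eqF.
Qed.

Lemma iter_int_gt0 d (g : env R -> \bar R) (lo hi : nat -> R) (x : env R) :
  measurable_fun [set: env R] g -> (forall y, 0 <= g y)%E ->
  (forall j, (j < d)%N -> lo j < hi j) ->
  (forall y : env R, (forall j, (j < d)%N -> lo j <= y j <= hi j) ->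
     (forall j, (d <= j)%N -> y j = x j) -> (0 < g y)%E) ->
  (0 < iter_int d g x)%E.
Proof.
move=> mg g0; elim: d x => [|d IH] x lohi gy /=; first exact: gy.
apply: (@integral_itv_gt0 _ (lo d) (hi d)).
- have mm : measurable_fun [set: R] (fun t : R => upd x d t : env R).
    by apply: measurable_upd.
  exact: (measurableT_comp (measurable_iter_int_env d mg g0) mm).
- by move=> t; apply: iter_int_ge0.
- exact: lohi.
- move=> t tlohi; apply: IH => [j jd|y ylohi yx]; first by apply: lohi; apply: ltnW.
  apply: gy => j.
  + rewrite ltnS leq_eqVlt => /orP[/eqP ->|]; last exact: ylohi.
    by rewrite yx// eqxx.
  + by move=> dj; rewrite yx ?(ltnW dj)// gtn_eqF.
Qed.

(** Partial integration, [m <= D], is the form the induction needs: integrated coordinates leave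
    constants, the others stay as factors. *)
Lemma iter_int_prod (phi : nat -> R -> R) (c : nat -> R) D m (x : env R) :
  (forall j t, 0 <= phi j t) -> (forall j, measurable_fun [set: R] (phi j)) ->
  (forall j, (j < D)%N -> \int[mu]_(t in [set: R]) (phi j t)%:E = (c j)%:E)%E ->
  (m <= D)%N ->
  iter_int m (fun x => (\prod_(0 <= j < D) phi j (x j))%:E) x =
  ((\prod_(0 <= j < m) c j) * \prod_(m <= j < D) phi j (x j))%:E.
Proof.
move=> phi0 mphi intphi; elim: m x => [|m IH] x mD /=.
  by rewrite [in RHS]big_geq// mul1r.
have c0 j : (j < D)%N -> 0 <= c j.
  by move=> jD; rewrite -lee_fin -intphi//; apply: integral_ge0 => t _; rewrite lee_fin.
transitivity (\int[mu]_(t in [set: R])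
  ((\prod_(0 <= j < m) c j * \prod_(m.+1 <= j < D) phi j (x j))%:E * (phi m t)%:E))%E.
  apply: eq_integral => t _; rewrite IH ?(ltnW mD)// -EFinM; congr EFin.
  rewrite (big_ltn mD) eqxx (mulrC (phi m t)) mulrA; congr (_ * _ * _).
  by apply: eq_big_nat => j /andP[mj _]; rewrite gtn_eqF.
rewrite ge0_integralZl_EFin//.
- by rewrite intphi// -EFinM big_nat_recr//= -!mulrA; congr (_ * _)%:E; rewrite mulrC.
- by move=> t _; rewrite lee_fin.
- by apply/measurable_EFinP; exact: mphi.
- rewrite mulr_ge0//; last by rewrite prodr_ge0.
  rewrite big_mkord prodr_ge0// => i _; apply: c0.
  exact: ltn_trans (ltn_ord i) mD.
Qed.

Lemma measurable_prod_coord (phi : nat -> R -> R) D :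
  (forall j, measurable_fun [set: R] (phi j)) ->
  measurable_fun [set: env R] (fun x : env R => \prod_(0 <= j < D) phi j (x j)).
Proof.
move=> mphi; elim: D => [|D IH].
  by apply: (eq_measurable_fun (fun _ : env R => 1 : R)) => // t _; rewrite big_geq.
apply: (eq_measurable_fun (fun x : env R => (\prod_(0 <= j < D) phi j (x j)) * phi D (x D))).
  by move=> t _; rewrite big_nat_recr.
apply: measurable_funM => //.
exact: (measurableT_comp (mphi D) (measurable_coord D)).
Qed.

Lemma measurable_quad (a m : R) : measurable_fun [set: R] (fun t => expR (- (a * (t - m) ^+ 2))).
Proof.
apply: measurableT_comp => //; apply: measurableT_comp => //.
by apply: measurable_funM => //; apply: measurable_funX; apply: measurable_funB.
Qed.

Lemma integral_gauss_affine (a m : R) : 0 < a ->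
  (\int[mu]_(t in [set: R]) (expR (- (a * (t - m) ^+ 2)))%:E = (Num.sqrt (pi / a))%:E)%E.
Proof.
(* The normal density of standard deviation [s] has exponent
   [- (t - m)^2 / (2 s^2) = - a (t - m)^2]. *)
move=> a0; pose s := Num.sqrt ((2 * a)^-1).
have s0 : 0 < s by rewrite sqrtr_gt0 invr_gt0 mulr_gt0.
have sE : s ^+ 2 = (2 * a)^-1 by rewrite sqr_sqrtr// invr_ge0 mulr_ge0// ltW.
have sn : s != 0 by rewrite gt_eqF.
have pk : (normal_peak s) = (Num.sqrt (pi / a))^-1.
  congr (_^-1); congr Num.sqrt; rewrite sE; field; rewrite gt_eqF//.
have q0 : 0 < Num.sqrt (pi / a) by rewrite sqrtr_gt0 divr_gt0// pi_gt0.
transitivity (\int[mu]_(t in [set: R]) ((Num.sqrt (pi / a))%:E * (normal_pdf m s t)%:E))%E.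
  apply: eq_integral => t _; rewrite -EFinM; congr EFin.
  rewrite normal_pdfE// pk mulVKf ?gt_eqF// /normal_fun sE; congr expR.
  by field; rewrite gt_eqF.
rewrite ge0_integralZl_EFin//.
- by rewrite integral_normal_pdf mule1.
- by move=> t _; rewrite lee_fin normal_pdf_ge0.
- by apply/measurable_EFinP; exact: measurable_normal_pdf.
Qed.

Lemma integral_expN_ge0 :
  (\int[mu]_(s in [set: R]) (expR (- s) * (0 <= s)%R%:R)%:E = 1)%E.
Proof.
rewrite -[RHS](@integral_exponential_pdf R 1 ltr01).
apply: eq_integral => s _; rewrite /exponential_pdf patchE mem_setE in_itv /= andbT.
by case: (0 <= s)%R; rewrite ?mulr1 ?mulr0// mul1r mulN1r.
Qed.

Lemma integral_expN_gt0 :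
  (\int[mu]_(s in [set: R]) (expR (- s) * (0 < s)%R%:R)%:E = 1)%E.
Proof.
have mexp A : measurable A -> measurable_fun A (fun s : R => (expR (- s))%:E).
  move=> mA; apply/measurable_EFinP; apply: measurable_funTS.
  by apply: measurableT_comp => //; apply: measurableT_comp.
rewrite -integral_expN_ge0.
transitivity (\int[mu]_(s in `]0%R, +oo[) (expR (- s))%:E)%E.
  rewrite [RHS]integral_mkcond; apply: eq_integral => s _.
  rewrite patchE mem_setE in_itv /= andbT.
  by case: (0 < s)%R; rewrite ?mulr1 ?mulr0.
rewrite integral_itv_obnd_cbnd; last exact: mexp.
rewrite integral_mkcond; apply: eq_integral => s _.
rewrite patchE mem_setE in_itv /= andbT.
by case: (0 <= s)%R; rewrite ?mulr1 ?mulr0.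
Qed.

(* The condition [0 < s] keeps the degenerate ball of radius 0 out of the layers. *)
Lemma layer_cake_exp (a : R) : 0 <= a ->
  (\int[mu]_(s in [set: R]) (expR (- s) * ((0 < s)%R && (a <= s)%R)%:R)%:E = (expR (- a))%:E)%E.
Proof.
rewrite le_eqVlt => /orP[/eqP <-|a0].
  rewrite oppr0 expR0 -[RHS]integral_expN_gt0; apply: eq_integral => s _.
  by rewrite andb_idr// => /ltW.
have mexp : measurable_fun [set: R] (fun s : R => expR (- s) * (0 <= s)%R%:R).
  apply: measurable_funM.
    by apply: measurableT_comp => //; apply: measurableT_comp.
  have -> : (fun s : R => (0 <= s)%R%:R) = \1_(`[0, +oo[) :> (R -> R).
    by apply/funext => s; rewrite indicE mem_setE in_itv /= andbT.
  exact: measurable_indic.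
rewrite -[RHS]mule1 -integral_expN_ge0 -ge0_integralZl_EFin ?expR_ge0//; last exact/measurable_EFinP.
rewrite -[RHS](integral_shift (- a)).
- apply: eq_integral => s _; rewrite -EFinM mulrA -expRD; congr (expR _ * _)%:E; first by ring.
  rewrite subr_ge0; congr (nat_of_bool _)%:R.
  by apply: andb_idl; exact: lt_le_trans.
- by apply: measurable_funeM; exact/measurable_EFinP.
- by move=> t; rewrite -EFinM lee_fin !mulr_ge0 ?expR_ge0.
Qed.

End OneDim.

(** * Cones and Gaussian weights *)

Section GaussianWeight.
Variable R : realType.
Local Notation mu := (@lebesgue_measure R).

Lemma dotvE n (x y : 'rV[R]_n) : dotv x y = (x *m y^T) 0 0.
Proof. by rewrite mxE; apply: eq_bigr => i _; rewrite mxE. Qed.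

Lemma dotvZ n (a : R) (x : 'rV[R]_n) : dotv (a *: x) (a *: x) = a ^+ 2 * dotv x x.
Proof. by rewrite /dotv mulr_sumr; apply: eq_bigr => i _; rewrite !mxE; ring. Qed.

Lemma dotvN n (x : 'rV[R]_n) : dotv (- x) (- x) = dotv x x.
Proof. by apply: eq_bigr => i _; rewrite !mxE mulrNN. Qed.

Lemma dotv_ge0 n (x : 'rV[R]_n) : 0 <= dotv x x.
Proof. by apply: sumr_ge0 => i _; rewrite -expr2 sqr_ge0. Qed.

Lemma enorm_le1 n (x : 'rV[R]_n) : (enorm x <= 1) = (dotv x x <= 1).
Proof. by rewrite /enorm -[X in _ <= X]sqrtr1 ler_sqrt. Qed.

Lemma dotv_onb d n (Q : 'M[R]_(d, n)) (y : 'rV[R]_d) :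
  Q *m Q^T = 1%:M -> dotv (y *m Q) (y *m Q) = dotv y y.
Proof. by move=> QQ; rewrite !dotvE trmx_mul mulmxA -(mulmxA y) QQ mulmx1. Qed.

(** Gram-Schmidt, as a matrix acting on the left: the lower rows are orthonormal by induction, the
    top row [b] is made orthogonal to them and normalised. The remainder [b'] is nonzero because it
    is a combination of the rows of [B] in which [b] has coefficient 1. *)
Lemma onb_exists d n (B : 'M[R]_(d, n)) : row_free B ->
  exists A : 'M[R]_d, (A *m B) *m (A *m B)^T = 1%:M.
Proof.
elim: d B => [|d IH] B fB; first by exists 0; apply/matrixP => -[].
rewrite -[d.+1]/(1 + d)%N in B fB *.
pose b := usubmx B; pose B' := dsubmx B.
have BE : B = col_mx b B' by rewrite vsubmxK.
have fB' : row_free B'.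
  apply/row_freeP; move/row_freeP: fB => [C BC].
  exists (rsubmx C).
  move: BC; rewrite BE -[C]hsubmxK mul_col_row.
  rewrite scalar_mx_block => /eq_block_mx[_ _ _].
  by rewrite hsubmxK.
have [A' AA] := IH B' fB'.
set Q := A' *m B' in AA.
pose b' := b - (b *m Q^T) *m Q.
have b'Q : b' *m Q^T = 0 by rewrite mulmxBl -(mulmxA _ Q) AA mulmx1 subrr.
have b'E : b' = row_mx 1%:M (- (b *m Q^T *m A')) *m B.
  by rewrite /b' BE mul_row_col mul1mx mulNmx -(mulmxA _ A' B').
have b'0 : 0 < dotv b' b'.
  rewrite lt_neqAle dotv_ge0 andbT eq_sym; apply/negP => /eqP b'0.
  have {}b'0 : b' = 0.
    apply/rowP => i; rewrite [RHS]mxE; apply/eqP; rewrite -sqrf_eq0 expr2; apply/eqP.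
    apply: (psumr_eq0P _ b'0) => // j _; by rewrite -expr2 sqr_ge0.
  have E : row_mx 1%:M (- (b *m Q^T *m A')) = 0.
    by apply: (row_free_inj fB); rewrite -b'E b'0 mul0mx.
  move/rowP: E => /(_ (lshift d ord0)).
  by rewrite row_mxEl !mxE eqxx => /eqP; rewrite oner_eq0.
pose r := (Num.sqrt (dotv b' b'))^-1.
pose A : 'M[R]_(1 + d) := col_mx (r *: row_mx 1%:M (- (b *m Q^T *m A'))) (row_mx 0 A').
have AB : A *m B = col_mx (r *: b') Q.
  rewrite mul_col_mx -scalemxAl -b'E; congr col_mx.
  by rewrite BE mul_row_col mul0mx add0r.
exists A; rewrite AB tr_col_mx mul_col_row AA.
rewrite -(scalemxAl r b' Q^T) b'Q scaler0.
have -> : Q *m (r *: b')^T = 0.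
  by rewrite -[LHS]trmxK trmx_mul trmxK -scalemxAl b'Q scaler0 trmx0.
rewrite scalar_mx_block; congr block_mx.
apply/rowP => i; rewrite ord1 -dotvE dotvZ mxE eqxx mulr1n.
by rewrite /r exprVn sqr_sqrtr ?ltW// mulVf// gt_eqF.
Qed.

Definition gauss_weight n (kappa : R) (v : 'rV[R]_n) : R := expR (- (kappa * dotv v v)).

Lemma measurable_gauss_weight d1 (T : measurableType d1) n kappa (h : T -> 'rV[R]_n) :
  (forall i, measurable_fun [set: T] (fun t => h t 0 i)) ->
  measurable_fun [set: T] (fun t => gauss_weight kappa (h t)).
Proof.
move=> mh; apply: measurableT_comp => //; apply: measurableT_comp => //.
by apply: measurable_funM => //; exact: measurable_dotv.
Qed.

Lemma measurable_row_coord d (i : 'I_d) :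
  measurable_fun [set: env R] (fun x : env R => env_row d x 0 i).
Proof. exact: (@measurable_env_row _ _ (env R) d id). Qed.

Lemma row_int_gauss d (kappa : R) : 0 < kappa ->
  exists2 c : R, 0 < c & row_int d (fun y => (gauss_weight kappa y)%:E) = c%:E.
Proof.
move=> k0; exists (Num.sqrt (pi / kappa) ^+ d).
  by rewrite exprn_gt0// sqrtr_gt0 divr_gt0// pi_gt0.
pose phi (j : nat) (t : R) := expR (- (kappa * (t - 0) ^+ 2)).
have := @iter_int_prod R phi (fun=> Num.sqrt (pi / kappa)) d d (fun=> 0).
move=> /(_ (fun j t => expR_ge0 _) (fun j => measurable_quad kappa 0)).
move=> /(_ (fun j _ => integral_gauss_affine 0 k0) (leqnn d)).
rewrite [X in (_ * X)%:E]big_geq// mulr1 prodr_const_nat subn0 => <-.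
apply: eq_iter_int => x; congr EFin.
rewrite big_mkord -expR_sum; congr expR.
rewrite sumrN; congr (- _); rewrite mulr_sumr; apply: eq_bigr => i _.
by rewrite mxE subr0 expr2.
Qed.

(** For [s > 0] this is the part of [K] where the Gaussian weight is at least [exp(-s)]. *)
Definition ball_layer d (K : set 'rV[R]_d) (kappa s : R) (y : 'rV[R]_d) : R :=
  \1_K y * ((0 < s) && (kappa * dotv y y <= s))%:R.

Section Cone.
Variables (d : nat) (K : set 'rV[R]_d) (kappa : R).
Hypothesis mK : measurable [set x : env R | K (env_row d x)].
Hypothesis k0 : 0 < kappa.

Lemma measurable_cone_indic : measurable_fun [set: env R] (fun x => \1_K (env_row d x) : R).
Proof. exact: (measurable_indic mK). Qed.

Lemma measurable_ball_layer :
  measurable_fun [set: R * env R] (fun z => ball_layer K kappa z.1 (env_row d z.2)).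
Proof.
apply: measurable_funM.
  exact: (measurableT_comp measurable_cone_indic measurable_snd).
pose S := [set z : R * env R | (0 < z.1) && (kappa * dotv (env_row d z.2) (env_row d z.2) <= z.1)].
suff mS : measurable S.
  apply: (eq_measurable_fun (\1_S : _ -> R)); last exact: measurable_indic.
  by move=> z _; rewrite indicE; congr (nat_of_bool _)%:R; apply/idP/idP; rewrite inE.
have md : measurable_fun [set: R * env R]
    (fun z => kappa * dotv (env_row d z.2) (env_row d z.2)).
  apply: measurable_funM => //; apply: measurable_dotv => i.
  exact: (measurableT_comp (measurable_row_coord i) measurable_snd).
have -> : S = [set z | 0 < z.1] `&` [set z | kappa * dotv (env_row d z.2) (env_row d z.2) <= z.1].
  by apply/seteqP; split => z /= /andP.
apply: measurableI; rewrite -[X in measurable X]setTI.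
  by apply: measurable_fun_ltr.
by apply: measurable_fun_ler.
Qed.

Lemma ball_layer_ge0 s y : 0 <= ball_layer K kappa s y.
Proof. by rewrite mulr_ge0. Qed.

Lemma measurable_ball_layer_row s :
  measurable_fun [set: env R] (fun x => (ball_layer K kappa s (env_row d x))%:E).
Proof.
apply/measurable_EFinP.
have mm : measurable_fun [set: env R] (fun x : env R => (s, x)).
  by apply/measurable_fun_pair.
exact: (measurableT_comp measurable_ball_layer mm).
Qed.

Lemma measurable_expRN : measurable_fun [set: R] (fun s : R => expR (- s)).
Proof. by apply: measurableT_comp => //; apply: measurableT_comp. Qed.

(** [exp(-a)] is the integral of [exp(-s)] over [s >= a]; with [a = kappa |y|^2], Tonelli moves the
    layer variable [s] outside. *)
Lemma gauss_layers :
  row_int d (fun y => (\1_K y * gauss_weight kappa y)%:E) =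
  (\int[mu]_(s in [set: R]) ((expR (- s))%:E *
     row_int d (fun y => (ball_layer K kappa s y)%:E)))%E.
Proof.
transitivity (\int[mu]_(s in [set: R])
    row_int d (fun y => (expR (- s))%:E * (ball_layer K kappa s y)%:E))%E; last first.
  apply: eq_integral => s _; rewrite row_intZl//.
  - exact: measurable_ball_layer_row.
  - by move=> y; rewrite lee_fin ball_layer_ge0.
rewrite [RHS](@iter_int_tonelli R d (fun z => (expR (- z.1))%:E * (ball_layer K kappa z.1 (env_row d z.2))%:E)%E).
- apply: eq_iter_int => x; set y := env_row d x.
  rewrite /gauss_weight EFinM -layer_cake_exp; last by rewrite mulr_ge0 ?(ltW k0) ?dotv_ge0.
  rewrite -ge0_integralZl_EFin//=.
  + by apply: eq_integral => s _; rewrite -!EFinM /ball_layer; congr EFin; ring.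
  + apply/measurable_EFinP; apply: measurable_funM; first exact: measurable_expRN.
    pose S := [set s : R | (0 < s) && (kappa * dotv y y <= s)].
    suff mS : measurable S.
      apply: (eq_measurable_fun (\1_S : _ -> R)); last exact: measurable_indic.
      by move=> z _; rewrite indicE; congr (nat_of_bool _)%:R; apply/idP/idP; rewrite inE.
    have -> : S = `]0, +oo[ `&` `[kappa * dotv y y, +oo[.
      by apply/seteqP; split => z /=; rewrite !in_itv/= !andbT => /andP.
    by apply: measurableI; exact: measurable_itv.
- apply: emeasurable_funM; apply/measurable_EFinP; last exact: measurable_ball_layer.
  exact: (measurableT_comp measurable_expRN measurable_fst).
- by move=> z; rewrite -EFinM lee_fin mulr_ge0 ?expR_ge0 ?ball_layer_ge0.
Qed.

End Cone.
End GaussianWeight.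

(** * The fraction of a ball covered by a cone, computed with a Gaussian *)

Section BallFraction.
Variable R : realType.
Local Notation mu := (@lebesgue_measure R).

Definition unit_ball_indic d (K : set 'rV[R]_d) (y : 'rV[R]_d) : R :=
  \1_K y * (dotv y y <= 1)%R%:R.

Lemma unit_ball_layer d (K : set 'rV[R]_d) : unit_ball_indic K = ball_layer K 1 1.
Proof. by apply/funext => y; rewrite /ball_layer ltr01 mul1r. Qed.

Lemma measurable_unit_ball_indic d (K : set 'rV[R]_d) :
  measurable [set x : env R | K (env_row d x)] ->
  measurable_fun [set: env R] (fun x => (unit_ball_indic K (env_row d x))%:E).
Proof. by move=> mK; rewrite unit_ball_layer; apply: measurable_ball_layer_row. Qed.

Lemma unit_ball_indic_ge0 d (K : set 'rV[R]_d) y : 0 <= unit_ball_indic K y.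
Proof. by rewrite mulr_ge0. Qed.

Lemma vol_unit_ball d (K : set 'rV[R]_d) :
  vol [set y | enorm y <= 1 /\ K y] = row_int d (fun y => (unit_ball_indic K y)%:E).
Proof.
apply: eq_iter_int => x; congr EFin; rewrite -/(env_row d x) /unit_ball_indic.
rewrite !indicE -natrM mulnb; congr (nat_of_bool _)%:R.
by apply/idP/andP; rewrite !inE /= enorm_le1 => -[].
Qed.

Lemma row_int_unit_ball d :
  exists2 c : R, 0 < c & row_int d (fun y => (unit_ball_indic [set: 'rV[R]_d] y)%:E) = c%:E.
Proof.
have mb := @measurable_unit_ball_indic d setT (@measurableT _ (env R)).
set I := row_int d _.
(* The cube of side [1 / (d + 1)] lies in the unit ball, as [y_i^2 <= y_i] there; the extra 1 also
   covers [d = 0]. *)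
have I0 : (0 < I)%E.
  rewrite /I /row_int; apply: (@iter_int_gt0 R d _ (fun=> 0) (fun=> d.+1%:R^-1)) => //.
  - by move=> y; rewrite lee_fin unit_ball_indic_ge0.
  - move=> y yd _; rewrite lte_fin /unit_ball_indic indicT mul1r.
    suff -> : dotv (env_row d y) (env_row d y) <= 1 by [].
    apply: (@le_trans _ _ (\sum_(i < d) d.+1%:R^-1)).
      apply: ler_sum => i _; have /andP[y0 y1] := yd i (ltn_ord i).
      rewrite mxE; apply: le_trans y1; rewrite ler_piMr//.
      have /andP[_ /le_trans] := yd i (ltn_ord i); apply.
      by rewrite invf_le1// ler1n.
    by rewrite sumr_const card_ord -[X in X <= _]mulr_natl ler_pdivrMr// mul1r ler_nat.
have [c c0 cE] := @row_int_gauss R d 1 ltr01.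
(* On the unit ball [e * exp(- |y|^2) >= 1], which gives finiteness by comparison with the
   Gaussian. *)
have : (I <= (expR 1 * c)%:E)%E.
  rewrite EFinM -cE -row_intZl//; last 2 first.
  - apply/measurable_EFinP; apply: measurable_gauss_weight => i.
    exact: measurable_row_coord.
  - by move=> y; rewrite lee_fin expR_ge0.
  apply: le_row_int => //.
  - apply: measurable_funeM; apply/measurable_EFinP; apply: measurable_gauss_weight => i.
    exact: measurable_row_coord.
  - by move=> y; rewrite lee_fin unit_ball_indic_ge0.
  - move=> y; rewrite -EFinM lee_fin /unit_ball_indic indicT mul1r /gauss_weight -expRD mul1r.
    have [y1|_] := leP (dotv y y) 1; last exact: expR_ge0.
    by apply: le_trans (expR_ge1Dx _); rewrite lerDl subr_ge0.
case: I I0 => [r| |]//; first by rewrite lte_fin => r0 _; exists r.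
Qed.

(** By homogeneity every layer of [K] is a dilate of the part of [K] in the unit ball, and the whole
    space scales in the same ratio; integrating over the layers preserves the proportion. Products
    replace quotients because finiteness of the integrals over [K] is not yet known. *)
Lemma cone_gauss_fraction d (K : set 'rV[R]_d) (kappa : R) : 0 < kappa ->
  measurable [set x : env R | K (env_row d x)] ->
  (forall t y, 0 < t -> K y -> K (t *: y)) ->
  (row_int d (fun y => (unit_ball_indic K y)%:E) *
     row_int d (fun y => (gauss_weight kappa y)%:E) =
   row_int d (fun y => (\1_K y * gauss_weight kappa y)%:E) *
     row_int d (fun y => (unit_ball_indic [set: 'rV[R]_d] y)%:E))%E.
Proof.
move=> k0 mK cK.
have mT := @measurableT _ (env R).
have cKE t y : 0 < t -> K (t *: y) <-> K y.
  move=> t0; split => [|/cK]; last exact.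
  move=> /(cK t^-1); rewrite scalerA mulVf ?gt_eqF// scale1r invr_gt0; exact.
have layer0 (L : set 'rV[R]_d) s : s <= 0 ->
    row_int d (fun y => (ball_layer L kappa s y)%:E) = 0%E.
  move=> s0; rewrite -[RHS](mul0e (row_int d (fun=> 0%E))) -row_intZl//.
  by apply: eq_row_int => y; rewrite /ball_layer ltNge s0/= mulr0 mul0e.
(* The dilation by [r = sqrt (s / kappa)] carries the unit ball onto the layer at [s]. Using the
   layer of the whole space as second function in [row_int_linear] cancels the factor [r ^ d]
   without computing it. *)
have scale s : (row_int d (fun y => (unit_ball_indic K y)%:E) *
     row_int d (fun y => (ball_layer [set: 'rV[R]_d] kappa s y)%:E) =
   row_int d (fun y => (ball_layer K kappa s y)%:E) *
     row_int d (fun y => (unit_ball_indic [set: 'rV[R]_d] y)%:E))%E.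
  have [s0|s0] := leP s 0; first by rewrite !layer0// mule0 mul0e.
  pose r := Num.sqrt (s / kappa).
  have r0 : 0 < r by rewrite sqrtr_gt0 divr_gt0.
  have r2 : kappa * r ^+ 2 = s by rewrite sqr_sqrtr ?divr_ge0 ?ltW// mulrC divfK// gt_eqF.
  have layerE (L : set 'rV[R]_d) y : (forall t z, 0 < t -> L (t *: z) <-> L z) ->
      ball_layer L kappa s (r *: y) = unit_ball_indic L y.
    move=> cL; rewrite /ball_layer /unit_ball_indic s0 dotvZ mulrA r2.
    rewrite -[X in (_ * _ <= X)]mulr1 ler_pM2l//; congr (_ * _).
    by rewrite !indicE; congr (nat_of_bool _)%:R; apply/idP/idP; rewrite !inE cL.
  have uA : (r%:M : 'M[R]_d) \in unitmx.
    by rewrite unitmxE det_scalar unitfE expf_neq0// gt_eqF.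
  have := @row_int_linear R d (fun y => (ball_layer K kappa s y)%:E)
    (fun y => (ball_layer [set: 'rV[R]_d] kappa s y)%:E) _ uA
    (measurable_ball_layer_row kappa mK s)
    (@measurable_ball_layer_row R d setT kappa mT s).
  move=> /(_ (fun y => ball_layer_ge0 K kappa s y)).
  move=> /(_ (fun y => ball_layer_ge0 [set: 'rV[R]_d] kappa s y)) H.
  transitivity (row_int d (fun x => (ball_layer K kappa s (x *m r%:M))%:E) *
     row_int d (fun y => (ball_layer [set: 'rV[R]_d] kappa s y)%:E))%E.
    by congr (_ * _)%E; apply: eq_row_int => y; rewrite mul_mx_scalar layerE.
  rewrite H; congr (_ * _)%E; apply: eq_row_int => y; rewrite mul_mx_scalar.
  by rewrite -scalerN layerE// /unit_ball_indic dotvN !indicT.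
have mlay (L : set 'rV[R]_d) : measurable [set x : env R | L (env_row d x)] ->
    measurable_fun [set: R] (fun s => row_int d (fun y => (ball_layer L kappa s y)%:E)).
  move=> mL.
  have := @measurable_iter_int R _ R d (fun z => (ball_layer L kappa z.1 (env_row d z.2))%:E).
  have mb : measurable_fun [set: R * env R] (fun z => (ball_layer L kappa z.1 (env_row d z.2))%:E).
    by apply/measurable_EFinP; exact: measurable_ball_layer.
  move=> /(_ mb (fun z => ball_layer_ge0 _ _ _ _)) mi.
  have mm : measurable_fun [set: R] (fun s : R => (s, (fun _ => 0) : env R)).
    by apply/measurable_fun_pair.
  exact: (measurableT_comp mi mm).
have lay0 (L : set 'rV[R]_d) s : (0 <= row_int d (fun y => (ball_layer L kappa s y)%:E))%E.
  by apply: row_int_ge0 => y; rewrite lee_fin ball_layer_ge0.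
have mE : measurable_fun [set: R] (fun s : R => (expR (- s))%:E).
  by apply/measurable_EFinP; exact: measurable_expRN.
have -> : row_int d (fun y => (gauss_weight kappa y)%:E) =
    row_int d (fun y => (\1_[set: 'rV[R]_d] y * gauss_weight kappa y)%:E).
  by apply: eq_row_int => y; rewrite indicT mul1r.
rewrite !gauss_layers// [RHS]muleC.
have mint (L : set 'rV[R]_d) : measurable [set x : env R | L (env_row d x)] ->
    measurable_fun [set: R] (fun s => (expR (- s))%:E *
      row_int d (fun y => (ball_layer L kappa s y)%:E))%E.
  by move=> mL; apply: emeasurable_funM => //; exact: mlay.
have int0 (L : set 'rV[R]_d) s :
    (0 <= (expR (- s))%:E * row_int d (fun y => (ball_layer L kappa s y)%:E))%E.
  by apply: mule_ge0 => //; rewrite lee_fin expR_ge0.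
have unit0 (L : set 'rV[R]_d) : (0 <= row_int d (fun y => (unit_ball_indic L y)%:E))%E.
  by apply: row_int_ge0 => y; rewrite lee_fin unit_ball_indic_ge0.
rewrite -ge0_integralZl//; last exact: mint.
rewrite -[RHS]ge0_integralZl//; last exact: mint.
apply: eq_integral => s _; rewrite muleCA scale [RHS]muleCA; congr (_ * _)%E.
by rewrite muleC.
Qed.

Lemma measurable_gauss_lin d n (M : 'M[R]_(d, n)) kappa :
  measurable_fun [set: env R] (fun x => (gauss_weight kappa (env_row d x *m M))%:E).
Proof.
apply/measurable_EFinP; apply: measurable_gauss_weight => i.
by apply: measurable_mulmx => j; exact: measurable_row_coord.
Qed.

Lemma row_int_gauss_lin_gt0 d n (B : 'M[R]_(d, n)) (kappa : R) :
  (0 < row_int d (fun y => (gauss_weight kappa (y *m B))%:E))%E.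
Proof.
apply: (@iter_int_gt0 R d _ (fun=> 0) (fun=> 1)) => //.
- exact: measurable_gauss_lin.
- by move=> y; rewrite lee_fin expR_ge0.
- by move=> y _ _; rewrite lte_fin expR_gt0.
Qed.

Lemma onb_change d n (B Q : 'M[R]_(d, n)) :
  Q *m Q^T = 1%:M -> row_free B -> (B <= Q)%MS ->
  exists2 A, A \in unitmx & B = A *m Q.
Proof.
move=> QQ fB /submxP[A BE]; exists A => //.
rewrite -row_free_unit -row_leq_rank.
have := fB; rewrite -row_leq_rank BE => /leq_trans; apply.
exact: mxrankM_maxl.
Qed.

Lemma row_int_gauss_lin d n (B : 'M[R]_(d, n)) (kappa : R) : 0 < kappa -> row_free B ->
  exists2 c : R, 0 < c & row_int d (fun y => (gauss_weight kappa (y *m B))%:E) = c%:E.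
Proof.
move=> k0 fB; have [A' QQ] := onb_exists fB.
set Q := A' *m B in QQ.
have uA' : A' \in unitmx.
  rewrite -row_free_unit; apply/row_freeP; exists (B *m Q^T).
  by rewrite mulmxA.
have BE : B = invmx A' *m Q by rewrite /Q mulKmx.
have uA : invmx A' \in unitmx by rewrite unitmx_inv.
set A := invmx A' in BE uA.
have gE (M : 'M[R]_d) y : gauss_weight kappa (y *m M *m Q) = gauss_weight kappa (y *m M).
  by rewrite /gauss_weight dotv_onb.
have [c c0 cE] := @row_int_gauss R d kappa k0.
have mg : measurable_fun [set: env R] (fun x => (gauss_weight kappa (env_row d x))%:E).
  by apply/measurable_EFinP; apply: measurable_gauss_weight => i; exact: measurable_row_coord.
have g0 (y : 'rV[R]_d) : (0 <= (gauss_weight kappa y)%:E)%E by rewrite lee_fin expR_ge0.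
(* Since [A] inverts [A'], the identity becomes [c * c = J * I], where [J] and [I] are the integrals
   for [A'] and [B]. Both are positive, so neither can be infinite. *)
have := @row_int_linear R d (fun y => (gauss_weight kappa (y *m A'))%:E)
  (fun y => (gauss_weight kappa y)%:E) A uA (measurable_gauss_lin A' kappa) mg.
move=> /(_ (fun y => g0 _) g0).
rewrite (eq_row_int (g := fun y => (gauss_weight kappa y)%:E)); last first.
  by move=> y; rewrite mulmxKV.
rewrite [X in (_ * X)%E = (_ * _)%E -> _]cE [X in (X * _)%E = (_ * _)%E -> _]cE.
rewrite [X in (_ = _ * X)%E -> _](_ : _ =
    row_int d (fun y => (gauss_weight kappa (y *m B))%:E)); last first.
  by apply: eq_row_int => y; rewrite /gauss_weight dotvN BE mulmxA (dotv_onb _ QQ).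
have := row_int_gauss_lin_gt0 B kappa; have := row_int_gauss_lin_gt0 A' kappa.
set I := row_int d (fun y => (gauss_weight kappa (y *m B))%:E).
set J := row_int d _.
case: I => [r| |]// ; first by rewrite lte_fin => _ r0 _; exists r.
by case: J => [r| |]// r0 _; rewrite ?gt0_muley.
Qed.

(* The basis [B] of [V] need not be orthonormal: the Jacobian of the change of
   basis appears in both integrals. *)
Lemma ball_fraction_gauss d n (B : 'M[R]_(d, n)) (V C : set 'rV[R]_n) (kappa : R) :
  0 < kappa -> row_free B -> V = [set y *m B | y in [set: 'rV[R]_d]] ->
  (forall t v, 0 < t -> C v -> C (t *: v)) ->
  (forall M : 'M[R]_(d, n), measurable [set x : env R | C (env_row d x *m M)]) ->
  ball_fraction V C =
  fine (row_int d (fun y => (\1_C (y *m B) * gauss_weight kappa (y *m B))%:E)) /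
  fine (row_int d (fun y => (gauss_weight kappa (y *m B))%:E)).
Proof.
move=> k0 fB VB cC mC; rewrite /ball_fraction.
case: pselect => [H|[]]; last first.
  have [A QQ] := onb_exists fB.
  exists (existT _ d (A *m B)); split => //=.
  have uA : A \in unitmx.
    rewrite -row_free_unit; apply/row_freeP; exists (B *m (A *m B)^T).
    by rewrite mulmxA.
  rewrite VB; apply/seteqP; split => _ [y _ <-].
    by exists (y *m invmx A) => //; rewrite mulmxA mulmxKV.
  by exists (y *m A) => //; rewrite mulmxA.
case: (cid H) => -[d' Q] /= [QQ VQ].
have BQ : (B <= Q)%MS.
  apply/row_subP => i; apply/submxP.
  have : V (row i B) by rewrite VB; exists (delta_mx 0 i) => //; rewrite -rowE.
  by rewrite VQ => -[y _ <-]; exists y.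
have QB : (Q <= B)%MS.
  apply/row_subP => i; apply/submxP.
  have : V (row i Q) by rewrite VQ; exists (delta_mx 0 i) => //; rewrite -rowE.
  by rewrite VB => -[y _ <-]; exists y.
(* The chosen orthonormal basis comes with its own dimension [d']; equality of the row spaces
   identifies it with [d]. *)
have dd : d' = d.
  have fQ : row_free Q by apply/row_freeP; exists Q^T.
  move: fQ fB; rewrite /row_free => /eqP <- /eqP <-.
  by apply/eqP; rewrite eqn_leq !mxrankS.
move: Q QQ VQ BQ QB; rewrite dd => Q QQ _ BQ _ {H dd}.
have [A uA BE] := onb_change QQ fB BQ.
pose K := [set y : 'rV[R]_d | C (y *m Q)].
have mK : measurable [set x : env R | K (env_row d x)] by exact: mC.
have cK t y : 0 < t -> K y -> K (t *: y).
  by move=> t0 /(cC _ _ t0); rewrite /K /= scalemxAl.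
have := cone_gauss_fraction k0 mK cK.
rewrite -vol_unit_ball.
have [b b0 bE] := row_int_unit_ball d.
have -> : vol [set y : 'rV[R]_d | enorm y <= 1] = b%:E.
  rewrite -bE -vol_unit_ball; congr vol.
  by apply/seteqP; split => y //= -[].
have [c c0 cE] := @row_int_gauss R d kappa k0.
have [e e0 eE] := row_int_gauss_lin k0 fB.
rewrite bE cE eE.
have mg : measurable_fun [set: env R] (fun x => (gauss_weight kappa (env_row d x))%:E).
  by apply/measurable_EFinP; apply: measurable_gauss_weight => i; exact: measurable_row_coord.
have g0 (y : 'rV[R]_d) : (0 <= (gauss_weight kappa y)%:E)%E by rewrite lee_fin expR_ge0.
have mf : measurable_fun [set: env R] (fun x => (\1_K (env_row d x) *
    gauss_weight kappa (env_row d x))%:E).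
  apply/measurable_EFinP; apply: measurable_funM; last exact/measurable_EFinP.
  exact: measurable_cone_indic.
have f0 (y : 'rV[R]_d) : (0 <= (\1_K y * gauss_weight kappa y)%:E)%E.
  by rewrite lee_fin mulr_ge0 ?expR_ge0.
have := @row_int_linear R d (fun y => (\1_K y * gauss_weight kappa y)%:E)
  (fun y => (gauss_weight kappa y)%:E) A uA mf mg f0 g0.
rewrite cE.
rewrite [X in (X * _ = _)%E -> _](_ : _ =
    row_int d (fun y => (\1_C (y *m B) * gauss_weight kappa (y *m B))%:E)); last first.
  apply: eq_row_int => y; rewrite BE mulmxA /gauss_weight (dotv_onb _ QQ).
  by congr (_ * _)%:E; rewrite !indicE.
rewrite [X in (_ = _ * X)%E -> _](_ : _ =
    row_int d (fun y => (gauss_weight kappa (y *m B))%:E)); last first.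
  by apply: eq_row_int => y; rewrite /gauss_weight dotvN BE mulmxA (dotv_onb _ QQ).
rewrite eE.
(* [H1] says [W * c = J * b] and [H2] says [I * c = J * e]: both fractions [W / b] and [I / e] equal
   [J / c]. *)
set I := row_int d _; set J := row_int d _; set W := vol _ => H1 H2.
have J0 : (0 <= J)%E by apply: row_int_ge0.
have I0 : (0 <= I)%E.
  by apply: row_int_ge0 => y; rewrite lee_fin mulr_ge0 ?expR_ge0.
have W0 : (0 <= W)%E.
  by apply: iter_int_ge0 => y; rewrite lee_fin.
have JJ : (J <= c%:E)%E.
  rewrite -cE; apply: le_row_int => // y.
  by rewrite lee_fin ler_piMl ?expR_ge0// indicE; case: (_ \in _).
have Jfin : J \is a fin_num by rewrite ge0_fin_numE// (le_lt_trans JJ)// ltry.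
move: H1 H2; rewrite -(fineK Jfin).
case: W W0 => [w| |]// _; last by rewrite gt0_mulye.
case: I I0 => [i| |]// _; last by rewrite gt0_mulye.
rewrite -!EFinM => -[H1] [H2] /=.
have bn0 : b != 0 by rewrite gt_eqF.
have en0 : e != 0 by rewrite gt_eqF.
apply/eqP; rewrite eqr_div//; apply/eqP.
have cn0 : c != 0 by rewrite gt_eqF.
apply: (mulIf cn0).
by rewrite mulrAC H2 [RHS]mulrAC H1; ring.
Qed.

End BallFraction.

(** * The two angles as Gaussian integrals *)

Section Faces.
Variables (R : realType) (f : R -> R) (n : nat).
Local Notation w := (wt f).
Hypothesis w0 : forall i : 'I_n, 0 < w i.

(** The convex coefficient of [x] at the [i]-th vertex is [w i * x_i]. *)
Lemma face0P m (x : 'rV[R]_n) : face0 f n m x <->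
  [/\ forall i, 0 <= x 0 i, forall i : 'I_n, (m <= i)%N -> x 0 i = 0 &
      \sum_i w i * x 0 i = 1].
Proof.
have wn (i : 'I_n) : w i != 0 by rewrite gt_eqF.
have coord (c : 'I_n -> R) j :
    (\sum_(i < n) c i *: ((w i)^-1 *: (delta_mx 0 i : 'rV[R]_n))) 0 j = c j / w j.
  rewrite summxE (bigD1 j)//= big1 ?addr0 => [|i ij]; rewrite !mxE eqxx /=.
    by rewrite eqxx mulr1.
  by rewrite eq_sym (negbTE ij) !mulr0.
split => [[c [c0 [cm [c1 ->]]]]|[x0 xm x1]].
  split => [i|i mi|]; rewrite ?coord.
  - by rewrite divr_ge0// ltW.
  - by rewrite cm// mul0r.
  - by rewrite -c1; apply: eq_bigr => i _; rewrite coord mulrC divfK.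
exists (fun i => w i * x 0 i); split=> [i|]; first by rewrite mulr_ge0// ltW.
split => [i mi|]; first by rewrite xm// mulr0.
by split => //; apply/rowP => j; rewrite coord mulrC mulKf.
Qed.

Lemma coord_le_enorm (v : 'rV[R]_n) i : `|v 0 i| <= enorm v.
Proof.
rewrite -sqrtr_sqr ler_wsqrtr// /dotv (bigD1 i)//= -expr2 lerDl.
by apply: sumr_ge0 => j _; rewrite -expr2 sqr_ge0.
Qed.

Lemma enormZ (a : R) (v : 'rV[R]_n) : enorm (a *: v) = `|a| * enorm v.
Proof. by rewrite /enorm dotvZ sqrtrM ?sqr_ge0// sqrtr_sqr. Qed.

Lemma vertex_face0 m (i : 'I_n) : (i < m)%N -> face0 f n m ((w i)^-1 *: delta_mx 0 i).
Proof.
move=> im; apply/face0P; split => [j|j mj|].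
- by rewrite !mxE mulr_ge0// invr_ge0 ltW.
- rewrite !mxE /=; case: eqP => [ji|_]; last by rewrite mulr0.
  by move: im; rewrite -ji ltnNge mj.
- rewrite (bigD1 i)//= big1 ?addr0 => [|j ji]; rewrite !mxE eqxx /=.
    by rewrite eqxx mulr1 mulfV// gt_eqF.
  by rewrite (negbTE ji) !mulr0.
Qed.

(** If [x_i] were 0, the segment from the [i]-th vertex to [x] could be prolonged slightly beyond
    [x] within the face, and its coordinate [i] would become negative. *)
Lemma relint_face0_gt0 m (x : 'rV[R]_n) : relint (face0 f n m) x ->
  forall i : 'I_n, (i < m)%N -> 0 < x 0 i.
Proof.
case=> Fx [e [e0 He]] i im; have [x0 _ _] := (face0P m x).1 Fx.
rewrite lt_neqAle x0 andbT; apply/eqP => /esym xi.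
pose v : 'rV[R]_n := (w i)^-1 *: delta_mx 0 i.
(* The prolonged point is [x + t (x - v)], at distance at most [e / 2] from [x]; the summand 1 keeps
   the denominator positive. *)
pose t := e / (2 * (enorm (x - v) + 1)).
have N0 : 0 <= enorm (x - v) by rewrite sqrtr_ge0.
have t0 : 0 < t by rewrite divr_gt0// mulr_gt0// ltr_wpDl.
have Fv : face0 f n m v := vertex_face0 im.
have : face0 f n m ((1 + t) *: x + (- t) *: v).
  apply: He.
    exists 2%N, (fun j : 'I_2 => if j == ord0 then x else v),
      (fun j : 'I_2 => if j == ord0 then 1 + t else - t).
    split; first by move=> j; case: ifP.
    by rewrite !big_ord_recl !big_ord0 /= !addr0 addrK.
  have -> : (1 + t) *: x + - t *: v - x = t *: (x - v).
    by apply/rowP => j; rewrite !mxE; ring.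
  rewrite enormZ gtr0_norm//.
  have : t * (2 * (enorm (x - v) + 1)) = e by rewrite divfK// gt_eqF// mulr_gt0// ltr_wpDl.
  have : 0 <= t * enorm (x - v) by rewrite mulr_ge0// ltW.
  lra.
move=> /face0P[/(_ i)]; rewrite /v !mxE xi !eqxx mulr0 add0r mulr1.
by rewrite mulNr oppr_ge0 leNgt mulr_gt0// invr_gt0.
Qed.

Lemma relint_face0_nonempty m : (0 < m)%N -> (m <= n)%N -> exists x, relint (face0 f n m) x.
Proof.
move=> m0 mn.
pose x : 'rV[R]_n := \row_i (if (i < m)%N then (m%:R * w i)^-1 else 0).
have mR : 0 < m%:R :> R by rewrite ltr0n.
have Fx : face0 f n m x.
  apply/face0P; split => [i|i mi|].
  - by rewrite mxE; case: ifP => // _; rewrite invr_ge0 mulr_ge0// ltW.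
  - by rewrite mxE ltnNge mi.
  - rewrite (eq_bigr (fun i : 'I_n => if (i < m)%N then m%:R^-1 else 0)); last first.
      move=> i _; rewrite mxE; case: ifP => _; last by rewrite mulr0.
      by rewrite invfM mulrCA mulfV ?mulr1// gt_eqF.
    rewrite -big_mkcond (big_ord_narrow mn) sumr_const card_ord -[_ *+ _]mulr_natl.
    by rewrite mulfV// gt_eqF.
pose W := \sum_(i < n) w i.
have wW (i : 'I_n) : w i <= W.
  rewrite /W (bigD1 i)//= lerDl sumr_ge0// => j _; exact: ltW.
have W0 : 0 < W by apply: lt_le_trans (wW (Ordinal (leq_trans m0 mn))).
(* The positive coordinates of the barycentre [x] are [1 / (m * w i) >= 1 / (m * W)], so a move
   shorter than [1 / (m * W)] keeps them nonnegative. *)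
exists x; split => //; exists (m%:R * W)^-1; split; first by rewrite invr_gt0 mulr_gt0.
move=> y [r [s [c [Fs [c1 yE]]]]] yx; apply/face0P.
have ym (i : 'I_n) : (m <= i)%N -> y 0 i = 0.
  move=> mi; rewrite yE summxE big1// => j _; rewrite mxE.
  by have [_ -> //] := (face0P m _).1 (Fs j); rewrite mulr0.
split => //.
- move=> i; case: (ltnP i m) => [im|/ym ->//].
  have := le_lt_trans (coord_le_enorm _ i) yx.
  rewrite !mxE im ltr_norml => /andP[+ _].
  have : (m%:R * W)^-1 <= (m%:R * w i)^-1.
    by rewrite lef_pV2 ?posrE ?mulr_gt0// ler_pM2l.
  lra.
- rewrite yE -c1.
  transitivity (\sum_i \sum_j c j * (w i * s j 0 i)).
    apply: eq_bigr => i _; rewrite summxE mulr_sumr; apply: eq_bigr => j _.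
    by rewrite mxE mulrCA.
  rewrite exchange_big; apply: eq_bigr => j _ /=.
  by rewrite -mulr_sumr; have [_ _ ->] := (face0P m _).1 (Fs j); rewrite mulr1.
Qed.

End Faces.

(** * Measurability of finite systems of constraints *)

Section Measurability.
Variables (R : realType) (d1 : measure_display) (T : measurableType d1).

Lemma measurable_ge0_set (g : T -> R) : measurable_fun [set: T] g ->
  measurable [set t | 0 <= g t].
Proof. by move=> mg; rewrite -[X in measurable X]setTI; apply: measurable_fun_ler. Qed.

Lemma measurable_eq0_set (g : T -> R) : measurable_fun [set: T] g ->
  measurable [set t | g t = 0].
Proof.
move=> mg.
have -> : [set t | g t = 0] = [set t | 0 <= g t] `&` [set t | 0 <= - g t].
  apply/seteqP; split => t /= => [->|[h1 h2]]; first by rewrite oppr0.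
  by apply/eqP; rewrite eq_le h1 andbT -oppr_ge0.
apply: measurableI; apply: measurable_ge0_set => //.
exact: measurableT_comp.
Qed.

Lemma measurable_forall_ord n (P : 'I_n -> set T) : (forall i, measurable (P i)) ->
  measurable [set t | forall i, P i t].
Proof.
move=> mP.
have -> : [set t | forall i, P i t] = \bigcap_(i in [set: 'I_n]) P i.
  by apply/seteqP; split => t /= H i; [move=> _; exact: H|exact: H].
by apply: fin_bigcap_measurable => //; exact: finite_finset.
Qed.

Lemma measurable_imply (b : bool) (S : set T) : measurable S -> measurable [set t | b -> S t].
Proof.
move=> mS; case: b.
  by rewrite (_ : [set t | _] = S)//; apply/seteqP; split => t /=; [apply|].
by rewrite (_ : [set t | _] = setT)//; apply/seteqP; split.
Qed.

End Measurability.

(** * The internal angle as a Gaussian integral over a partial orthant *)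

Section InternalAngle.
Variables (R : realType) (f : R -> R) (n d : nat) (p : 'I_d.+1).
Hypothesis dn : (d.+1 <= n)%N.
Local Notation w := (@wt R f n).
Hypothesis w0 : forall i : 'I_n, 0 < w i.

(** The pivot is the last vertex of the smaller face. Among the other vertices of the larger face,
    renumbered by [j], those with [j < p] belong to the smaller face and those with [p <= j] do
    not. *)
Definition pivot : 'I_n := widen_ord dn p.
Definition other (j : 'I_d) : 'I_n := widen_ord dn (lift p j).

Lemma eq_other j j' : (other j == other j') = (j == j').
Proof.
apply/eqP/eqP => [/(congr1 val) /= H|->//].
by apply: (@lift_inj _ p); apply: val_inj.
Qed.

Lemma other_pivot j : (other j == pivot) = false.
Proof.
apply/eqP => /(congr1 val) /= H.
by have := neq_lift p j; rewrite -val_eqE /= H eqxx.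
Qed.

Lemma sum_face (F : 'I_n -> R) : (forall i : 'I_n, (d < i)%N -> F i = 0) ->
  \sum_i F i = F pivot + \sum_j F (other j).
Proof.
move=> F0; rewrite (bigID (fun i : 'I_n => (i < d.+1)%N)) /= [X in _ + X]big1 ?addr0.
  by rewrite (big_ord_narrow dn) (bigD1_ord p).
by move=> i; rewrite -leqNgt => /F0.
Qed.

(* The span of [G - x] is [{v | sum_(i <= d) w_i v_i = 0}], supported on the face;
   the coordinate at [pivot] is solved for. *)
Definition hyperplane_basis : 'M[R]_(d, n) :=
  \matrix_(j, i) ((i == other j)%:R - (i == pivot)%:R * (w (other j) / w pivot)).
Local Notation B := hyperplane_basis.

Lemma basis_other (y : 'rV[R]_d) j : (y *m B) 0 (other j) = y 0 j.
Proof.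
rewrite mxE (bigD1 j)//= big1 ?addr0 => [|i ij]; rewrite mxE eq_other other_pivot mul0r subr0.
  by rewrite eqxx mulr1.
by rewrite eq_sym (negbTE ij) mulr0.
Qed.

Lemma basis_pivot (y : 'rV[R]_d) :
  (y *m B) 0 pivot = - (\sum_j w (other j) * y 0 j) / w pivot.
Proof.
rewrite mxE mulNr mulr_suml -sumrN; apply: eq_bigr => j _.
by rewrite mxE eq_sym other_pivot eqxx mul1r sub0r; ring.
Qed.

Lemma basis_out (y : 'rV[R]_d) (i : 'I_n) : (d < i)%N -> (y *m B) 0 i = 0.
Proof.
move=> di; rewrite mxE big1// => j _; rewrite mxE.
have -> : (i == other j) = false.
  apply/eqP => /(congr1 val) /= ij.
  by have := ltn_ord (lift p j); rewrite -[val (lift p j)]/(nat_of_ord (lift p j)) ltnNge /= -ij di.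
have -> : (i == pivot) = false.
  by apply/eqP => /(congr1 val) /= ij; have := ltn_ord p; rewrite ltnNge -ij di.
by rewrite mul0r subr0 mulr0.
Qed.

Lemma basis_free : row_free B.
Proof.
rewrite -kermx_eq0; apply/eqP/row_matrixP => i; rewrite row0.
apply/rowP => j; rewrite -basis_other.
have /sub_kermxP -> : (row i (kermx B) <= kermx B)%MS by apply: row_sub.
by rewrite !mxE.
Qed.

Lemma basis_span (v : 'rV[R]_n) :
  (forall i : 'I_n, (d < i)%N -> v 0 i = 0) -> \sum_i w i * v 0 i = 0 ->
  v = (\row_j v 0 (other j)) *m B.
Proof.
move=> vd v0; apply/rowP => i.
have wp : w pivot != 0 by rewrite gt_eqF.
case: (ltnP d i) => [di|id]; first by rewrite basis_out// vd.
case: (unliftP p (Ordinal (id : (i < d.+1)%N))) => [j|] E.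
  have -> : i = other j by apply: val_inj; rewrite /= -[LHS]/(val (Ordinal (id : (i < d.+1)%N))) E.
  by rewrite basis_other mxE.
have -> : i = pivot by apply: val_inj; rewrite /= -[LHS]/(val (Ordinal (id : (i < d.+1)%N))) E.
rewrite basis_pivot; move: v0; rewrite sum_face; last by move=> ? /vd ->; rewrite mulr0.
move=> /eqP; rewrite addr_eq0 => /eqP E'.
under eq_bigr do rewrite mxE.
by apply: (mulfI wp); rewrite E' mulrCA mulfV// mulr1.
Qed.

Lemma basis_sum (y : 'rV[R]_d) : \sum_i w i * (y *m B) 0 i = 0.
Proof.
rewrite sum_face; last by move=> i di; rewrite basis_out// mulr0.
rewrite basis_pivot mulrCA mulfV ?gt_eqF// mulr1 addrC.
by under eq_bigr do rewrite basis_other; rewrite subrr.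
Qed.

Lemma dotv_basis (y : 'rV[R]_d) : dotv (y *m B) (y *m B) =
  \sum_j y 0 j ^+ 2 + (\sum_j w (other j) * y 0 j) ^+ 2 / w pivot ^+ 2.
Proof.
rewrite /dotv sum_face; last by move=> i di; rewrite basis_out// mulr0.
rewrite basis_pivot addrC; congr (_ + _).
  by apply: eq_bigr => j _; rewrite basis_other.
by rewrite -expr2 exprMn sqrrN exprVn.
Qed.

Definition angle_cone : set 'rV[R]_n :=
  [set v | [/\ forall i : 'I_n, (d < i)%N -> v 0 i = 0, \sum_i w i * v 0 i = 0 &
     forall i : 'I_n, (p < i)%N -> 0 <= v 0 i]].

Lemma angle_cone_basis (y : 'rV[R]_d) :
  angle_cone (y *m B) <-> forall j : 'I_d, (p <= j)%N -> 0 <= y 0 j.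
Proof.
split => [[_ _ H] j pj|H].
  by rewrite -basis_other H//= /bump pj.
split => [i|| i pi]; [exact: basis_out|exact: basis_sum|].
case: (ltnP d i) => [di|id]; first by rewrite basis_out.
case: (unliftP p (Ordinal (id : (i < d.+1)%N))) => [j|] E.
  have iE : i = other j by apply: val_inj; rewrite /= -[LHS]/(val (Ordinal (id : (i < d.+1)%N))) E.
  rewrite iE basis_other H//.
  by move: pi; rewrite iE /= /bump; case: (leqP p j) => //; rewrite add0n => /ltnW; rewrite leqNgt => /negbTE ->.
by move: pi; have /= -> := congr1 val E; rewrite ltnn.
Qed.

Lemma angle_cone_measurable (M : 'M[R]_(d, n)) :
  measurable [set x : env R | angle_cone (env_row d x *m M)].
Proof.
have mc i : measurable_fun [set: env R] (fun x : env R => (env_row d x *m M) 0 i).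
  by apply: measurable_mulmx => j; exact: measurable_row_coord.
have -> : [set x : env R | angle_cone (env_row d x *m M)] =
  [set x | forall i : 'I_n, (d < i)%N -> (env_row d x *m M) 0 i = 0] `&`
  [set x | \sum_i w i * (env_row d x *m M) 0 i = 0] `&`
  [set x | forall i : 'I_n, (p < i)%N -> 0 <= (env_row d x *m M) 0 i].
  by apply/seteqP; split => x /= [] => [|[]].
apply: measurableI; first apply: measurableI.
- apply: (measurable_forall_ord (P := fun i x => (d < i)%N -> (env_row d x *m M) 0 i = 0)) => i.
  exact: (measurable_imply _ (measurable_eq0_set (mc i))).
- apply: measurable_eq0_set; apply: measurable_sum => i; exact: measurable_funM.
- apply: (measurable_forall_ord (P := fun i x => (p < i)%N -> 0 <= (env_row d x *m M) 0 i)) => i.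
  exact: (measurable_imply _ (measurable_ge0_set (mc i))).
Qed.

Lemma angle_coneZ (t : R) v : 0 < t -> angle_cone v -> angle_cone (t *: v).
Proof.
move=> t0 [vd vs vp]; split => [i di||i pi].
- by rewrite mxE vd// mulr0.
- rewrite (eq_bigr (fun i => t * (w i * v 0 i))); last by move=> i _; rewrite mxE mulrCA.
  by rewrite -mulr_sumr vs mulr0.
- by rewrite mxE mulr_ge0// ?vp// ltW.
Qed.

(** A small move from [x] in the affine hull of the larger face is restricted in sign only where [x]
    vanishes, that is beyond index [p]. *)
Lemma tangent_cone_face x : relint (face0 f n p.+1) x ->
  [set v | exists t g, 0 <= t /\ face0 f n d.+1 g /\ v = t *: (g - x)] = angle_cone.
Proof.
move=> rx; have xp := relint_face0_gt0 w0 rx.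
case: rx => /(face0P w0) [x0 xm x1] _.
have pd : (p < d.+1)%N by [].
apply/seteqP; split => v /=.
  move=> [t [g [t0 [/(face0P w0) [g0 gm g1] ->]]]]; split => [i di||i pi].
  - by rewrite !mxE gm// xm ?subrr ?mulr0// (leq_trans _ di).
  - rewrite (eq_bigr (fun i => t * (w i * g 0 i) - t * (w i * x 0 i))); last first.
      by move=> i _; rewrite !mxE; ring.
    by rewrite sumrB -!mulr_sumr g1 x1 subrr.
  - by rewrite !mxE xm// subr0 mulr_ge0.
move=> [vd vs vp].
(* [t] exceeds each ratio [|v_i| / x_i] on the smaller face, so [x + v / t] stays nonnegative
   there. *)
pose t := 1 + \sum_(i : 'I_n | (i < p.+1)%N) `|v 0 i| / x 0 i.
have s0 (i : 'I_n) : (i < p.+1)%N -> 0 <= `|v 0 i| / x 0 i.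
  by move=> ip; rewrite divr_ge0// ltW// xp.
have t0 : 0 < t by rewrite ltr_pwDl// sumr_ge0.
exists t, (x + t^-1 *: v); split; first exact: ltW.
split; last by rewrite addrC addKr scalerA mulfV ?gt_eqF// scale1r.
apply/(face0P w0); split => [i|i di|].
- rewrite !mxE; case: (ltnP i p.+1) => [ip|pi]; last first.
    by rewrite addr_ge0// mulr_ge0 ?invr_ge0 ?vp// ltW.
  have : `|v 0 i| <= t * x 0 i.
    rewrite -ler_pdivrMr ?xp// /t (bigD1 i)//= addrCA lerDl addr_ge0// sumr_ge0// => j /andP[jp _].
    exact: s0.
  move=> H; rewrite -(pmulr_rge0 _ t0) mulrDr mulVKf ?gt_eqF//.
  by move: H; rewrite ler_norml => /andP[+ _]; rewrite lerNl -subr_ge0 opprK.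
- by rewrite !mxE vd// mulr0 addr0 xm// (leq_trans _ di).
- rewrite (eq_bigr (fun i => w i * x 0 i + t^-1 * (w i * v 0 i))); last first.
    by move=> i _; rewrite !mxE; ring.
  by rewrite big_split /= x1 -mulr_sumr vs mulr0 addr0.
Qed.

Lemma span_face x : relint (face0 f n p.+1) x ->
  Defs.span [set g - x | g in face0 f n d.+1] = [set y *m B | y in [set: 'rV[R]_d]].
Proof.
move=> [/(face0P w0) [x0 xm x1] _].
apply/seteqP; split => v /=.
  move=> [m [s [c [Fs ->]]]].
  have sP j : (forall i : 'I_n, (d < i)%N -> s j 0 i = 0) /\ \sum_i w i * s j 0 i = 0.
    have [g /(face0P w0) [g0 gm g1] <-] := Fs j; split => [i di|].
      by rewrite !mxE gm// xm ?subrr// (leq_trans _ di).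
    rewrite (eq_bigr (fun i => w i * g 0 i - w i * x 0 i)).
      by rewrite sumrB g1 x1 subrr.
    by move=> i _; rewrite !mxE; ring.
  exists (\row_j (\sum_(j < m) c j *: s j) 0 (other j)) => //.
  rewrite -basis_span//.
    move=> i di; rewrite summxE big1// => j _; rewrite mxE.
    by rewrite (sP j).1// mulr0.
  rewrite (eq_bigr (fun i => \sum_j c j * (w i * s j 0 i))).
    by rewrite exchange_big big1// => j _ /=; rewrite -mulr_sumr (sP j).2 mulr0.
  by move=> i _; rewrite summxE mulr_sumr; apply: eq_bigr => j _; rewrite mxE; ring.
move=> [y _ <-].
pose e (i : 'I_n) : 'rV[R]_n := (w i)^-1 *: delta_mx 0 i.
have Fe j : face0 f n d.+1 (e (widen_ord dn j)) by apply: vertex_face0 => //=.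
(* Vertices minus [x], with coefficients chosen to sum to 0 so that [x] cancels; the pivot takes the
   compensating coefficient. *)
pose s (j : 'I_d + 'I_1) := match j with inl j => e (other j) - x | inr _ => e pivot - x end.
pose c (j : 'I_d + 'I_1) := match j with inl j => y 0 j * w (other j)
  | inr _ => - (\sum_j y 0 j * w (other j)) end.
exists (d + 1)%N, (fun j => s (fintype.split j)), (fun j => c (fintype.split j)); split.
  by move=> j; case: (fintype.split j) => j' /=; eexists; try reflexivity; exact: Fe.
rewrite big_split_ord /=.
under eq_bigr => i _ do rewrite -[lshift _ _]/(unsplit (inl i)) unsplitK /=.
rewrite big_ord1 -[rshift _ _]/(unsplit (inr _)) unsplitK /=.
have eE (i i' : 'I_n) : e i 0 i' = (w i)^-1 * (i' == i)%:R by rewrite !mxE eqxx.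
apply/rowP => i; rewrite !mxE summxE.
rewrite mulNr mulr_suml -sumrN -big_split /=; apply: eq_bigr => j _.
have wp : w pivot != 0 by rewrite gt_eqF.
have wj : w (other j) != 0 by rewrite gt_eqF.
by rewrite !mxE !eqxx /=; field; rewrite wp wj.
Qed.

Definition int_density (x : env R) : R :=
  expR (- (2^-1 * (\sum_(j < d) x j ^+ 2 + (\sum_(j < d) w (other j) * x j) ^+ 2 / w pivot ^+ 2))).

Lemma int_angleE : int_angle (face0 f n p.+1) (face0 f n d.+1) =
  fine (iter_int d (fun x => ((\prod_(j < d) (((p <= j)%N ==> (0 <= x j)%R) : nat)%:R) * int_density x)%:E)
    (fun=> 0)) / fine (iter_int d (fun x => (int_density x)%:E) (fun=> 0)).
Proof.
have pd : (p.+1 <= d.+1)%N by exact: ltn_ord.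
(* Nonemptiness of the relative interior ensures that [xget] returns a point of it and not its
   default 0. *)
have rx := xgetPex 0 (relint_face0_nonempty w0 (ltn0Sn p) (leq_trans pd dn)).
rewrite /int_angle tangent_cone_face// span_face//.
have k0 : (0 : R) < 2^-1 by rewrite invr_gt0.
rewrite (ball_fraction_gauss k0 basis_free erefl angle_coneZ angle_cone_measurable).
have dE x : gauss_weight 2^-1 (env_row d x *m B) = int_density x.
  rewrite /gauss_weight dotv_basis /int_density.
  have -> : \sum_j env_row d x 0 j ^+ 2 = \sum_(j < d) x j ^+ 2.
    by apply: eq_bigr => i _; rewrite mxE.
  have -> // : \sum_j w (other j) * env_row d x 0 j = \sum_(j < d) w (other j) * x j.
  by apply: eq_bigr => i _; rewrite mxE.
congr (fine _ / fine _); apply: eq_iter_int => x; rewrite dE//.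
congr (_ * _)%:E; rewrite indicE -natr_prod; congr (_%:R).
have [H|H] := boolP [forall j : 'I_d, (p <= j)%N ==> (0 <= x j)].
  rewrite mem_set; last first.
    by apply/angle_cone_basis => j pj; rewrite mxE; move/forallP/(_ j): H; rewrite pj.
  by rewrite big1// => j _; move/forallP/(_ j): H => ->.
rewrite memNset.
  move: H; rewrite negb_forall => /existsP[j /negbTE jE].
  by rewrite (bigD1 j)//= jE mul0n.
move/angle_cone_basis => Hx; move/negP: H; apply; apply/forallP => j; apply/implyP => pj.
by have := Hx j pj; rewrite mxE.
Qed.

End InternalAngle.

(** * The external angle as a Gaussian integral over the normal cone *)

Section ExternalAngle.
Variables (R : realType) (f : R -> R) (l' N : nat).
Local Notation l := l'.+1.
Local Notation n := (l + N)%N.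
Local Notation w := (@wt R f n).
Hypothesis w0 : forall i : 'I_n, 0 < w i.

Let first : 'I_n := lshift N ord0.
Let wfirst : 0 < w first. Proof. exact: w0. Qed.

(** The last row is the weight vector on the face, the others are unit vectors beyond it. The
    multiplier is placed last because the last coordinate is the outermost variable of
    [iter_int]. *)
Definition normal_basis : 'M[R]_(N.+1, n) :=
  \matrix_(j, i) match fintype.split i with
    | inl _ => (j == ord_max)%:R * w i
    | inr i' => (val j == val i')%:R
  end.
Local Notation B := normal_basis.

Lemma normal_basis_l (y : 'rV[R]_N.+1) i : (y *m B) 0 (lshift N i) = y 0 ord_max * w (lshift N i).
Proof.
have sp : fintype.split (lshift N i) = inl i :> 'I_l + 'I_N by rewrite -[lshift _ _]/(unsplit (inl i)) unsplitK.
rewrite mxE (bigD1 ord_max)//= big1 ?addr0 => [|j jm]; rewrite mxE sp.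
  by rewrite eqxx mul1r.
by rewrite (negbTE jm) mul0r mulr0.
Qed.

Lemma normal_basis_r (y : 'rV[R]_N.+1) i : (y *m B) 0 (rshift l i) = y 0 (widen_ord (leqnSn N) i).
Proof.
have sp : fintype.split (rshift l i) = inr i :> 'I_l + 'I_N by rewrite -[rshift _ _]/(unsplit (inr i)) unsplitK.
rewrite mxE (bigD1 (widen_ord (leqnSn N) i))//= big1 ?addr0 => [|j jm]; rewrite mxE sp.
  by rewrite eqxx mulr1.
rewrite (_ : (val j == val i) = false) ?mulr0//.
by apply: contraNF jm => /eqP ji; apply/eqP/val_inj.
Qed.

Lemma normal_basis_inj (y : 'rV[R]_N.+1) : y *m B = 0 -> y = 0.
Proof.
move=> yB; apply/rowP => j; rewrite [RHS]mxE.
case: (unliftP ord_max j) => [j' ->|->].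
  have := normal_basis_r y j'; rewrite yB mxE => ->; congr (y 0 _).
  by apply: val_inj; rewrite /= /bump leqNgt ltn_ord.
have /eqP := normal_basis_l y ord0; rewrite yB mxE eq_sym mulf_eq0.
by rewrite (gt_eqF wfirst) orbF => /eqP.
Qed.

Lemma normal_basis_free : row_free B.
Proof.
rewrite -kermx_eq0; apply/eqP/row_matrixP => i; rewrite row0.
by apply: normal_basis_inj; apply/sub_kermxP/row_sub.
Qed.

(* The multiplier [t] of [normal_cone_faceP] is eliminated through [v 0 first],
   which makes the set visibly measurable. *)
Definition normal_cone_face : set 'rV[R]_n :=
  [set v | [/\ 0 <= v 0 first, forall i : 'I_n, (i < l)%N -> v 0 i * w first - v 0 first * w i = 0 &
     forall i, 0 <= v 0 first * w i - `|v 0 i| * w first]].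

Lemma normal_cone_faceP v : normal_cone_face v <->
  exists2 t, 0 <= t & (forall i : 'I_n, (i < l)%N -> v 0 i = t * w i) /\
    forall i, `|v 0 i| <= t * w i.
Proof.
have wn : w first != 0 by rewrite gt_eqF.
split => [[v0 vl vle]|[t t0 [vl vle]]].
  exists (v 0 first / w first); first by rewrite divr_ge0// ltW.
  split => [i /vl /eqP|i].
    by rewrite subr_eq0 => /eqP E; rewrite mulrAC -E mulfK.
  by rewrite mulrAC ler_pdivlMr// -subr_ge0 vle.
split => [|i il|i].
- by rewrite vl// mulr_ge0// ltW.
- by rewrite !vl//; ring.
- rewrite (vl first)// mulrAC -mulrBl mulr_ge0 ?subr_ge0//; exact: ltW.
Qed.

Lemma normal_cone_face_basis (y : 'rV[R]_N.+1) : normal_cone_face (y *m B) <->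
  0 <= y 0 ord_max /\ forall j, `|y 0 (widen_ord (leqnSn N) j)| <= y 0 ord_max * w (rshift l j).
Proof.
split => [/normal_cone_faceP[t t0 [vl vle]]|[y0 yle]].
  have yt : y 0 ord_max = t.
    have := vl first (ltn0Sn _); rewrite normal_basis_l.
    by move/(mulIf (lt0r_neq0 wfirst)).
  by rewrite yt; split => // j; rewrite -normal_basis_r.
apply/normal_cone_faceP; exists (y 0 ord_max) => //; split => [i il|i].
  have -> : i = lshift N (Ordinal il) by apply: val_inj.
  by rewrite normal_basis_l.
rewrite -(splitK i); case: (fintype.split i) => j /=.
  by rewrite normal_basis_l ger0_norm// mulr_ge0// ltW.
by rewrite normal_basis_r.
Qed.

Lemma normal_cone_faceZ (t : R) v : 0 < t -> normal_cone_face v -> normal_cone_face (t *: v).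
Proof.
move=> t0 /normal_cone_faceP[s s0 [vl vle]]; apply/normal_cone_faceP.
exists (t * s); first by rewrite mulr_ge0// ltW.
split => [i il|i]; rewrite mxE; first by rewrite vl// mulrA.
by rewrite normrM gtr0_norm// -mulrA ler_pM2l.
Qed.

Lemma normal_cone_face_measurable (M : 'M[R]_(N.+1, n)) :
  measurable [set x : env R | normal_cone_face (env_row N.+1 x *m M)].
Proof.
have mc i : measurable_fun [set: env R] (fun x : env R => (env_row N.+1 x *m M) 0 i).
  by apply: measurable_mulmx => j; exact: measurable_row_coord.
pose v (x : env R) := env_row N.+1 x *m M.
have -> : [set x : env R | normal_cone_face (env_row N.+1 x *m M)] =
  [set x | 0 <= v x 0 first] `&`
  [set x | forall i : 'I_n, (i < l)%N -> v x 0 i * w first - v x 0 first * w i = 0] `&`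
  [set x | forall i : 'I_n, 0 <= v x 0 first * w i - `|v x 0 i| * w first].
  by apply/seteqP; split => x /= [] => [|[]].
apply: measurableI; first apply: measurableI.
- exact: measurable_ge0_set.
- apply: (measurable_forall_ord (P := fun i x => (i < l)%N -> v x 0 i * w first - v x 0 first * w i = 0)) => i.
  apply: (measurable_imply (i < l)%N (S := [set x | v x 0 i * w first - v x 0 first * w i = 0])).
  by apply: measurable_eq0_set; apply: measurable_funB; apply: measurable_funM.
- apply: (measurable_forall_ord (P := fun i x => 0 <= v x 0 first * w i - `|v x 0 i| * w first)) => i.
  apply: measurable_ge0_set; apply: measurable_funB; apply: measurable_funM => //.
  exact: measurableT_comp.
Qed.

Lemma dotvBr m (v z x : 'rV[R]_m) : dotv v (z - x) = dotv v z - dotv v x.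
Proof. by rewrite /dotv -sumrB; apply: eq_bigr => i _; rewrite !mxE mulrBr. Qed.

(** Testing [v] at the vertices [e_i / w_i] and [- e_i / w_i] of the ball gives
    [|v_i| <= <v, x> * w_i], so the multiplier is [t = <v, x>]. *)
Lemma normal_cone_faceE x : relint (face0 f n l) x ->
  normal_cone (wl1_ball f n) x = normal_cone_face.
Proof.
move=> rx; have xp := relint_face0_gt0 w0 rx.
case: rx => /(face0P w0) [x0 xm x1] _.
apply/seteqP; split => v /=; last first.
  move=> /normal_cone_faceP[t t0 [vl vle]] z zP.
  have vx : dotv v x = t.
    rewrite -[RHS]mulr1 -x1 mulr_sumr; apply: eq_bigr => i _.
    case: (ltnP i l) => [il|/xm ->]; last by rewrite !mulr0.
    by rewrite vl// mulrA.
  rewrite dotvBr vx subr_le0 -[X in _ <= X]mulr1.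
  apply: (@le_trans _ _ (t * \sum_i w i * `|z 0 i|)); last by rewrite ler_wpM2l.
  rewrite mulr_sumr; apply: ler_sum => i _; rewrite mulrA.
  apply: le_trans (ler_norm _) _; rewrite normrM.
  by rewrite ler_wpM2r// vle.
move=> Hv.
have vle i : `|v 0 i| <= dotv v x * w i.
  have vz (e : R) : `|e| <= 1 -> e * v 0 i <= dotv v x * w i.
    move=> e1; pose z : 'rV[R]_n := (e / w i) *: delta_mx 0 i.
    have zP : wl1_ball f n z.
      rewrite /wl1_ball /= (bigD1 i)//= big1 ?addr0 => [|j ji]; rewrite !mxE eqxx /=.
        by rewrite eqxx mulr1 normrM normfV (gtr0_norm (w0 i)) mulrCA mulfV ?gt_eqF// mulr1.
      by rewrite (negbTE ji) mulr0 normr0 mulr0.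
    have := Hv z zP; rewrite dotvBr subr_le0.
    have -> : dotv v z = v 0 i * e / w i.
      rewrite /dotv (bigD1 i)//= big1 ?addr0 => [|j ji]; rewrite !mxE eqxx /=.
        by rewrite eqxx mulr1 mulrA.
      by rewrite (negbTE ji) !mulr0.
    by rewrite ler_pdivrMr// mulrC.
  rewrite ler_norml lerNl; apply/andP; split.
    by have := vz (-1); rewrite normrN normr1 mulN1r => ->.
  by have := vz 1; rewrite normr1 mul1r => ->.
apply/normal_cone_faceP; exists (dotv v x).
  by have := le_trans (normr_ge0 _) (vle first); rewrite pmulr_lge0.
split => // i il.
(* Complementary slackness: nonnegative terms with sum 0 vanish, and [x_i > 0] on the face turns the
   inequality into an equality there. *)
have E : \sum_j (dotv v x * w j - v 0 j) * x 0 j = 0.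
  rewrite (eq_bigr (fun j => dotv v x * (w j * x 0 j) - v 0 j * x 0 j)).
    by rewrite sumrB -mulr_sumr x1 mulr1 subrr.
  by move=> j _; ring.
have /eqP : (dotv v x * w i - v 0 i) * x 0 i = 0.
  apply: (psumr_eq0P _ E) => // j _; rewrite mulr_ge0// subr_ge0.
  by apply: le_trans (vle j); exact: ler_norm.
by rewrite mulf_eq0 (gt_eqF (xp i il)) orbF subr_eq0 => /eqP.
Qed.

Lemma span_normal_cone_face :
  Defs.span normal_cone_face = [set y *m B | y in [set: 'rV[R]_N.+1]].
Proof.
have wE (j : 'I_N) : widen_ord (leqnSn N) j = lift ord_max j.
  by apply: val_inj; rewrite /= /bump leqNgt ltn_ord.
apply/seteqP; split => v /=.
  move=> [m [s [c [Cs ->]]]].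
  have sP j : exists y, s j = y *m B.
    have /normal_cone_faceP[t t0 [vl vle]] := Cs j.
    exists (\row_i match unlift ord_max i with Some i' => s j 0 (rshift l i') | None => t end).
    apply/rowP => i; rewrite -(splitK i); case: (fintype.split i) => i' /=.
      by rewrite normal_basis_l mxE unlift_none vl//=.
    by rewrite normal_basis_r mxE wE liftK.
  have [y yE] := choice sP.
  exists (\sum_j c j *: y j) => //; rewrite mulmx_suml; apply: eq_bigr => j _.
  by rewrite yE scalemxAl.
move=> [y _ <-].
(* Cone vectors of multiplier 1 with at most one nonzero tail coordinate, set to its largest value
   [w]. The coefficient of the one with zero tail corrects the multiplier contributed by the
   others. *)
pose z (j : 'I_N.+1) : 'rV[R]_N.+1 := delta_mx 0 ord_max +
  (if unlift ord_max j is Some j' then w (rshift l j') *: delta_mx 0 j else 0).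
pose c (j : 'I_N.+1) : R := if unlift ord_max j is Some j' then y 0 j / w (rshift l j')
  else y 0 ord_max - \sum_(j' < N) y 0 (lift ord_max j') / w (rshift l j').
exists N.+1, (fun j => z j *m B), c; split.
  move=> j; apply/normal_cone_face_basis; rewrite /z.
  case: (unliftP ord_max j) => [j' ->|_].
    have lm : (ord_max == lift ord_max j') = false by apply/negbTE/neq_lift.
    rewrite !mxE !eqxx lm mulr0 addr0; split => // i; rewrite !mxE wE.
    rewrite eq_sym (negbTE (neq_lift _ _)) add0r mul1r /=.
    rewrite (inj_eq (@lift_inj _ ord_max)); case: eqP => [->|_].
      by rewrite mulr1 gtr0_norm.
    by rewrite mulr0 normr0 ltW.
  rewrite addr0 !mxE !eqxx; split => // i; rewrite !mxE wE.
  by rewrite eq_sym (negbTE (neq_lift _ _)) normr0 mul1r ltW.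
under eq_bigr do rewrite scalemxAl.
rewrite -mulmx_suml; congr (_ *m _).
rewrite (bigD1_ord ord_max)//= /z /c unlift_none addr0.
under eq_bigr do rewrite liftK.
apply/rowP => i; rewrite [RHS]mxE summxE [X in X + _]mxE.
case: (unliftP ord_max i) => [i' ->|->].
  rewrite mxE eq_sym (negbTE (neq_lift _ _)) mulr0 add0r (bigD1 i')//= big1 ?addr0.
    rewrite !mxE !eqxx eq_sym (negbTE (neq_lift _ _)) add0r mulr1 divfK//.
    by rewrite gt_eqF.
  move=> j ji; rewrite !mxE /= (inj_eq (@lift_inj _ ord_max)) eq_sym (negbTE (neq_lift _ _)).
  by rewrite eq_sym (negbTE ji) mulr0 addr0 mulr0.
rewrite mxE !eqxx mulr1 [X in _ + X](eq_bigr (fun j => y 0 (lift ord_max j) / w (rshift l j))).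
  by rewrite subrK.
by move=> j _; rewrite !mxE !eqxx (negbTE (neq_lift _ _)) mulr0 addr0 mulr1.
Qed.

Definition head_sq : R := \sum_(i < l) w (lshift N i) ^+ 2.

Lemma dotv_normal_basis (y : 'rV[R]_N.+1) : dotv (y *m B) (y *m B) =
  head_sq * y 0 ord_max ^+ 2 + \sum_(j < N) y 0 (widen_ord (leqnSn N) j) ^+ 2.
Proof.
rewrite /dotv big_split_ord /=; congr (_ + _).
  by rewrite mulr_suml; apply: eq_bigr => i _; rewrite normal_basis_l; ring.
by apply: eq_bigr => i _; rewrite normal_basis_r expr2.
Qed.

(** The scale is [kappa = 1], against [1 / 2] for the internal angle, so that the one-dimensional
    sections are values of [erf]. *)
Definition ext_density (x : env R) : R :=
  expR (- (head_sq * x N ^+ 2 + \sum_(j < N) x j ^+ 2)).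

Lemma ext_angleE : ext_angle (face0 f n l) (wl1_ball f n) =
  fine (iter_int N.+1 (fun x => ((0 <= x N)%R%:R *
      (\prod_(j < N) (`|x j| <= x N * w (rshift l j))%R%:R) * ext_density x)%:E)
    (fun=> 0)) / fine (iter_int N.+1 (fun x => (ext_density x)%:E) (fun=> 0)).
Proof.
have rx := xgetPex 0 (relint_face0_nonempty w0 (ltn0Sn l') (leq_addr N l)).
rewrite /ext_angle normal_cone_faceE// span_normal_cone_face.
rewrite (ball_fraction_gauss ltr01 normal_basis_free erefl normal_cone_faceZ normal_cone_face_measurable).
have dE x : gauss_weight 1 (env_row N.+1 x *m B) = ext_density x.
  rewrite /gauss_weight dotv_normal_basis /ext_density mul1r mxE.
  have -> // : \sum_(j < N) env_row N.+1 x 0 (widen_ord (leqnSn N) j) ^+ 2 = \sum_(j < N) x j ^+ 2.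
  by apply: eq_bigr => i _; rewrite mxE.
congr (fine _ / fine _); apply: eq_iter_int => x; rewrite dE//.
congr (_ * _)%:E; rewrite indicE.
have [xN|xN] := boolP (0 <= x N)%R; last first.
  by rewrite mul0r memNset// => /normal_cone_face_basis[]; rewrite mxE (negbTE xN).
rewrite mul1r.
have [H|H] := boolP [forall j : 'I_N, `|x j| <= x N * w (rshift l j)].
  rewrite mem_set; last first.
    apply/normal_cone_face_basis; rewrite mxE; split => // j; rewrite mxE.
    by move/forallP/(_ j): H.
  by rewrite big1// => j _; move/forallP/(_ j): H => ->.
rewrite memNset.
  move: H; rewrite negb_forall => /existsP[j /negbTE jE].
  by rewrite (bigD1 j)//= jE mul0r.
move/normal_cone_face_basis => [_ Hx]; move/negP: H; apply; apply/forallP => j.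
by have := Hx j; rewrite !mxE.
Qed.

End ExternalAngle.

(** * The internal angle *)

#[local] Opaque expR.

(** * The half-line Gaussian integral and the function [lam] *)

Section HalfGauss.
Variable R : realType.
Local Notation mu := (@lebesgue_measure R).

Lemma integral_opp (h : R -> \bar R) :
  measurable_fun [set: R] h -> (forall t, 0 <= h t)%E ->
  (\int[mu]_(t in [set: R]) h (- t)%R = \int[mu]_(t in [set: R]) h t)%E.
Proof.
move=> mh h0.
rewrite (_ : (\int[mu]_(t in [set: R]) h (- t)%R)%E =
  \int[mu]_(t in (-%R : _ -> measurableTypeR R) @^-1` setT) (h \o -%R) t)%E; last by rewrite preimage_setT.
rewrite -ge0_integral_pushforward //=.
by apply: eq_measure_integral => //= A mA _; exact: lebesgue_measureN.
Qed.

Definition gauss1 (t : R) : R := expR (- (t ^+ 2) / 2).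

Lemma measurable_gauss1 : measurable_fun [set: R] gauss1.
Proof.
apply: (eq_measurable_fun (fun t : R => expR (- (2^-1 * (t - 0) ^+ 2)))).
  by move=> t _; rewrite /gauss1 subr0; congr expR; ring.
exact: measurable_quad.
Qed.

Lemma integral_gauss1 : (\int[mu]_(t in [set: R]) (gauss1 t)%:E = (Num.sqrt (2 * pi))%:E)%E.
Proof.
have <- : pi / 2^-1 = 2 * pi :> R by rewrite invrK mulrC.
have h2 : (0 : R) < 2^-1 by rewrite invr_gt0.
rewrite -(integral_gauss_affine 0 h2).
by apply: eq_integral => t _; rewrite subr0 /gauss1; congr (expR _)%:E; ring.
Qed.

Lemma measurable_ler (a : R) : measurable_fun [set: R] (fun t : R => (a <= t)%R%:R : R).
Proof.
rewrite (_ : (fun t : R => _) = \1_(`[a, +oo[)); first exact: measurable_indic.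
by apply/funext => t; rewrite indicE mem_setE in_itv /= andbT.
Qed.

Lemma measurable_ger (a : R) : measurable_fun [set: R] (fun t : R => (t <= a)%R%:R : R).
Proof.
rewrite (_ : (fun t : R => _) = \1_(`]-oo, a])); first exact: measurable_indic.
by apply/funext => t; rewrite indicE mem_setE in_itv /=.
Qed.

Lemma integral_restrict_fin (b : R -> bool) (g : R -> R) (c : R) :
  measurable_fun [set: R] (fun t => (b t)%:R : R) -> measurable_fun [set: R] g ->
  (forall t, 0 <= g t) -> (\int[mu]_(t in [set: R]) (g t)%:E = c%:E)%E ->
  exists2 r, 0 <= r <= c & (\int[mu]_(t in [set: R]) ((b t)%:R * g t)%:E = r%:E)%E.
Proof.
move=> mb mg g0 gc; set I := (\int[mu]_(t in _) _)%E.
have I0 : (0 <= I)%E by apply: integral_ge0 => t _; rewrite lee_fin mulr_ge0.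
have Ic : (I <= c%:E)%E.
  rewrite -gc; apply: ge0_le_integral => //.
  - by move=> t _; rewrite lee_fin mulr_ge0.
  - by apply/measurable_EFinP; exact: measurable_funM.
  - exact/measurable_EFinP.
  - by move=> t _; rewrite lee_fin; case: (b t); rewrite ?mul1r// mul0r.
have If : I \is a fin_num by rewrite ge0_fin_numE// (le_lt_trans Ic)// ltry.
exists (fine I); last by rewrite fineK.
by rewrite -!lee_fin fineK// I0.
Qed.

Lemma PhiE (s : R) :
  (\int[mu]_(t in [set: R]) ((t <= s)%R%:R * gauss1 t)%:E = (Num.sqrt (2 * pi) * Phi s)%:E)%E.
Proof.
have [r _ rE] := integral_restrict_fin (measurable_ger s) measurable_gauss1
  (fun t => expR_ge0 _) integral_gauss1.
have q0 : Num.sqrt (2 * pi) != 0 :> R by rewrite gt_eqF// sqrtr_gt0 mulr_gt0// pi_gt0.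
rewrite rE; congr EFin; rewrite /Phi mulVKf// /Rintegral integral_mkcond.
transitivity (fine r%:E) => //; rewrite -rE; congr fine; apply: eq_integral => t _.
by rewrite patchE mem_setE in_itv /=; case: (t <= s); rewrite ?mul1r ?mul0r.
Qed.

Lemma Phi_gt0 (s : R) : 0 < Phi s.
Proof.
have q0 : 0 < Num.sqrt (2 * pi) :> R by rewrite sqrtr_gt0 mulr_gt0// pi_gt0.
rewrite -(pmulr_rgt0 _ q0) -lte_fin -PhiE.
apply: (@integral_itv_gt0 _ _ (s - 1) s).
- apply/measurable_EFinP; apply: measurable_funM; [exact: measurable_ger|exact: measurable_gauss1].
- by move=> t; rewrite lee_fin mulr_ge0 ?expR_ge0.
- by rewrite ltrBlDr ltrDl.
- by move=> t /andP[_ ->]; rewrite mul1r lte_fin expR_gt0.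
Qed.

Definition half_gauss (r t : R) : R := (0 <= t)%R%:R * expR (r * t - t ^+ 2 / 2).

Lemma half_gaussE r t : (0 <= t)%R -> half_gauss r t = expR (r * t - t ^+ 2 / 2).
Proof. by move=> t0; rewrite /half_gauss t0 mul1r. Qed.

Lemma half_gauss_lt0 r t : ~~ (0 <= t)%R -> half_gauss r t = 0.
Proof. by move=> /negbTE t0; rewrite /half_gauss t0 mul0r. Qed.

Lemma half_gauss_ge0 r t : 0 <= half_gauss r t.
Proof. by rewrite mulr_ge0 ?expR_ge0. Qed.

Lemma measurable_half_gauss r : measurable_fun [set: R] (half_gauss r).
Proof.
apply: measurable_funM; first exact: measurable_ler.
apply: measurableT_comp => //; apply: measurable_funB; first exact: measurable_funM.
by apply: measurable_funM => //; exact: measurable_funX.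
Qed.

(** Completing the square after the substitution [t -> r - t]. Thus [lam] is the cumulant generating
    function of [|Z|] for a standard normal [Z]; its value at 0, its monotonicity and its convexity
    are all read off this integral. *)
Lemma integral_half_gauss (r : R) :
  (\int[mu]_(t in [set: R]) (half_gauss r t)%:E =
    (Num.sqrt (2 * pi) / 2 * expR (lam r))%:E)%E.
Proof.
have mh : measurable_fun [set: R] (fun t => (half_gauss r t)%:E).
  by apply/measurable_EFinP; exact: measurable_half_gauss.
have h0 t : (0 <= (half_gauss r t)%:E)%E by rewrite lee_fin half_gauss_ge0.
rewrite -(integral_shift r mh h0) -integral_opp; last 2 first.
- by apply: (measurableT_comp mh); exact: measurable_fun_shift.
- by move=> t; exact: h0.
transitivity (\int[mu]_(t in [set: R])
   ((expR (r ^+ 2 / 2))%:E * ((t <= r)%R%:R * gauss1 t)%:E))%E.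
  apply: eq_integral => t _; rewrite -EFinM; congr EFin.
  rewrite /half_gauss /gauss1 addrC subr_ge0 mulrCA -expRD; congr (_ * expR _).
  by field.
rewrite ge0_integralZl_EFin ?expR_ge0//.
- rewrite PhiE -EFinM; congr EFin.
  rewrite /lam expRD lnK; first by field.
  by rewrite posrE mulr_gt0// Phi_gt0.
- by move=> t _; rewrite lee_fin mulr_ge0 ?expR_ge0.
- by apply/measurable_EFinP; apply: measurable_funM; [exact: measurable_ger|exact: measurable_gauss1].
Qed.

#[local] Opaque lam half_gauss.

Let q2 : 0 < Num.sqrt (2 * pi) / 2 :> R.
Proof. by rewrite divr_gt0// sqrtr_gt0 mulr_gt0// pi_gt0. Qed.

(** By symmetry the half line carries half of the Gaussian mass. *)
Lemma lam0 : lam 0 = 0 :> R.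
Proof.
apply: expR_inj; rewrite expR0; apply: (mulfI (lt0r_neq0 q2)); rewrite mulr1.
apply/eqP; rewrite -eqe -integral_half_gauss; apply/eqP.
have := @ge0_symfun_integralT R gauss1 (fun t => expR_ge0 _) _ _.
rewrite integral_gauss1 => /(_ _ _)/esym H.
have {}H : (2%:E * \int[mu]_(x in [set x | (0 <= x)%R]) (gauss1 x)%:E = (Num.sqrt (2 * pi))%:E)%E.
  apply: H.
  - move=> t; apply: continuous_comp; last exact: continuous_expR.
    apply: (@continuousM _ R^o (fun t : R => - t ^+ 2)); last exact: cst_continuous.
    by apply: (@continuousN _ R^o); exact: exprn_continuous.
  - by move=> t /=; rewrite /gauss1 sqrrN.
have E : (\int[mu]_(x in [set x | (0 <= x)%R]) (gauss1 x)%:E =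
   \int[mu]_(t in [set: R]) (half_gauss 0 t)%:E)%E.
  rewrite integral_mkcond; apply: eq_integral => t _; rewrite patchE.
  have [t0|t0] := boolP (0 <= t)%R.
    by rewrite mem_set// half_gaussE// mul0r sub0r /gauss1 mulNr.
  by rewrite memNset ?half_gauss_lt0//=; exact/negP.
rewrite E in H.
have := integral_half_gauss 0 => I0; rewrite I0 in H *; move: H.
by rewrite -EFinM => -[H]; congr EFin; apply: (mulfI (x := 2)) => //; rewrite H; field.
Qed.

Lemma le_lam (r s : R) : r <= s -> lam r <= lam s.
Proof.
move=> rs.
suff : (\int[mu]_(t in [set: R]) (half_gauss r t)%:E <=
        \int[mu]_(t in [set: R]) (half_gauss s t)%:E)%E.
  by rewrite !integral_half_gauss lee_fin (ler_pM2l q2) ler_expR.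
apply: ge0_le_integral => //.
- by move=> t _; rewrite lee_fin half_gauss_ge0.
- by apply/measurable_EFinP; exact: measurable_half_gauss.
- by apply/measurable_EFinP; exact: measurable_half_gauss.
- move=> t _; rewrite lee_fin.
  have [t0|t0] := boolP (0 <= t)%R; last by rewrite !half_gauss_lt0.
  by rewrite !half_gaussE// ler_expR lerB// ler_wpM2r.
Qed.

Lemma expR_convex (th a b : R) : 0 <= th <= 1 ->
  expR ((1 - th) * a + th * b) <= (1 - th) * expR a + th * expR b.
Proof.
move=> /andP[th0 th1]; set c := _ + _.
have key x : expR c * (1 + (x - c)) <= expR x.
  have -> : expR x = expR c * expR (x - c) by rewrite -expRD addrC subrK.
  by rewrite ler_wpM2l ?expR_ge0// expR_ge1Dx.
have := key a; have := key b.
have cE : c = (1 - th) * a + th * b by [].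
have Ec := expR_gt0 c.
move=> /(ler_wpM2l th0) Hb; rewrite -subr_ge0 in th1; move=> /(ler_wpM2l th1) Ha.
apply: le_trans (lerD Ha Hb); rewrite le_eqVlt; apply/orP; left; apply/eqP.
by rewrite cE; ring.
Qed.

(** Hoelder's inequality, proved by convexity of [exp] at each [t]. The exponents are first shifted
    by [L - lam r] and [L - lam s], so that both terms of the pointwise bound have integrals
    proportional to the same [exp L]. *)
Lemma lam_convex (th r s : R) : 0 <= th <= 1 ->
  lam ((1 - th) * r + th * s) <= (1 - th) * lam r + th * lam s.
Proof.
move=> th01; have /andP[th0 th1] := th01.
set m := (1 - th) * r + th * s; set L := (1 - th) * lam r + th * lam s.
suff : (\int[mu]_(t in [set: R]) (half_gauss m t)%:E <=
        (Num.sqrt (2 * pi) / 2 * expR L)%:E)%E.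
  by rewrite integral_half_gauss lee_fin (ler_pM2l q2) ler_expR.
have mg x : measurable_fun [set: R] (fun t => (half_gauss x t)%:E).
  by apply/measurable_EFinP; exact: measurable_half_gauss.
have g0 x t : (0 <= (half_gauss x t)%:E)%E by rewrite lee_fin half_gauss_ge0.
have [k1 k1E] : {k | k = (1 - th) * expR (L - lam r)} by exact: exist _ _ erefl.
have [k2 k2E] : {k | k = th * expR (L - lam s)} by exact: exist _ _ erefl.
have k10 : 0 <= k1 by rewrite k1E; apply: mulr_ge0; [rewrite subr_ge0|exact: expR_ge0].
have k20 : 0 <= k2 by rewrite k2E; apply: mulr_ge0; [|exact: expR_ge0].
apply: (@le_trans _ _ (\int[mu]_(t in [set: R])
  (k1%:E * (half_gauss r t)%:E + k2%:E * (half_gauss s t)%:E))%E).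
  apply: ge0_le_integral => //.
  - exact: mg.
  - by apply: emeasurable_funD; apply: measurable_funeM; exact: mg.
  - move=> t _.
    suff E : half_gauss m t <= k1 * half_gauss r t + k2 * half_gauss s t by exact: E.
    have [t0|t0] := boolP (0 <= t)%R; last first.
      by rewrite !(half_gauss_lt0 _ t0) !mulr0 addr0.
    have aux (u e1 e2 g1 g2 h1 h2 : R) : e1 * g1 = h1 -> e2 * g2 = h2 ->
        u <= (1 - th) * h1 + th * h2 -> u <= (1 - th) * e1 * g1 + th * e2 * g2.
      by move=> <- <-; rewrite !mulrA.
    rewrite k1E k2E !(half_gaussE _ t0).
    apply: aux (esym (expRD _ _)) (esym (expRD _ _)) _.
    have := expR_convex (L - lam r + (r * t - t ^+ 2 / 2)) (L - lam s + (s * t - t ^+ 2 / 2)) th01.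
    apply: le_trans; rewrite ler_expR le_eqVlt; apply/orP; left; apply/eqP.
    by rewrite /L /m; ring.
have n1 t : (0 <= k1%:E * (half_gauss r t)%:E)%E by apply: mule_ge0; rewrite ?lee_fin ?half_gauss_ge0.
have n2 t : (0 <= k2%:E * (half_gauss s t)%:E)%E by apply: mule_ge0; rewrite ?lee_fin ?half_gauss_ge0.
rewrite ge0_integralD//; [|by apply: measurable_funeM; exact: mg..].
rewrite (ge0_integralZl_EFin _ _ _ _ k10)//; last exact: mg.
rewrite (ge0_integralZl_EFin _ _ _ _ k20)//; last exact: mg.
rewrite !integral_half_gauss.
have aux (q e1 e2 e f1 f2 k k' : R) : k = (1 - th) * f1 -> k' = th * f2 ->
    f1 * e1 = e -> f2 * e2 = e -> k * (q * e1) + k' * (q * e2) = q * e.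
  move=> -> -> H1 H2; transitivity (q * ((1 - th) * (f1 * e1) + th * (f2 * e2))); first by ring.
  by rewrite H1 H2; ring.
suff E : k1 * (Num.sqrt (2 * pi) / 2 * expR (lam r)) + k2 * (Num.sqrt (2 * pi) / 2 * expR (lam s))
    <= Num.sqrt (2 * pi) / 2 * expR L by exact: E.
rewrite le_eqVlt; apply/orP; left; apply/eqP.
by apply: aux k1E k2E _ _; rewrite -expRD subrK.
Qed.

Let slope_arith (M s t ls lt lM lM1 : R) : 0 <= t - s ->
  lt * (M + 1 - s) <= ls * (M + 1 - t) + lM1 * (t - s) ->
  lM * (M + 1 - t) <= lt + lM1 * (M - t) ->
  (lt - ls) * (M + 1 - t) <= (t - s) * (lM1 - lM) * (M + 1 - t).
Proof. by move=> st0 H1 /(ler_wpM2l st0); nra. Qed.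

(** Chord slopes of a convex function increase, so the slope over [[s, t]] is at most that over
    [[M, M + 1]]. The weights [a] and [b] write [t] between [s] and [M + 1], and [M] between [t] and
    [M + 1]. *)
Lemma lam_lipschitz (M s t : R) : s <= t -> t <= M ->
  lam t - lam s <= (t - s) * (lam (M + 1) - lam M).
Proof.
move=> st tM.
have [->|neq] := eqVneq s t; first by rewrite !subrr mul0r.
have tM1 : 0 < M + 1 - t by lra.
have sM1 : 0 < M + 1 - s by lra.
pose a := (t - s) / (M + 1 - s); pose b := (M - t) / (M + 1 - t).
have a01 : 0 <= a <= 1 by rewrite divr_ge0 ?ler_pdivrMr ?mul1r//=; lra.
have b01 : 0 <= b <= 1 by rewrite divr_ge0 ?ler_pdivrMr ?mul1r//=; lra.
have := lam_convex s (M + 1) a01; have := lam_convex t (M + 1) b01.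
have -> : (1 - a) * s + a * (M + 1) = t by rewrite /a; field; lra.
have -> : (1 - b) * t + b * (M + 1) = M by rewrite /b; field; lra.
have aE : a * (M + 1 - s) = t - s by rewrite divfK//; lra.
have bE : b * (M + 1 - t) = M - t by rewrite divfK//; lra.
move=> Hb Ha.
have mix (u A1 A2 D : R) : ((1 - u) * A1 + u * A2) * D = A1 * (D - u * D) + A2 * (u * D) by ring.
have H1 : lam t * (M + 1 - s) <= lam s * (M + 1 - t) + lam (M + 1) * (t - s).
  have := ler_wpM2r (ltW sM1) Ha; rewrite mix aE.
  by have -> : M + 1 - s - (t - s) = M + 1 - t by ring.
have H2 : lam M * (M + 1 - t) <= lam t + lam (M + 1) * (M - t).
  have := ler_wpM2r (ltW tM1) Hb; rewrite mix bE.
  have -> : M + 1 - t - (M - t) = 1 by ring.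
  by rewrite mulr1.
rewrite -(ler_pM2r tM1); apply: slope_arith H1 H2.
by rewrite subr_ge0.
Qed.

Lemma lam_lipschitz_norm (M s t : R) : s <= M -> t <= M ->
  `|lam s - lam t| <= (lam (M + 1) - lam M) * `|s - t|.
Proof.
wlog st : s t / s <= t.
  move=> H; case: (leP s t) => [|/ltW] st sM tM; first exact: H.
  by rewrite distrC (distrC s); exact: H.
move=> sM tM; rewrite distrC (distrC s) !ger0_norm ?subr_ge0 ?le_lam//.
by rewrite mulrC; exact: lam_lipschitz.
Qed.

Lemma lipschitz_continuous (h : R -> R) :
  (forall M, exists K, forall s t, s <= M -> t <= M -> `|h s - h t| <= K * `|s - t|) ->
  continuous h.
Proof.
move=> hK x; have [K xK] := hK (x + 1); apply/cvgrPdist_le => /= e e0.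
have L1 : 0 < `|K| + 1 by rewrite ltr_wpDl.
near=> y.
have yx : `|x - y| <= e / (`|K| + 1).
  by near: y; apply: cvgr_dist_le; [exact: cvg_id|rewrite divr_gt0].
have yM : y <= x + 1.
  have : `|x - y| <= 1 by near: y; apply: cvgr_dist_le; [exact: cvg_id|].
  by rewrite ler_norml => /andP[+ _]; rewrite lerBrDr addrC lerBlDr.
have xM : x <= x + 1 by rewrite lerDl.
apply: le_trans (xK _ _ xM yM) _.
apply: (@le_trans _ _ ((`|K| + 1) * (e / (`|K| + 1)))); last first.
  by rewrite mulrCA mulfV ?mulr1// gt_eqF.
apply: (@le_trans _ _ ((`|K| + 1) * `|x - y|)); last by rewrite ler_pM2l.
by rewrite ler_wpM2r// ler_wpDr// ler_norm.
Unshelve. all: by end_near. Qed.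

Lemma continuous_lam : continuous (@lam R).
Proof.
apply: lipschitz_continuous => M; exists (lam (M + 1) - lam M) => s t.
exact: lam_lipschitz_norm.
Qed.

End HalfGauss.

(** * Gaussian integrals with a rank-one term, and their tilted bounds *)

Section GaussQuad.
Variable R : realType.
Local Notation mu := (@lebesgue_measure R).
Local Notation q := (Num.sqrt (2 * pi) : R).

Lemma congr_expR (x y : R) : x = y -> expR x = expR y.
Proof. by move=> ->. Qed.

Lemma sqrt2pi_gt0 : 0 < q.
Proof. by rewrite sqrtr_gt0 mulr_gt0// pi_gt0. Qed.

Let quad_arith (a b S t : R) : S != 0 -> S + a ^+ 2 != 0 ->
  - (2^-1 * (t ^+ 2 + (b + a * t) ^+ 2 / S)) =
  - (2^-1 * (b ^+ 2 / (S + a ^+ 2))) +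
  - ((S + a ^+ 2) / (2 * S) * (t - (- (a * b) / (S + a ^+ 2))) ^+ 2).
Proof. by move=> S0 Sa0; field; rewrite S0 Sa0. Qed.

(** Integrating out one coordinate preserves the shape of the quadratic form and only replaces [S]
    by [S + a ^+ 2]. *)
Lemma integral_gauss_quad (a b S : R) : 0 < S ->
  (\int[mu]_(t in [set: R]) (expR (- (2^-1 * (t ^+ 2 + (b + a * t) ^+ 2 / S))))%:E =
   (q * Num.sqrt (S / (S + a ^+ 2)) * expR (- (2^-1 * (b ^+ 2 / (S + a ^+ 2)))))%:E)%E.
Proof.
move=> S0; have Sa0 : 0 < S + a ^+ 2 by rewrite ltr_pwDl// sqr_ge0.
pose al := (S + a ^+ 2) / (2 * S); pose m := - (a * b) / (S + a ^+ 2).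
have al0 : 0 < al by rewrite divr_gt0// mulr_gt0.
transitivity (\int[mu]_(t in [set: R])
  ((expR (- (2^-1 * (b ^+ 2 / (S + a ^+ 2)))))%:E * (expR (- (al * (t - m) ^+ 2)))%:E))%E.
  apply: eq_integral => t _; rewrite -EFinM; congr EFin.
  by rewrite -expRD; apply: congr_expR; apply: quad_arith; rewrite gt_eqF.
rewrite ge0_integralZl_EFin ?expR_ge0//; last first.
  by apply/measurable_EFinP; exact: measurable_quad.
rewrite integral_gauss_affine// -EFinM mulrC; congr (_ * _)%:E.
rewrite -sqrtrM ?mulr_ge0 ?pi_ge0//; congr Num.sqrt.
by rewrite /al; field; rewrite !gt_eqF.
Qed.

Definition quad_density (a : nat -> R) S D (x : env R) : R :=
  expR (- (2^-1 * (\sum_(0 <= j < D) x j ^+ 2 + (\sum_(0 <= j < D) a j * x j) ^+ 2 / S))).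

(** The square roots produced by the successive coordinates telescope into a single one. *)
Lemma iter_int_quad (a : nat -> R) S D m x : 0 < S -> (m <= D)%N ->
  iter_int m (fun x => (quad_density a S D x)%:E) x =
  (q ^+ m * Num.sqrt (S / (S + \sum_(0 <= j < m) a j ^+ 2)) *
    expR (- (2^-1 * (\sum_(m <= j < D) x j ^+ 2 + (\sum_(m <= j < D) a j * x j) ^+ 2 /
       (S + \sum_(0 <= j < m) a j ^+ 2)))))%:E.
Proof.
move=> S0; elim: m x => [|m IH] x mD /=.
  by rewrite [in RHS](@big_geq _ _ _ 0 0)// addr0 mulfV ?gt_eqF// sqrtr1 !mul1r.
have A0 k : 0 < S + \sum_(0 <= j < k) a j ^+ 2.
  by rewrite ltr_pwDl// sumr_ge0// => j _; exact: sqr_ge0.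
set C := q ^+ m * Num.sqrt (S / (S + \sum_(0 <= j < m) a j ^+ 2)).
have C0 : 0 <= C by rewrite mulr_ge0 ?exprn_ge0 ?sqrtr_ge0.
pose X2 := \sum_(m.+1 <= j < D) x j ^+ 2.
pose AX := \sum_(m.+1 <= j < D) a j * x j.
transitivity (\int[mu]_(t in [set: R]) ((C * expR (- (2^-1 * X2)))%:E *
  (expR (- (2^-1 * (t ^+ 2 + (AX + a m * t) ^+ 2 / (S + \sum_(0 <= j < m) a j ^+ 2)))))%:E))%E.
  apply: eq_integral => t _; rewrite IH ?(ltnW mD)// -EFinM; congr EFin.
  rewrite -/C -(mulrA C) -expRD; congr (_ * _); apply: congr_expR.
  rewrite !(big_ltn mD) eqxx.
  have -> : \sum_(m.+1 <= j < D) (if j == m then t else x j) ^+ 2 = X2.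
    by apply: eq_big_nat => j /andP[mj _]; rewrite gtn_eqF.
  have -> : \sum_(m.+1 <= j < D) a j * (if j == m then t else x j) = AX.
    by apply: eq_big_nat => j /andP[mj _]; rewrite gtn_eqF.
  by ring.
rewrite ge0_integralZl_EFin//; last 2 first.
- apply/measurable_EFinP; apply: measurableT_comp => //; apply: measurableT_comp => //.
  apply: measurable_funM => //; apply: measurable_funD; first exact: measurable_funX.
  apply: measurable_funM => //; apply: measurable_funX.
  by apply: measurable_funD => //; exact: measurable_funM.
- by rewrite mulr_ge0 ?expR_ge0.
rewrite integral_gauss_quad// -EFinM; congr EFin.
have sumS : S + \sum_(0 <= j < m.+1) a j ^+ 2 = S + \sum_(0 <= j < m) a j ^+ 2 + a m ^+ 2.
  by rewrite big_nat_recr//= addrA.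
have sq : Num.sqrt (S / (S + \sum_(0 <= j < m.+1) a j ^+ 2)) =
    Num.sqrt (S / (S + \sum_(0 <= j < m) a j ^+ 2)) *
    Num.sqrt ((S + \sum_(0 <= j < m) a j ^+ 2) / (S + \sum_(0 <= j < m) a j ^+ 2 + a m ^+ 2)).
  rewrite -sqrtrM; last by rewrite divr_ge0 ?ltW.
  congr Num.sqrt; rewrite sumS mulrA divfK// gt_eqF//.
have arith (C1 e1 qq s1 e2 s0 s2 e3 : R) : C1 = q ^+ m * s0 -> e1 * e2 = e3 -> s2 = s0 * s1 ->
    C1 * e1 * (qq * s1 * e2) = qq * q ^+ m * s2 * e3.
  by move=> -> <- ->; ring.
rewrite (exprS q m); apply: (arith _ _ _ _ _ _ _ _ erefl _ sq).
by rewrite -expRD sumS; apply: congr_expR; rewrite -/X2 -/AX; ring.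
Qed.

Lemma measurable_quad_density (a : nat -> R) S D :
  measurable_fun [set: env R] (quad_density a S D : env R -> R).
Proof.
have ms (g : nat -> env R -> R) : (forall j, measurable_fun [set: env R] (g j)) ->
    measurable_fun [set: env R] (fun x => \sum_(0 <= j < D) g j x).
  by move=> mg; apply: measurable_sum.
apply: measurableT_comp => //; apply: measurableT_comp => //.
apply: measurable_funM => //; apply: measurable_funD.
  by apply: ms => j; apply: measurable_funX; exact: measurable_coord.
apply: measurable_funM => //; apply: measurable_funX.
by apply: ms => j; apply: measurable_funM => //; exact: measurable_coord.
Qed.

Definition tilted (a : nat -> R) (s : R) (p j : nat) (t : R) : R :=
  ((p <= j)%N ==> (0 <= t)%R)%:R * expR (s * a j * t - t ^+ 2 / 2).

(** Logarithm of the integral of [tilted] relative to [sqrt (2 pi)]: a full Gaussian for [j < p], a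
    half-line one otherwise. *)
Definition tilted_exponent (a : nat -> R) (s : R) (p j : nat) : R :=
  if (j < p)%N then (s * a j) ^+ 2 / 2 else lam (s * a j) - ln 2.

Lemma tilted_ge0 a s p j t : 0 <= tilted a s p j t.
Proof. by rewrite /tilted mulr_ge0 ?expR_ge0. Qed.

Lemma measurable_tilted a s p j : measurable_fun [set: R] (tilted a s p j).
Proof.
apply: measurable_funM.
  by case: (p <= j)%N => //=; exact: measurable_ler.
apply: measurableT_comp => //; apply: measurable_funB; first exact: measurable_funM.
by apply: measurable_funM => //; exact: measurable_funX.
Qed.

Lemma integral_tilted a s p j :
  (\int[mu]_(t in [set: R]) (tilted a s p j t)%:E = (q * expR (tilted_exponent a s p j))%:E)%E.
Proof.
rewrite /tilted /tilted_exponent; case: (ltnP j p) => jp.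
  have h2 : (0 : R) < 2^-1 by rewrite invr_gt0.
  transitivity (\int[mu]_(t in [set: R]) ((expR ((s * a j) ^+ 2 / 2))%:E *
      (expR (- (2^-1 * (t - s * a j) ^+ 2)))%:E))%E.
    apply: eq_integral => t _; rewrite -EFinM -expRD mul1r; congr EFin.
    by apply: congr_expR; field.
  rewrite ge0_integralZl_EFin ?expR_ge0//; last first.
    by apply/measurable_EFinP; exact: measurable_quad.
  by rewrite integral_gauss_affine// -EFinM mulrC invrK (mulrC pi).
rewrite [LHS](_ : _ = (\int[mu]_(t in [set: R]) (half_gauss (s * a j) t)%:E)%E)//.
rewrite integral_half_gauss expRD expRN lnK ?posrE//; congr EFin.
by rewrite -mulrA; congr (_ * _); rewrite mulrC.
Qed.

Lemma quad_density_le (a : nat -> R) (W s : R) D p x : 0 < W ->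
  (\prod_(0 <= j < D) ((p <= j)%N ==> (0 <= x j)%R)%:R) * quad_density a (W ^+ 2) D x <=
  expR (s ^+ 2 / 2 * W ^+ 2) * \prod_(0 <= j < D) tilted a s p j (x j).
Proof.
move=> W0; rewrite /tilted big_split /= mulrCA.
apply: ler_wpM2l; first by rewrite prodr_ge0.
rewrite big_mkord -expR_sum -expRD ler_expR /quad_density.
rewrite -(big_mkord xpredT (fun j => s * a j * x j - x j ^+ 2 / 2)) sumrB -mulr_suml.
set X2 := \sum_(0 <= j < D) x j ^+ 2.
have -> : \sum_(0 <= j < D) s * a j * x j = s * \sum_(0 <= j < D) a j * x j.
  by rewrite mulr_sumr; apply: eq_bigr => j _; rewrite mulrA.
set T := \sum_(0 <= j < D) a j * x j.
(* the tangent line of slope [s] of the concave function [T |-> - T^2 / (2 W^2)] *)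
have : 0 <= (T / W + s * W) ^+ 2 / 2 by rewrite divr_ge0// sqr_ge0.
have -> : (T / W + s * W) ^+ 2 / 2 = 2^-1 * (T ^+ 2 / W ^+ 2) + s * T + s ^+ 2 / 2 * W ^+ 2.
  by field; rewrite gt_eqF.
rewrite mulrDr; lra.
Qed.

Lemma iter_int_quad_orthant (a : nat -> R) (W s : R) D p : 0 < W ->
  exists2 r, 0 < r <= expR (s ^+ 2 / 2 * W ^+ 2) * (q ^+ D *
     expR (\sum_(0 <= j < D) tilted_exponent a s p j)) &
  iter_int D (fun x => ((\prod_(0 <= j < D) ((p <= j)%N ==> (0 <= x j)%R)%:R) *
    quad_density a (W ^+ 2) D x)%:E) (fun=> 0) = r%:E.
Proof.
move=> W0; set I := iter_int _ _ _.
have mprod : measurable_fun [set: env R] (fun x : env R =>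
    \prod_(0 <= j < D) ((p <= j)%N ==> (0 <= x j)%R)%:R : R).
  apply: (measurable_prod_coord (phi := fun j t => ((p <= j)%N ==> (0 <= t)%R)%:R)) => j.
  by case: (p <= j)%N => //=; exact: measurable_ler.
have mg : measurable_fun [set: env R] (fun x : env R =>
   ((\prod_(0 <= j < D) ((p <= j)%N ==> (0 <= x j)%R)%:R) * quad_density a (W ^+ 2) D x)%:E).
  by apply/measurable_EFinP; apply: measurable_funM => //; exact: measurable_quad_density.
have g0 (x : env R) : (0 <= ((\prod_(0 <= j < D) ((p <= j)%N ==> (0 <= x j)%R)%:R) *
    quad_density a (W ^+ 2) D x)%:E)%E.
  by rewrite lee_fin mulr_ge0 ?expR_ge0// prodr_ge0.
have I0 : (0 < I)%E.
  apply: (@iter_int_gt0 R D _ (fun=> 0) (fun=> 1)) => // y y01 _.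
  rewrite lte_fin mulr_gt0 ?expR_gt0// big_mkord prodr_gt0// => j _.
  by have /andP[-> _] := y01 j (ltn_ord j); rewrite implybT.
have mt : measurable_fun [set: env R] (fun x : env R => \prod_(0 <= j < D) tilted a s p j (x j)).
  by apply: measurable_prod_coord => j; exact: measurable_tilted.
have I1 : (I <= (expR (s ^+ 2 / 2 * W ^+ 2) * (q ^+ D *
     expR (\sum_(0 <= j < D) tilted_exponent a s p j)))%:E)%E.
  have E := @iter_int_prod R (tilted a s p) (fun j => q * expR (tilted_exponent a s p j)) D D
    (fun=> 0) (tilted_ge0 a s p) (measurable_tilted a s p) (fun j _ => integral_tilted a s p j) (leqnn D).
  rewrite (@big_geq _ _ _ D D)// mulr1 big_split /= prodr_const_nat subn0 in E.
  rewrite [X in (_ * (_ * X))%:E](_ : _ = \prod_(0 <= j < D) expR (tilted_exponent a s p j)); last first.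
    by rewrite !big_mkord expR_sum.
  rewrite EFinM -E -iter_intZl ?lee_fin ?expR_ge0//.
  - apply: le_iter_int => //.
    + by apply: measurable_funeM; exact/measurable_EFinP.
    + by move=> y; rewrite -EFinM lee_fin; exact: quad_density_le.
  - exact/measurable_EFinP.
  - by move=> y; rewrite lee_fin prodr_ge0// => j _; exact: tilted_ge0.
have If : I \is a fin_num by rewrite fin_numElt (lt_trans _ I0)// (le_lt_trans I1)// ltry.
exists (fine I); last by rewrite fineK.
by rewrite -lte_fin -lee_fin fineK// I0.
Qed.

End GaussQuad.

(** * Exponential bound for the internal angle at fixed [n] *)

Section InternalAngleBound.
Variables (R : realType) (f : R -> R) (n d : nat) (p : 'I_d.+1).
Hypothesis dn : (d.+1 <= n)%N.
Hypothesis w0 : forall i : 'I_n, 0 < wt f i.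

Let v (i : nat) : R := f (i.+1%:R / n%:R).
Let a (j : nat) : R := v (bump p j).

Lemma sum_bump (F G : nat -> R) :
  \sum_(0 <= j < d) (if (j < p)%N then F (bump p j) else G (bump p j)) =
  \sum_(0 <= i < p) F i + \sum_(p.+1 <= i < d.+1) G i.
Proof.
have pd : (p <= d)%N by rewrite -ltnS.
rewrite (@big_cat_nat _ _ _ p 0 d)//= big_add1 /=; congr (_ + _).
  by apply: eq_big_nat => j /andP[_ jp]; rewrite jp /bump leqNgt jp.
by apply: eq_big_nat => j /andP[pj _]; rewrite ltnNge pj /= /bump pj.
Qed.

Lemma sum_sq_bump : v p ^+ 2 + \sum_(0 <= j < d) a j ^+ 2 = \sum_(0 <= i < d.+1) v i ^+ 2.
Proof.
have pd : (p <= d.+1)%N by rewrite ltnW.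
have := sum_bump (fun i => v i ^+ 2) (fun i => v i ^+ 2).
rewrite (eq_bigr (fun j => a j ^+ 2)); last by move=> j _; case: ifP.
move=> ->; rewrite (@big_cat_nat _ _ _ p 0 d.+1)//= [in RHS](@big_ltn _ _ _ p)//.
by rewrite addrCA.
Qed.

(** The pivot is absent from the integrated coordinates; the constant left by the tangent line, with
    [W = v p], is exactly its missing term. *)
Lemma tilted_exponent_bump s :
  s ^+ 2 / 2 * v p ^+ 2 + \sum_(0 <= j < d) tilted_exponent a s p j =
  s ^+ 2 / 2 * \sum_(0 <= i < p.+1) v i ^+ 2 +
  \sum_(p.+1 <= i < d.+1) (lam (s * v i) - ln 2).
Proof.
rewrite (sum_bump (fun i => (s * v i) ^+ 2 / 2) (fun i => lam (s * v i) - ln 2)).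
rewrite [in RHS]big_nat_recr//= addrA; congr (_ + _).
rewrite addrC mulrDr; congr (_ + _).
by rewrite mulr_sumr; apply: eq_bigr => i _; rewrite exprMn mulrAC.
Qed.

(** Positivity is recorded because [ln] is 0 on nonpositive reals: an upper bound alone would not
    bound the logarithm of the angle. *)
Lemma int_angle_bound (s : R) :
  0 < int_angle (face0 f n p.+1) (face0 f n d.+1) <=
  expR (s ^+ 2 / 2 * \sum_(0 <= i < p.+1) v i ^+ 2 +
    \sum_(p.+1 <= i < d.+1) (lam (s * v i) - ln 2)) *
  ((\sum_(0 <= i < d.+1) v i ^+ 2) / v p ^+ 2).
Proof.
have v0 : 0 < v p := w0 (pivot p dn).
rewrite int_angleE//.
have dE : int_density f p dn = quad_density a (v p ^+ 2) d.
  apply/funext => x; rewrite /int_density /quad_density.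
  by rewrite !big_mkord.
rewrite dE.
have -> : (fun x : env R => ((\prod_(j < d) (((p <= j)%N ==> (0 <= x j)) : nat)%:R) *
    quad_density a (v p ^+ 2) d x)%:E) =
  (fun x : env R => ((\prod_(0 <= j < d) ((p <= j)%N ==> (0 <= x j))%:R) *
    quad_density a (v p ^+ 2) d x)%:E).
  by apply/funext => x; rewrite big_mkord.
have [r /andP[r0 rle] ->] := iter_int_quad_orthant a s d p v0.
rewrite iter_int_quad ?exprn_gt0// !(@big_geq _ _ _ d d)// expr0n /= mul0r addr0 mulr0 oppr0 expR0 mulr1.
set A := \sum_(0 <= j < d) a j ^+ 2 in rle *.
have A0 : 0 <= A by rewrite sumr_ge0// => j _; exact: sqr_ge0.
have V0 : 0 < v p ^+ 2 by rewrite exprn_gt0.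
have VA0 : 0 < v p ^+ 2 + A by rewrite ltr_pwDl.
set y := v p ^+ 2 / (v p ^+ 2 + A).
have y0 : 0 < y by rewrite divr_gt0.
have y1 : y <= 1 by rewrite ler_pdivrMr// mul1r lerDl.
have sy0 : 0 < Num.sqrt y by rewrite sqrtr_gt0.
have q0 : 0 < Num.sqrt (2 * pi) ^+ d :> R by rewrite exprn_gt0// sqrt2pi_gt0.
apply/andP; split; first by rewrite divr_gt0// mulr_gt0.
rewrite -tilted_exponent_bump -sum_sq_bump -/A.
rewrite ler_pdivrMr ?mulr_gt0//=.
apply: (le_trans rle); rewrite expRD.
set e1 := expR _; set e2 := expR _; set qd := _ ^+ d.
have -> : e1 * (qd * e2) = e1 * e2 * qd * 1 by ring.
have -> : e1 * e2 * ((v p ^+ 2 + A) / v p ^+ 2) * (qd * Num.sqrt y) =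
  e1 * e2 * qd * ((v p ^+ 2 + A) / v p ^+ 2 * Num.sqrt y) by ring.
apply: ler_wpM2l; first by rewrite !mulr_ge0 ?expR_ge0// ltW.
(* Dividing by the normalising integral costs [1 / sqrt y]; this is weakened to [1 / y], at most
   linear in [n] in the application. *)
have -> : (v p ^+ 2 + A) / v p ^+ 2 = y^-1 by rewrite invf_div.
rewrite mulrC ler_pdivlMr// mul1r.
have sy1 : Num.sqrt y <= 1 by rewrite -[X in _ <= X]sqrtr1 ler_wsqrtr.
by have := ler_wpM2r (ltW sy0) sy1; rewrite mul1r -expr2 sqr_sqrtr// ltW.
Qed.

End InternalAngleBound.

(** * Integrals over segments and Riemann sums *)

Section Riemann.
Variable R : realType.
Local Notation mu := (@lebesgue_measure R).
Implicit Types (a b c k : R) (g h : R -> R).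

Lemma RInt_integrable a b g : {within `[a, b], continuous g} ->
  mu.-integrable `[a, b] (EFin \o g).
Proof. by move=> cg; apply: continuous_compact_integrable => //; exact: segment_compact. Qed.

Lemma within_subitv a b c d g : a <= c -> d <= b ->
  {within `[a, b], continuous g} -> {within `[c, d], continuous g}.
Proof.
move=> ac db; apply: continuous_subspaceW => x /=; rewrite !in_itv /= => /andP[cx xd].
by rewrite (le_trans ac cx) (le_trans xd db).
Qed.

Lemma within_comp a b g h : {within `[a, b], continuous g} -> continuous h ->
  {within `[a, b], continuous (h \o g)}.
Proof. by move=> cg ch x; apply: (@continuous_comp (subspace `[a, b]) R R g h x); [exact: cg|exact: ch]. Qed.

Lemma RInt_split a b c g : a <= c -> c <= b -> {within `[a, b], continuous g} ->
  RInt a b g = RInt a c g + RInt c b g.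
Proof.
move=> ac cb cg; apply/eqP; rewrite addrC -subr_eq; apply/eqP.
rewrite /RInt (@Rintegral_itvB _ g (BLeft a) (BRight b) c)//.
- apply: Rintegral_itv_obnd_cbnd.
  apply: (integrableS _ _ _ (RInt_integrable (within_subitv ac (lexx b) cg))) => //.
  by apply: subset_itvr; rewrite bnd_simp.
- exact: RInt_integrable.
Qed.

Lemma le_RInt a b g h : {within `[a, b], continuous g} -> {within `[a, b], continuous h} ->
  (forall u, a <= u <= b -> g u <= h u) -> RInt a b g <= RInt a b h.
Proof.
move=> cg ch gh; by apply: le_Rintegral => //; exact: RInt_integrable.
Qed.

Lemma RInt_cst a b k : a <= b -> RInt a b (fun=> k) = k * (b - a).
Proof.
move=> ab; rewrite /RInt (@Rintegral_cst _ _ _ mu `[a, b])//; congr (_ * _).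
have E : mu `[a, b]%classic = if a < b then (b - a)%:E else 0%E.
  by rewrite lebesgue_measure_itv /= lte_fin; case: ifP.
apply: (etrans (congr1 fine E)); case: ltP => [_//|ba] /=.
by rewrite (@le_anti _ _ a b) ?ab// subrr.
Qed.

Lemma RInt_ge_cst a b k g : a <= b -> {within `[a, b], continuous g} ->
  (forall u, a <= u <= b -> k <= g u) -> k * (b - a) <= RInt a b g.
Proof.
move=> ab cg kg; rewrite -RInt_cst//; apply: le_RInt => //.
by apply: continuous_subspaceT; exact: cst_continuous.
Qed.

Lemma within_comb a b k l g h : {within `[a, b], continuous g} -> {within `[a, b], continuous h} ->
  {within `[a, b], continuous (fun u => k * g u + l * h u)}.
Proof.
move=> cg ch x.
have H1 := @within_comp _ _ _ _ cg (@mulrl_continuous _ k) x.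
have H2 := @within_comp _ _ _ _ ch (@mulrl_continuous _ l) x.
exact: (continuousD H1 H2).
Qed.

Lemma RInt_comb a b k l g h : {within `[a, b], continuous g} -> {within `[a, b], continuous h} ->
  RInt a b (fun u => k * g u + l * h u) = k * RInt a b g + l * RInt a b h.
Proof.
move=> cg ch; rewrite /RInt RintegralD//; try (by apply: RInt_integrable; apply: within_comp => //; exact: mulrl_continuous).
by rewrite !RintegralZl//; exact: RInt_integrable.
Qed.

Lemma RInt_sub_le a b c d g : a <= c -> c <= d -> d <= b -> {within `[a, b], continuous g} ->
  (forall u, a <= u <= b -> 0 <= g u) -> RInt c d g <= RInt a b g.
Proof.
move=> ac cd db cg g0.
have cb := le_trans cd db; have ad := le_trans ac cd.
rewrite (RInt_split ac cb cg) (RInt_split cd db (within_subitv ac (lexx b) cg)).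
have H1 : 0 <= RInt a c g.
  by apply: Rintegral_ge0 => u /=; rewrite in_itv /= => /andP[au uc]; rewrite g0// au (le_trans uc).
have H2 : 0 <= RInt d b g.
  by apply: Rintegral_ge0 => u /=; rewrite in_itv /= => /andP[du ub]; rewrite g0// ub (le_trans ad).
by rewrite addrCA lerDl addr_ge0.
Qed.

Lemma riemann_lower (n i j : nat) (c : nat -> R) g : (0 < n)%N -> (i <= j)%N ->
  {within `[i%:R / n%:R, j%:R / n%:R], continuous g} ->
  (forall m u, (i <= m < j)%N -> m%:R / n%:R <= u <= m.+1%:R / n%:R -> c m <= g u) ->
  \sum_(i <= m < j) c m <= n%:R * RInt (i%:R / n%:R) (j%:R / n%:R) g.
Proof.
move=> n0; have nR : (0 : R) < n%:R by rewrite ltr0n.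
move=> ij; rewrite -(subnKC ij); elim: (j - i)%N => [|m IH] cg H.
  rewrite addn0 big_geq//; apply: mulr_ge0 => //; rewrite /RInt set_itv1.
  by rewrite Rintegral_set1.
rewrite addnS in cg H *.
have mn : (i + m)%:R / n%:R <= (i + m).+1%:R / n%:R :> R.
  by rewrite ler_pM2r ?invr_gt0// ler_nat.
have im : i%:R / n%:R <= (i + m)%:R / n%:R :> R.
  by rewrite ler_pM2r ?invr_gt0// ler_nat leq_addr.
rewrite big_nat_recr ?leq_addr//= (RInt_split im mn cg) mulrDr; apply: lerD.
  apply: IH; first exact: within_subitv cg.
  by move=> k u /andP[ik km]; apply: H; rewrite ik ltnW.
have Hc u : (i + m)%:R / n%:R <= u <= (i + m).+1%:R / n%:R -> c (i + m)%N <= g u.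
  by apply: H; rewrite leq_addr /=.
have K := RInt_ge_cst mn (within_subitv im (lexx _) cg) Hc.
apply: le_trans (ler_wpM2l (ltW nR) K).
by rewrite -mulrBl -natrB// subSnn mulrCA mul1r mulfV ?mulr1// gt_eqF.
Qed.

Lemma eventually_ln (A e : R) : 0 < e ->
  exists n0 : nat, forall n, (n0 < n)%N -> A + ln n%:R < n%:R * e.
Proof.
(* Half of [e] absorbs the constant [A - ln h], the other half absorbs [ln (h * n) < h * n]. *)
move=> e0; pose h := e / 2.
have h0 : 0 < h by rewrite divr_gt0.
pose B := `|A - ln h| / h.
exists (Num.trunc B).+1 => n nB.
have Bn : B < n%:R.
  apply: (lt_le_trans (truncnS_gt B)); rewrite ler_nat; exact: ltnW.
have n0 : (0 : R) < n%:R.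
  by rewrite ltr0n (leq_trans _ nB).
have H1 : ln (h * n%:R) < h * n%:R by apply: ln_sublinear; rewrite mulr_gt0.
rewrite lnM ?posrE// in H1.
have H2 : `|A - ln h| < h * n%:R by move: Bn; rewrite /B ltr_pdivrMr// mulrC.
have := ler_norm (A - ln h).
have -> : n%:R * e = h * n%:R + h * n%:R by rewrite /h; field.
lra.
Qed.

End Riemann.

(** Beyond distance [T = 2 K / c] from 0 the quadratic term outweighs a linear decrease of slope
    [K]. *)
Lemma min_arith (R : realType) (c T s h K : R) : 0 < c -> T * c = 2 * K -> s <= - T ->
  s <= 0 -> 0 <= h + K * (- s) -> 0 <= c / 2 * s ^+ 2 + h.
Proof.
move=> c0 TE sT s0 hK.
have : 0 <= - s * c * (- s - T) by rewrite !mulr_ge0 ?(ltW c0)//; lra.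
have -> : - s * c * (- s - T) = c * s ^+ 2 - (- s) * (T * c) by ring.
by rewrite TE; nra.
Qed.

(** First-order optimality without derivatives: a violation by [X > 0] would make a short step from
    [s0] towards [s] gain [th * X] at the quadratic cost [th ^+ 2 * D / 2]. *)
Lemma subgradient_arith (R : realType) (c s0 s h0 h : R) : 0 < c ->
  (forall th, 0 <= th <= 1 -> c / 2 * s0 ^+ 2 + h0 <=
     c / 2 * ((1 - th) * s0 + th * s) ^+ 2 + ((1 - th) * h0 + th * h)) ->
  h0 - c * s0 * (s - s0) <= h.
Proof.
move=> c0 s0min; rewrite leNgt; apply/negP => Hlt.
pose X := h0 - c * s0 * (s - s0) - h.
have X0 : 0 < X by rewrite /X subr_gt0.
pose D := c * (s - s0) ^+ 2.
have D0 : 0 <= D by rewrite mulr_ge0 ?sqr_ge0// ltW.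
(* This choice satisfies [th * D < X] and lies in []0, 1]] even when [D = 0]. *)
pose th := X / (X + D).
have XD : 0 < X + D by rewrite ltr_pwDl.
have th0 : 0 < th by rewrite divr_gt0.
have th1 : th <= 1 by rewrite ler_pdivrMr// mul1r lerDl.
have Jle := s0min th; rewrite (ltW th0) th1 in Jle; have {}Jle := Jle isT.
have : th * X <= th * (th * (D / 2)).
  have -> : th * X = th * (h0 - h) - c * s0 * (th * (s - s0)) by rewrite /X; ring.
  have -> : th * (th * (D / 2)) = c / 2 * ((1 - th) * s0 + th * s) ^+ 2 - c / 2 * s0 ^+ 2
      - c * s0 * (th * (s - s0)) by rewrite /D; field.
  lra.
rewrite ler_pM2l// => XthD.
have thE : th * (X + D) = X by rewrite /th divfK// gt_eqF.
have : 0 < th * X by rewrite mulr_gt0.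
move: X0 D0 XD th0 XthD thE; clearbody th X D; clear; nra.
Qed.

(** The subgradient inequality divided by [c0]: at slope [y0 = - c1 * s0 / c0] the conjugate of
    [lam0] is attained at [s0]. *)
Lemma fenchel_arith (R : realType) (c0 c1 s s0 h h0 : R) : 0 < c0 ->
  h0 - c1 * s0 * (s - s0) <= h ->
  s * (- (c1 * s0) / c0) - c0^-1 * h <= s0 * (- (c1 * s0) / c0) - c0^-1 * h0.
Proof.
move=> c0p; have ci : 0 < c0^-1 by rewrite invr_gt0.
rewrite -(ler_pM2l ci) => H; nra.
Qed.

Lemma eta_arith (R : realType) (c0 c1 s0 h0 : R) : c0 != 0 -> c1 != 0 ->
  c0 ^+ 2 / (2 * c1) * (- (c1 * s0) / c0) ^+ 2 + c0 * (s0 * (- (c1 * s0) / c0) - c0^-1 * h0) =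
  - (c1 / 2 * s0 ^+ 2 + h0).
Proof. by move=> c0n c1n; field; rewrite c0n c1n. Qed.

#[local] Opaque RInt lam.

(** * The minimised exponent and its comparison with [psi_int] *)

Section InternalExponent.
Variables (R : realType) (f : R -> R) (delta tau : R).
Hypothesis cf : {within `[0, 1], continuous f}.
Hypothesis mf : forall u v : R, 0 <= u -> u <= v -> v <= 1 -> f u <= f v.
Hypothesis f_ge0 : forall u : R, 0 <= u -> u <= 1 -> 0 <= f u.
Hypothesis f_gt0 : forall u : R, 0 < u -> u <= 1 -> 0 < f u.
Hypotheses (delta0 : 0 < delta) (dt : delta < tau) (tau1 : tau < 1).

Let delta1 : delta <= 1. Proof. exact: ltW (lt_trans dt tau1). Qed.
Let tau0 : 0 < tau. Proof. exact: lt_trans dt. Qed.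

Let c0 := RInt delta tau f.
Let c1 := RInt 0 delta (fun u => f u ^+ 2).
Let H (s : R) := RInt delta tau (fun u => lam (s * f u)).
Let L : R := lam (0 + 1) - lam 0.

Let L0 : 0 <= L. Proof. by rewrite subr_ge0 le_lam// lerDl. Qed.

Let cf_dt : {within `[delta, tau], continuous f}.
Proof. exact: within_subitv (ltW delta0) (ltW tau1) cf. Qed.

Lemma within_sq a b : 0 <= a -> b <= 1 -> {within `[a, b], continuous (fun u => f u ^+ 2)}.
Proof.
move=> a0 b1; apply: (within_comp (within_subitv a0 b1 cf) (h := fun y => y ^+ 2)).
exact: exprn_continuous.
Qed.

Let cH s : {within `[delta, tau], continuous (fun u => lam (s * f u))}.
Proof.
apply: (within_comp cf_dt (h := fun y => lam (s * y))) => y.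
by apply: continuous_comp; [exact: mulrl_continuous|exact: continuous_lam].
Qed.

Let f_dt u : delta <= u <= tau -> 0 <= f u.
Proof.
by move=> /andP[du ut]; rewrite f_ge0// ?(le_trans (ltW delta0))// (le_trans ut)// ltW.
Qed.

Lemma c0_gt0 : 0 < c0.
Proof.
apply: lt_le_trans (RInt_ge_cst (k := f delta) (ltW dt) cf_dt _).
  by rewrite mulr_gt0 ?f_gt0// subr_gt0.
by move=> u /andP[du ut]; rewrite mf ?(ltW delta0)// (le_trans ut)// ltW.
Qed.

Lemma c1_gt0 : 0 < c1.
Proof.
have d2 : 0 <= delta / 2 by rewrite divr_ge0 ?ltW.
have d2d : delta / 2 <= delta by rewrite ler_pdivrMr// ler_peMr ?ltW// ltr1n.
have f2 : 0 < f (delta / 2) by rewrite f_gt0 ?divr_gt0// (le_trans d2d).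
apply: lt_le_trans (RInt_sub_le d2 d2d (lexx _) (within_sq (lexx 0) delta1) _); last first.
  by move=> u _; exact: sqr_ge0.
apply: lt_le_trans (RInt_ge_cst (k := f (delta / 2) ^+ 2) d2d (within_sq d2 delta1) _).
  rewrite mulr_gt0 ?exprn_gt0// subr_gt0 ltr_pdivrMr// ltr_pMr//.
  by rewrite ltr1n.
move=> u /andP[du ud]; rewrite lerXn2r ?nnegrE ?(ltW f2)//; last by rewrite mf// (le_trans ud).
by rewrite f_ge0 ?(le_trans d2)// (le_trans ud).
Qed.

Let H_convex th r s : 0 <= th <= 1 -> H ((1 - th) * r + th * s) <= (1 - th) * H r + th * H s.
Proof.
move=> th01; rewrite /H -RInt_comb; [|exact: cH..].
apply: le_RInt; first exact: cH.
  exact: within_comb.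
move=> u _; rewrite mulrDl -!mulrA; exact: lam_convex.
Qed.

(** [lam] is Lipschitz on half lines []-oo, K]] but not globally, whence the common bound on the
    arguments; integrating [|s - t| * f u] produces [c0]. *)
Let H_lip_bound K s t : (forall u, delta <= u <= tau -> s * f u <= K) ->
  (forall u, delta <= u <= tau -> t * f u <= K) ->
  H s <= H t + (lam (K + 1) - lam K) * c0 * `|s - t|.
Proof.
move=> sK tK; rewrite mulrAC -[H t]mul1r /H /c0 -RInt_comb; [|exact: cH|exact: cf_dt].
apply: le_RInt; first exact: cH.
  by apply: within_comb; [exact: cH|exact: cf_dt].
move=> u udt; have fu := f_dt udt; rewrite mul1r -lerBlDl.
apply: le_trans (ler_norm _) _.
apply: le_trans (lam_lipschitz_norm (sK u udt) (tK u udt)) _.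
by rewrite -mulrBl normrM (ger0_norm fu) mulrA.
Qed.

Let H_lipM M s t : s <= M -> t <= M ->
  H s <= H t + (lam (`|M| * f tau + 1) - lam (`|M| * f tau)) * c0 * `|s - t|.
Proof.
have key r u : r <= M -> delta <= u <= tau -> r * f u <= `|M| * f tau.
  move=> rM udt; have /andP[du ut] := udt.
  apply: (@le_trans _ _ (`|M| * f u)).
    by rewrite ler_wpM2r ?f_dt// (le_trans rM)// ler_norm.
  by rewrite ler_wpM2l// mf ?(le_trans (ltW delta0))// ltW.
by move=> sM tM; apply: H_lip_bound => u; exact: key.
Qed.

Let H_lip s t : s <= 0 -> t <= 0 -> H s <= H t + L * c0 * `|s - t|.
Proof.
by move=> s0 t0; apply: H_lip_bound => u udt; apply: mulr_le0_ge0 => //; exact: f_dt.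
Qed.

Let H0 : H 0 = 0.
Proof.
rewrite /H (_ : (fun u => lam (0 * f u)) = fun=> 0).
  by rewrite RInt_cst ?(ltW dt)// mul0r.
by apply/funext => u; rewrite mul0r lam0.
Qed.

Let H_ge0 s : 0 <= s -> 0 <= H s.
Proof.
move=> s0; rewrite -H0; apply: le_RInt; [exact: cH|exact: cH|].
by move=> u udt; rewrite le_lam// mul0r mulr_ge0// f_dt.
Qed.

Definition int_exponent (s : R) : R := c1 / 2 * s ^+ 2 + H s.
Local Notation J := int_exponent.

Let J_continuous T : {within `[- T, 0], continuous J}.
Proof.
rewrite (_ : J = fun s => c1 / 2 * s ^+ 2 + 1 * H s); last by apply/funext => s; rewrite mul1r.
apply: within_comb; apply: continuous_subspaceT; first exact: exprn_continuous.
apply: lipschitz_continuous => M; pose K := `|M| * f tau.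
exists ((lam (K + 1) - lam K) * c0) => s t sM tM.
have HK := H_lipM sM tM; have HK' := H_lipM tM sM; rewrite distrC in HK'.
by rewrite ler_norml lerBlDl HK andbT lerNl opprB lerBlDl.
Qed.

(** [J 0 = 0], and [J] is nonnegative both for [s >= 0], where [H] is, and for [s <= - T], because
    [H] decreases at most with slope [L * c0] to the left of 0. Hence the minimum over [[- T, 0]] is
    global. *)
Lemma int_exponent_min : exists2 s0, s0 <= 0 & forall s, J s0 <= J s.
Proof.
pose T := 2 * L * c0 / c1.
have T0 : 0 <= T by rewrite divr_ge0 ?(ltW c1_gt0)// !mulr_ge0 ?(ltW c0_gt0).
have J0 : J 0 = 0 by rewrite /J expr0n /= mulr0 H0 addr0.
have NT0 : - T <= 0 by rewrite oppr_le0.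
have [s0 s0T s0min] := EVT_min NT0 (@J_continuous T).
have s00 : s0 <= 0 by move: s0T; rewrite in_itv /= => /andP[].
have Js0 : J s0 <= 0 by rewrite -J0; apply: s0min; rewrite in_itv /= NT0 lexx.
exists s0; first exact: s00.
move=> s; case: (leP 0 s) => [s_ge0|/ltW s_le0].
  apply: (le_trans Js0); apply: addr_ge0; last exact: H_ge0.
  by apply: mulr_ge0; [apply: divr_ge0 => //; exact: ltW c1_gt0|exact: sqr_ge0].
case: (leP (- T) s) => [Ts|/ltW sT].
  by apply: s0min; rewrite in_itv /= Ts s_le0.
apply: (le_trans Js0); apply: (min_arith (K := L * c0) (T := T)).
- exact: c1_gt0.
- by rewrite /T divfK ?mulrA// gt_eqF// c1_gt0.
- exact: sT.
- exact: s_le0.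
- by have := H_lip (lexx 0) s_le0; rewrite H0 sub0r normrN ler0_norm.
Qed.

Let subgradient s0 : (forall s, J s0 <= J s) -> forall s, H s0 - c1 * s0 * (s - s0) <= H s.
Proof.
move=> s0min s; apply: (subgradient_arith c1_gt0) => th th01.
apply: (le_trans (s0min ((1 - th) * s0 + th * s))).
by apply: lerD; [exact: lexx|exact: H_convex].
Qed.

(* It suffices to evaluate [eta] at [y0 = - c1 s0 / c0], where the supremum defining
   [lam0s] is attained at [s0]. *)
Lemma psi_int_ge : exists2 s0, s0 <= 0 &
  ((- ((tau - delta) * ln 2) + int_exponent s0)%:E <= psi_int f delta tau)%E.
Proof.
have [s0 s00 s0min] := int_exponent_min; exists s0 => //.
have sub := subgradient s0min.
have c0p := c0_gt0; have c1p := c1_gt0.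
rewrite /psi_int -/c0 -/c1 EFinD; apply: leeD => //.
rewrite -[X in (X <= _)%E]oppeK leeN2 -EFinN.
pose y0 := - (c1 * s0) / c0.
pose lam0s y := ereal_sup [set (s * y - c0^-1 * H s)%:E | s in [set: R]].
apply: (@le_trans _ _ ((c0 ^+ 2 / (2 * c1) * y0 ^+ 2)%:E + c0%:E * lam0s y0)%E).
  by apply: ereal_inf_lbound; exists y0.
have : (lam0s y0 <= (s0 * y0 - c0^-1 * H s0)%:E)%E.
  apply: ge_ereal_sup => _ [s _ <-]; rewrite lee_fin.
  exact: fenchel_arith (sub s).
move=> Hsup; apply: (@le_trans _ _ ((c0 ^+ 2 / (2 * c1) * y0 ^+ 2)%:E + c0%:E * (s0 * y0 - c0^-1 * H s0)%:E)%E).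
  by apply: leeD => //; apply: lee_wpmul2l => //; rewrite lee_fin ltW.
by rewrite -EFinM -EFinD lee_fin eta_arith ?gt_eqF// lexx.
Qed.

End InternalExponent.

(** * Asymptotics of the internal angle *)

Section InternalAsymptotics.
Variables (R : realType) (f : R -> R) (delta tau : R).
Hypothesis cf : {within `[0, 1], continuous f}.
Hypothesis mf : forall u v : R, 0 <= u -> u <= v -> v <= 1 -> f u <= f v.
Hypothesis f_ge0 : forall u : R, 0 <= u -> u <= 1 -> 0 <= f u.
Hypothesis f_gt0 : forall u : R, 0 < u -> u <= 1 -> 0 < f u.
Hypotheses (delta0 : 0 < delta) (dt : delta < tau) (tau1 : tau < 1).

Lemma wt_gt0 n (i : 'I_n) : 0 < wt f i.
Proof.
have n0 : (0 : R) < n%:R by rewrite ltr0n (leq_ltn_trans _ (ltn_ord i)).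
apply: f_gt0; first by rewrite divr_gt0// ltr0n.
by rewrite ler_pdivrMr// mul1r ler_nat.
Qed.

Lemma grid_ge0 (n i : nat) : 0 <= i%:R / n%:R :> R.
Proof. by rewrite divr_ge0. Qed.

Lemma grid_le1 (n i : nat) : (i <= n)%N -> i%:R / n%:R <= 1 :> R.
Proof.
case: n => [|n] ij; first by rewrite invr0 mulr0.
by rewrite ler_pdivrMr ?ltr0n// mul1r ler_nat.
Qed.

Lemma grid_le (n i j : nat) : (i <= j)%N -> i%:R / n%:R <= j%:R / n%:R :> R.
Proof. by move=> ij; rewrite ler_wpM2r ?invr_ge0// ler_nat. Qed.

(** As [f ^+ 2] is non-decreasing, each term is charged to the cell on the right of its node; the
    last node [a] has no such cell and its term is split off. *)
Lemma sum_sq_head_le (n p : nat) (a : R) : (0 < n)%N -> (p.+1 <= n)%N -> p.+1%:R / n%:R = a ->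
  \sum_(0 <= i < p.+1) f (i.+1%:R / n%:R) ^+ 2 <=
  n%:R * RInt 0 a (fun u => f u ^+ 2) + f a ^+ 2.
Proof.
move=> n0 pn pa; have a1 : a <= 1 by rewrite -pa grid_le1.
have ap : 0 <= a by rewrite -pa grid_ge0.
have p1 : (1 <= p.+1)%N by [].
rewrite big_nat_recr//= pa lerD2r.
have -> : \sum_(0 <= i < p) f (i.+1%:R / n%:R) ^+ 2 = \sum_(1 <= i < p.+1) f (i%:R / n%:R) ^+ 2.
  by rewrite [RHS]big_add1.
have cg : {within `[1%:R / n%:R, p.+1%:R / n%:R], continuous (fun u => f u ^+ 2)}.
  by apply: (within_sq cf); [exact: grid_ge0|exact: grid_le1].
apply: le_trans (riemann_lower n0 p1 cg _) _.
  move=> m u /andP[m1 mp] /andP[mu um].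
  have u1 : u <= 1 by rewrite (le_trans um)// grid_le1// (leq_trans mp).
  have mn := grid_ge0 n m.
  by rewrite lerXn2r ?nnegrE ?f_ge0 ?mf// ?(le_trans mu)// (le_trans mn).
rewrite pa ler_wpM2l//; apply: RInt_sub_le => //.
- by rewrite -pa grid_le.
- exact: (within_sq cf).
- by move=> u _; exact: sqr_ge0.
Qed.

(** For [s <= 0] the integrand is non-increasing, so sampling at right end points underestimates the
    integral and no boundary term appears. *)
Lemma sum_lam_le (n k l : nat) (s : R) : (0 < n)%N -> s <= 0 -> (k <= l)%N ->
  k%:R / n%:R = delta -> l%:R / n%:R = tau ->
  \sum_(k <= i < l) lam (s * f (i.+1%:R / n%:R)) <= n%:R * RInt delta tau (fun u => lam (s * f u)).
Proof.
move=> n0 s0 kl kd lt.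
have nR : (0 : R) < n%:R by rewrite ltr0n.
rewrite -kd -lt; apply: riemann_lower => //.
  rewrite kd lt.
  apply: (within_comp (within_subitv (ltW delta0) (ltW tau1) cf) (h := fun y => lam (s * y))) => y.
  by apply: continuous_comp; [exact: mulrl_continuous|exact: continuous_lam].
move=> m u /andP[km ml] /andP[mu um]; apply: le_lam; rewrite ler_wnM2l// mf//.
  by apply: le_trans mu; exact: grid_ge0.
apply: (le_trans (grid_le n ml)); rewrite lt; exact: ltW.
Qed.

Lemma int_angle_asymptotics (eps : R) : 0 < eps ->
  exists n0 : nat, forall n k l : nat, (n0 < n)%N ->
    k%:R = delta * n%:R -> l%:R = tau * n%:R ->
    ((ln (int_angle (face0 f n k) (face0 f n l)) / n%:R)%:E < psi_int f delta tau + eps%:E)%E.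
Proof.
move=> e0.
have [s s0 psi_ge] := psi_int_ge cf mf f_ge0 f_gt0 delta0 dt tau1.
have fd : 0 < f delta by rewrite f_gt0// ltW// (lt_trans dt).
have f1 : 0 < f 1 by rewrite f_gt0.
(* The boundary term of the head sum, plus the constant in [Y <= n * (f 1 ^+ 2 / f delta ^+ 2)]; the
   factor [n] there accounts for the [ln n] in [eventually_ln]. *)
pose A := s ^+ 2 / 2 * f delta ^+ 2 + ln (f 1 ^+ 2 / f delta ^+ 2).
have [n0 Hn0] := eventually_ln A e0.
exists n0 => n k l nn0 kn ln_.
have npos : (0 < n)%N by rewrite (leq_ltn_trans _ nn0).
have nR : (0 : R) < n%:R by rewrite ltr0n.
have nn : n%:R != 0 :> R by rewrite gt_eqF.
have kd : k%:R / n%:R = delta by rewrite kn mulfK.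
have lt : l%:R / n%:R = tau by rewrite ln_ mulfK.
have kl : (k < l)%N by rewrite -(ltr_nat R) kn ln_ ltr_pM2r.
have lln : (l <= n)%N by rewrite -(ler_nat R) ln_ ler_piMl// ltW.
have k0 : (0 < k)%N by rewrite -(ltr_nat R) kn mulr_gt0.
case: k kn kd kl k0 => [//|p] kn kd kl _.
case: l ln_ lt kl lln => [//|d] ln_ lt kl lln.
have pd : (p < d.+1)%N by rewrite ltnW.
have := int_angle_bound (Ordinal pd) lln (@wt_gt0 n) s.
rewrite -![nat_of_ord (Ordinal pd)]/p => /andP[b0 ble].
set E := s ^+ 2 / 2 * _ + _ in ble; set Y := (\sum_(0 <= i < _) _) / f _ ^+ 2 in ble.
have Y0 : 0 < Y.
  rewrite /Y kd divr_gt0 ?exprn_gt0// big_nat_recl//= ltr_pwDl//.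
    by rewrite exprn_gt0// f_gt0 ?grid_le1// divr_gt0.
  by apply: sumr_ge0 => i _; exact: sqr_ge0.
have lnb : ln (int_angle (face0 f n p.+1) (face0 f n d.+1)) <= E + ln Y.
  by rewrite -[E]expRK -lnM ?posrE ?expR_gt0// ler_ln ?posrE// mulr_gt0 ?expR_gt0.
have YC : ln Y <= ln n%:R + ln (f 1 ^+ 2 / f delta ^+ 2).
  have C0 : 0 < f 1 ^+ 2 / f delta ^+ 2 by rewrite divr_gt0// exprn_gt0.
  have nC0 : 0 < n%:R * (f 1 ^+ 2 / f delta ^+ 2) by rewrite mulr_gt0.
  rewrite -lnM ?posrE// ler_ln ?posrE//.
  rewrite /Y kd mulrA ler_wpM2r ?invr_ge0 ?sqr_ge0//.
  apply: (@le_trans _ _ (\sum_(0 <= i < d.+1) f 1 ^+ 2)).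
    rewrite !big_mkord; apply: ler_sum => i _.
    have i1 : i.+1%:R / n%:R <= 1 :> R by rewrite grid_le1// (leq_trans (ltn_ord i)).
    by rewrite lerXn2r ?nnegrE ?f_ge0 ?mf// grid_ge0.
  by rewrite sumr_const_nat subn0 -[_ *+ _]mulr_natl ler_wpM2r ?sqr_ge0// ler_nat.
have EC : E <= n%:R * (- ((tau - delta) * ln 2) + int_exponent f delta tau s) +
    s ^+ 2 / 2 * f delta ^+ 2.
  have H1 := sum_sq_head_le npos (leq_trans (ltnW kl) lln) kd.
  have H2 := sum_lam_le npos s0 (ltnW kl) kd lt.
  have s2 : 0 <= s ^+ 2 / 2 by rewrite divr_ge0 ?sqr_ge0.
  have {}H1 := ler_wpM2l s2 H1.
  have H3 : \sum_(p.+1 <= i < d.+1) ln 2 = n%:R * ((tau - delta) * ln 2) :> R.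
    rewrite sumr_const_nat -[_ *+ _]mulr_natl natrB ?(ltnW kl)// kn ln_.
    by rewrite -mulrBl mulrAC mulrC mulrA.
  rewrite /E sumrB H3 /int_exponent.
  move: (RInt 0 delta _) (RInt delta tau _) H1 H2 => c1 h H1 H2.
  apply: le_trans (lerD H1 (lerB H2 (lexx _))) _.
  by rewrite le_eqVlt; apply/orP; left; apply/eqP; ring.
apply: (@lt_le_trans _ _ ((- ((tau - delta) * ln 2) + int_exponent f delta tau s)%:E + eps%:E)%E);
  last by apply: leeD.
rewrite -EFinD lte_fin ltr_pdivrMr//.
have := Hn0 n nn0; rewrite /A.
move: (ln n%:R) (ln (_ / _)) (ln Y) (int_exponent _ _ _ _) lnb YC EC => x y z w H1 H2 H3 H4.
by rewrite (mulrC (_ + _)) mulrDr; lra.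
Qed.

End InternalAsymptotics.

(** * The external angle *)

#[local] Transparent RInt.

(** * The Gaussian primitive and [erf] *)

Section Erf.
Variable R : realType.
Local Notation mu := (@lebesgue_measure R).

Definition gauss0 (t : R) : R := expR (- (t ^+ 2)).
Definition gauss_prim (x : R) : R := RInt 0 x gauss0.

Let spi : 0 < Num.sqrt pi :> R. Proof. by rewrite sqrtr_gt0 pi_gt0. Qed.

Lemma gauss0_gt0 t : 0 < gauss0 t. Proof. exact: expR_gt0. Qed.
Lemma gauss0_ge0 t : 0 <= gauss0 t. Proof. exact: expR_ge0. Qed.

Lemma continuous_gauss0 : continuous gauss0.
Proof. exact: continuous_gauss_fun. Qed.

Let wc a b : {within `[a, b], continuous gauss0}.
Proof. by apply: continuous_subspaceT; exact: continuous_gauss0. Qed.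

Lemma measurable_gauss0 : measurable_fun [set: R] gauss0.
Proof. exact: measurable_gauss_fun. Qed.

Lemma gauss0_le (s t : R) : 0 <= s -> s <= t -> gauss0 t <= gauss0 s.
Proof.
by move=> s0 st; rewrite ler_expR lerN2 lerXn2r ?nnegrE// (le_trans s0).
Qed.

Lemma gauss_prim_split (a b : R) : 0 <= a -> a <= b ->
  gauss_prim b = gauss_prim a + RInt a b gauss0.
Proof. by move=> a0 ab; exact: RInt_split. Qed.

Lemma gauss_prim_step (a b : R) : 0 <= a -> a <= b ->
  0 <= gauss_prim b - gauss_prim a <= gauss0 a * (b - a).
Proof.
move=> a0 ab; rewrite (gauss_prim_split a0 ab) addrAC subrr add0r; apply/andP; split.
  by apply: Rintegral_ge0 => u _; exact: gauss0_ge0.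
rewrite -RInt_cst//; apply: le_RInt => //.
  by apply: continuous_subspaceT; exact: cst_continuous.
by move=> u /andP[au _]; exact: gauss0_le.
Qed.

(** The segment from 0 to a negative point is empty, so this primitive is 0 there rather than
    odd. *)
Lemma gauss_prim_neg (x : R) : x <= 0 -> gauss_prim x = 0.
Proof.
rewrite le_eqVlt => /orP[/eqP ->|x0]; rewrite /gauss_prim /RInt.
  by rewrite set_itv1 Rintegral_set1.
by rewrite set_itv_ge ?Rintegral_set0// bnd_simp -ltNge.
Qed.

Lemma gauss_prim_ge (a : R) : 0 <= a -> a * gauss0 a <= gauss_prim a.
Proof.
move=> a0; rewrite mulrC -[X in _ * X]subr0; apply: RInt_ge_cst => //.
by move=> u /andP[u0 ua]; exact: gauss0_le.
Qed.

Lemma gauss_prim_gt0 (a : R) : 0 < a -> 0 < gauss_prim a.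
Proof.
by move=> a0; apply: lt_le_trans (gauss_prim_ge (ltW a0)); rewrite mulr_gt0// gauss0_gt0.
Qed.

Lemma le_gauss_prim (a b : R) : a <= b -> gauss_prim a <= gauss_prim b.
Proof.
move=> ab; case: (leP a 0) => [a0|/ltW a0].
  rewrite (gauss_prim_neg a0); case: (leP b 0) => [b0|/gauss_prim_gt0/ltW//].
  by rewrite gauss_prim_neg.
by rewrite -subr_ge0; have /andP[] := gauss_prim_step a0 ab.
Qed.

Lemma gauss_prim_lip (a b : R) : a <= b -> gauss_prim b - gauss_prim a <= b - a.
Proof.
have g1 (c : R) : gauss0 c <= 1 by exact: gauss_fun_le1.
have step (c d : R) : 0 <= c -> c <= d -> gauss_prim d - gauss_prim c <= d - c.
  move=> c0 cd; have /andP[_ /le_trans] := gauss_prim_step c0 cd; apply.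
  by rewrite ler_piMl ?subr_ge0.
move=> ab; case: (leP a 0) => [a0|/ltW a0]; last exact: step.
case: (leP b 0) => [b0|/ltW b0]; first by rewrite !gauss_prim_neg ?subr_ge0// subrr subr_ge0.
have := step 0 b (lexx 0) b0; rewrite (@gauss_prim_neg 0)// (gauss_prim_neg a0) !subr0.
by move/le_trans; apply; rewrite lerDl oppr_ge0.
Qed.

Lemma continuous_gauss_prim : continuous gauss_prim.
Proof.
apply: lipschitz_continuous => M; exists 1 => s t _ _; rewrite mul1r.
wlog st : s t / s <= t.
  by move=> W; case: (leP s t) => [|/ltW] st; [exact: W|rewrite distrC (distrC s); exact: W].
rewrite distrC (distrC s) !ger0_norm ?subr_ge0 ?le_gauss_prim//.
exact: gauss_prim_lip.
Qed.

(** The density decreases on the positive half line: the increment over [[a, b]] is at most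
    [(b - a) * gauss0 a], and [a * gauss0 a <= gauss_prim a]. *)
Lemma gauss_prim_star (a b : R) : 0 < a -> a <= b -> a * gauss_prim b <= b * gauss_prim a.
Proof.
move=> a0 ab; have /andP[_ H1] := gauss_prim_step (ltW a0) ab.
have H2 := gauss_prim_ge (ltW a0).
have ba : 0 <= b - a by rewrite subr_ge0.
have {}H2 := ler_wpM2l ba H2; have {}H1 := ler_wpM2l (ltW a0) H1.
move: (gauss_prim a) (gauss_prim b) (gauss0 a) H1 H2 => x y z H1 H2; nra.
Qed.

Lemma integral_gauss_prim (r : R) :
  (\int[mu]_(t in [set: R]) (((0 <= t)%R && (t <= r)%R)%:R * gauss0 t)%:E = (gauss_prim r)%:E)%E.
Proof.
have fin : (\int[mu]_(t in `[0%R, r]) (gauss0 t)%:E)%E \is a fin_num.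
  by apply: integrable_fin_num => //; exact: RInt_integrable.
rewrite /gauss_prim /RInt /Rintegral fineK// [RHS]integral_mkcond.
apply: eq_integral => t _; rewrite patchE mem_setE in_itv /=.
by case: (_ && _); rewrite ?mul1r ?mul0r.
Qed.

Lemma gauss_prim_le (r : R) : gauss_prim r <= Num.sqrt pi / 2.
Proof.
rewrite -lee_fin -integral_gauss_prim -integral0y_gauss [X in (_ <= X)%E]integral_mkcond.
have mb : measurable_fun [set: R] (fun t : R => ((0 <= t)%R && (t <= r)%R)%:R : R).
  rewrite (_ : (fun t => _) = \1_(`[0, r])); first exact: measurable_indic.
  by apply/funext => t; rewrite indicE mem_setE in_itv /=.
apply: ge0_le_integral => //.
- by move=> t _; rewrite lee_fin mulr_ge0// gauss0_ge0.
- by apply/measurable_EFinP; apply: measurable_funM => //; exact: measurable_gauss0.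
- apply/(measurable_restrictT _ _).1 => //.
  by apply/measurable_EFinP; apply: measurable_funTS; exact: measurable_gauss_fun.
- move=> t _; rewrite patchE mem_setE in_itv /= andbT.
  case: (0 <= t)%R => /=; last by rewrite mul0r.
  rewrite lee_fin; case: (t <= r)%R; first by rewrite mul1r.
  by rewrite mul0r gauss_fun_ge0.
Qed.

Lemma erfE (x : R) : erf x = 2 / Num.sqrt pi * gauss_prim x.
Proof. by []. Qed.

Let two_spi : 0 < 2 / Num.sqrt pi :> R. Proof. by rewrite divr_gt0. Qed.

Lemma erf_gt0 (x : R) : 0 < x -> 0 < erf x.
Proof. by move=> x0; rewrite erfE mulr_gt0// gauss_prim_gt0. Qed.

Lemma erf0 : erf (0 : R) = 0.
Proof. by rewrite erfE gauss_prim_neg// mulr0. Qed.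

Lemma le_erf (x y : R) : x <= y -> erf x <= erf y.
Proof. by move=> xy; rewrite !erfE ler_pM2l// le_gauss_prim. Qed.

Lemma erf_le1 (x : R) : erf x <= 1.
Proof.
rewrite erfE; have := gauss_prim_le x; rewrite -(ler_pM2l two_spi) => /le_trans; apply.
by rewrite mulrA divfK ?mulfV// gt_eqF.
Qed.

(* Star-shapedness of the concave function [erf] at the origin. *)
Lemma erf_star (a b : R) : 0 < a -> a <= b -> a * erf b <= b * erf a.
Proof.
move=> a0 ab; rewrite !erfE (mulrCA a) (mulrCA b) ler_pM2l//; exact: gauss_prim_star.
Qed.

Lemma continuous_erf : continuous (@erf R).
Proof.
move=> x; apply: (@continuous_comp _ _ _ gauss_prim (fun y => 2 / Num.sqrt pi * y)).
  exact: continuous_gauss_prim.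
exact: mulrl_continuous.
Qed.

(** [[- r, r]] is covered by [[0, r]] and its mirror image; an upper bound suffices, so their
    overlap at 0 needs no treatment. *)
Lemma integral_abs_le (r : R) : 0 <= r ->
  exists2 c, 0 <= c <= Num.sqrt pi * erf r &
  (\int[mu]_(t in [set: R]) ((`|t| <= r)%R%:R * gauss0 t)%:E = c%:E)%E.
Proof.
move=> r0.
have mb : measurable_fun [set: R] (fun t : R => (`|t| <= r)%R%:R : R).
  rewrite (_ : (fun t => _) = \1_(`[- r, r])); first exact: measurable_indic.
  by apply/funext => t; rewrite indicE mem_setE in_itv /= ler_norml.
have mb' : measurable_fun [set: R] (fun t : R => ((0 <= t)%R && (t <= r)%R)%:R : R).
  rewrite (_ : (fun t => _) = \1_(`[0, r])); first exact: measurable_indic.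
  by apply/funext => t; rewrite indicE mem_setE in_itv /=.
have [c /andP[c0 _] cE] := integral_restrict_fin mb measurable_gauss0 gauss0_ge0 integralT_gauss.
exists c => //; rewrite c0 /= -lee_fin -cE.
have -> : Num.sqrt pi * erf r = gauss_prim r + gauss_prim r.
  by rewrite erfE; field; rewrite gt_eqF.
pose h (t : R) := (((0 <= t)%R && (t <= r)%R)%:R * gauss0 t)%:E.
have mh : measurable_fun [set: R] h.
  by apply/measurable_EFinP; apply: measurable_funM => //; exact: measurable_gauss0.
have h0 t : (0 <= h t)%E by rewrite lee_fin mulr_ge0// gauss0_ge0.
have mh' : measurable_fun [set: R] (fun t => h (- t)).
  exact: (measurableT_comp mh).
rewrite EFinD -[X in (_ <= X + _)%E]integral_gauss_prim -integral_gauss_prim -/h.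
rewrite -[X in (_ <= X + _)%E](integral_opp mh h0) -ge0_integralD//; last first.
  by move=> t _; exact: h0.
apply: ge0_le_integral => //.
- by move=> t _; rewrite lee_fin mulr_ge0// gauss0_ge0.
- by apply/measurable_EFinP; apply: measurable_funM => //; exact: measurable_gauss0.
- exact: emeasurable_funD.
- move=> t _; have gN : gauss0 (- t) = gauss0 t by rewrite /gauss0 sqrrN.
  have [tr|_] := boolP (`|t| <= r)%R; last by rewrite mul0r; apply: adde_ge0; exact: h0.
  rewrite mul1r; case: (leP 0 t) => t0.
    rewrite -[X in (X <= _)%E]add0e; apply: leeD; first exact: h0.
    have {}tr : t <= r by rewrite -(ger0_norm t0).
    by rewrite /h ?t0 /= tr mul1r.
  rewrite -[X in (X <= _)%E]adde0; apply: leeD; last by rewrite /= mul0r.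
  have {}tr : - t <= r by rewrite -(ltr0_norm t0).
  by rewrite /h oppr_ge0 (ltW t0) /= tr mul1r gN.
Qed.

End Erf.

#[local] Opaque erf.

(** * Bound for the external angle from a Gaussian majorant *)

Section ExternalBound.
Variables (R : realType) (f : R -> R) (l' N : nat).
Local Notation mu := (@lebesgue_measure R).
Local Notation l := l'.+1.
Local Notation n := (l + N)%N.
Hypothesis w0 : forall i : 'I_n, 0 < wt f i.
Local Notation S := (head_sq f l' N).
Let W (j : nat) : R := f ((l + j).+1%:R / n%:R).

Let W0 j : (j < N)%N -> 0 < W j.
Proof. by move=> jN; exact: (w0 (rshift l (Ordinal jN))). Qed.

Lemma head_sq_gt0 : 0 < S.
Proof.
rewrite /head_sq big_ord_recl ltr_pwDl ?exprn_gt0//.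
by apply: sumr_ge0 => i _; exact: sqr_ge0.
Qed.

Let S0 := head_sq_gt0.

Let g (x : env R) : R := (0 <= x N)%R%:R *
  (\prod_(0 <= j < N) (`|x j| <= x N * W j)%R%:R) *
  expR (- (S * x N ^+ 2 + \sum_(0 <= j < N) x j ^+ 2)).

Let g_ge0 x : 0 <= g x.
Proof. by rewrite !mulr_ge0 ?expR_ge0// prodr_ge0. Qed.

Let mset (b : env R -> bool) : measurable [set x : env R | b x] ->
  measurable_fun [set: env R] (fun x : env R => (b x)%:R : R).
Proof.
move=> mb; apply: (eq_measurable_fun (\1_[set x | b x] : env R -> R)); last exact: measurable_indic.
by move=> x _; rewrite indicE; congr (nat_of_bool _)%:R; apply/idP/idP; rewrite inE.
Qed.

Let mcoord j : measurable_fun [set: env R] (fun x : env R => x j).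
Proof. exact: measurable_coord. Qed.

Let mg : measurable_fun [set: env R] (fun x : env R => (g x)%:E).
Proof.
apply/measurable_EFinP; apply: measurable_funM; first apply: measurable_funM.
- by apply: mset; exact: measurable_ge0_set.
- have mprod k : measurable_fun [set: env R] (fun x : env R =>
      \prod_(0 <= j < k) (`|x j| <= x N * W j)%R%:R : R).
    elim: k => [|k IH].
      by apply: (eq_measurable_fun (fun _ : env R => 1 : R)) => // x _; rewrite big_geq.
    apply: (eq_measurable_fun (fun x : env R =>
        (\prod_(0 <= j < k) (`|x j| <= x N * W j)%R%:R) * (`|x k| <= x N * W k)%R%:R : R)).
      by move=> x _; rewrite big_nat_recr.
    apply: measurable_funM; [exact: IH|apply: mset].
    rewrite (_ : [set x | _] = [set x | 0 <= x N * W k - `|x k|]); last first.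
      by apply/seteqP; split => x /=; rewrite subr_ge0.
    apply: measurable_ge0_set; apply: measurable_funB; first exact: measurable_funM.
    exact: measurableT_comp.
  exact: mprod.
- apply: measurableT_comp => //; apply: measurableT_comp => //.
  apply: measurable_funD; first by apply: measurable_funM => //; exact: measurable_funX.
  by apply: measurable_sum => j; exact: measurable_funX.
Qed.

(** With the multiplier frozen at [t >= 0] the slice of the cone is a box, so the inner integral
    factors; for [t < 0] the slice is empty. *)
Lemma ext_inner_le (t : R) (x : env R) : x N = t ->
  (iter_int N (fun x => (g x)%:E) x <=
   ((0 <= t)%R%:R * (Num.sqrt pi ^+ N * (expR (- (S * t ^+ 2)) * \prod_(0 <= j < N) erf (t * W j))))%:E)%E.
Proof.
move=> xN.
have mb r : measurable_fun [set: R] (fun u : R => (`|u| <= r)%R%:R : R).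
  rewrite (_ : (fun u => _) = \1_(`[- r, r])); first exact: measurable_indic.
  by apply/funext => u; rewrite indicE mem_setE in_itv /= ler_norml.
have [t0|t0] := boolP (0 <= t)%R; last first.
  rewrite mul0r (@eq_iter_int_tail _ _ _ (fun=> 0%E)).
    rewrite (_ : iter_int _ _ _ = 0%E)//.
    by elim: N x {xN} => //= m IH x; rewrite integral0_eq// => u _; exact: IH.
  by move=> y yx; rewrite /g yx// xN (negbTE t0) !mul0r.
(* Constants are required for [j < N] only; beyond, the sign of [W j] is not known and 0 is a
   default. *)
have cex (j : nat) : exists c : R, (j < N)%N -> 0 <= c <= Num.sqrt pi * erf (t * W j) /\
    (\int[mu]_(u in [set: R]) ((`|u| <= t * W j)%R%:R * gauss0 u)%:E = c%:E)%E.
  case: (ltnP j N) => jN; last by exists 0.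
  have tW : 0 <= t * W j by rewrite mulr_ge0// ltW// W0.
  by have [c c0 cE] := integral_abs_le tW; exists c.
have [c cP] := choice cex.
pose phi (j : nat) (u : R) := (`|u| <= t * W j)%R%:R * gauss0 u.
have phi0 j u : 0 <= phi j u by rewrite mulr_ge0// gauss0_ge0.
have mphi j : measurable_fun [set: R] (phi j).
  by apply: measurable_funM => //; exact: measurable_gauss0.
rewrite (@eq_iter_int_tail _ _ _
  (fun y => (expR (- (S * t ^+ 2)))%:E * (\prod_(0 <= j < N) phi j (y j))%:E)%E); last first.
  move=> y yx; rewrite -EFinM; congr EFin.
  rewrite /g yx// xN t0 mul1r big_split /= opprD expRD mulrCA mulrA mulrAC.
  rewrite mulrC mulrCA; congr (_ * _); congr (_ * _).
  by rewrite /gauss0 -expR_sum sumrN.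
rewrite iter_intZl; [|by apply/measurable_EFinP; exact: measurable_prod_coord|
  by move=> y; rewrite lee_fin prodr_ge0| by rewrite lee_fin expR_ge0].
rewrite (@iter_int_prod R phi c N N x phi0 mphi _ (leqnn N)); last first.
  by move=> j jN; have [_] := cP j jN.
rewrite (@big_geq _ _ _ N N)// mulr1 -EFinM lee_fin.
rewrite -[true%:R]/(1 : R) [X in _ <= X]mul1r [X in _ <= X]mulrCA.

apply: ler_wpM2l; first exact: expR_ge0.
have -> : Num.sqrt pi ^+ N * \prod_(0 <= j < N) erf (t * W j) =
    \prod_(0 <= j < N) (Num.sqrt pi * erf (t * W j)).
  by rewrite [RHS]big_split /= prodr_const_nat subn0.
rewrite !big_mkord; apply: ler_prod => j _.
by have [] := cP j (ltn_ord j).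
Qed.

Lemma sqrt_ratio_arith (a b c P K r : R) : 0 < a -> 0 < b -> 0 < c -> 0 < P -> 0 < r ->
  r <= K * (P * Num.sqrt (a / c)) ->
  0 < r / (P * Num.sqrt (a / b)) <= K * Num.sqrt (b / c).
Proof.
move=> a0 b0 c0 P0 r0 rle.
have ab : 0 < Num.sqrt (a / b) by rewrite sqrtr_gt0 divr_gt0.
have PD : 0 < P * Num.sqrt (a / b) by rewrite mulr_gt0.
rewrite divr_gt0//= ler_pdivrMr//; apply: (le_trans rle).
have -> : a / c = a / b * (b / c) by field; rewrite !gt_eqF.
rewrite sqrtrM; last by rewrite divr_ge0 ?ltW.
by rewrite le_eqVlt; apply/orP; left; apply/eqP; ring.
Qed.

(** The integral over the multiplier is bounded by a full Gaussian integral; [sqrt (S / c)] is the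
    quotient of [sqrt (pi / c)] by the constant [sqrt (pi / S)] of the denominator. *)
Lemma ext_angle_bound (K c : R) : 0 < c -> 0 <= K ->
  (forall t, 0 <= t -> expR (- (S * t ^+ 2)) * \prod_(0 <= j < N) erf (t * W j) <=
     K * expR (- (c * t ^+ 2))) ->
  0 < ext_angle (face0 f n l) (wl1_ball f n) <= K * Num.sqrt (S / c).
Proof.
move=> c0 K0 HK.
rewrite (ext_angleE w0).
set I := iter_int _ _ _; set D := iter_int _ _ _.
have IE : I = iter_int N.+1 (fun x => (g x)%:E) (fun=> 0).
  by apply: eq_iter_int => x; rewrite /g /ext_density !big_mkord.
have spi : 0 < Num.sqrt pi :> R by rewrite sqrtr_gt0 pi_gt0.
have DE : D = (Num.sqrt pi ^+ N * Num.sqrt (pi / S))%:E.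
  pose a (j : nat) := if j == N then S else 1.
  have a0 j : 0 < a j by rewrite /a; case: ifP.
  pose phi (j : nat) (u : R) := expR (- (a j * (u - 0) ^+ 2)).
  pose k (j : nat) := Num.sqrt (pi / a j).
  have -> : D = iter_int N.+1 (fun x => (\prod_(0 <= j < N.+1) phi j (x j))%:E) (fun=> 0).
    apply: eq_iter_int => x; congr EFin.
    rewrite /ext_density -expR_sum sumrN big_nat_recr//= /a eqxx subr0.
    rewrite [in RHS]addrC; congr (expR (- (_ + _))).
    rewrite big_mkord; apply: eq_bigr => j _.
    by rewrite (ltn_eqF (ltn_ord j)) mul1r subr0.
  rewrite (@iter_int_prod R phi k N.+1 N.+1)//.
  - rewrite (@big_geq _ _ _ N.+1 N.+1)// mulr1 big_nat_recr//= {2}/k /a eqxx; congr ((_ * _)%:E).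
    rewrite (@eq_big_nat _ _ _ 0 N _ (fun=> Num.sqrt pi)) ?prodr_const_nat ?subn0//.
    by move=> j /andP[_ jN]; rewrite /k /a (ltn_eqF jN) divr1.
  - by move=> j u; exact: expR_ge0.
  - by move=> j; exact: measurable_quad.
  - by move=> j _; exact: integral_gauss_affine.
have I0 : (0 < I)%E.
  (* With [w] below all tail weights, every constraint holds on the box [1 <= x N <= 2],
     [0 <= x j <= w], which makes the integral positive. *)
  have [w wpos wle] : exists2 w, 0 < w & forall j, (j < N)%N -> w <= W j.
    elim: N W0 => [|m IH] W0'; first by exists 1.
    have [j jm|w wpos wle] := IH; first by apply: W0'; exact: ltnW.
    exists (Num.min w (W m)); first by rewrite lt_min wpos W0'.
    by move=> j; rewrite ltnS leq_eqVlt => /orP[/eqP ->|/wle]; rewrite ge_min ?lexx ?orbT// => ->.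
  rewrite IE; apply: (iter_int_gt0 mg (lo := fun j => (j == N)%:R) (hi := fun j => if j == N then 2 else w)).
  - by move=> y; rewrite lee_fin.
  - by move=> j _; case: eqP => _ //; rewrite ltr1n.
  - move=> y ybox _; rewrite lte_fin /g.
    have /andP[y1 _] := ybox N (ltnSn N); rewrite eqxx in y1.
    have y0 : 0 <= y N := le_trans ler01 y1.
    rewrite y0 mul1r big_nat big1 ?mul1r ?expR_gt0// => j /andP[_ jN].
    have := ybox j (ltnW jN); rewrite (ltn_eqF jN) => /andP[yj0 yjw].
    have -> : (`|y j| <= y N * W j)%R by
      rewrite ger0_norm// (le_trans yjw)// (le_trans (wle j jN))// ler_peMl// ltW// W0.
    by [].
have Ile : (I <= (K * (Num.sqrt pi ^+ N * Num.sqrt (pi / c)))%:E)%E.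
  rewrite IE /= mulrA EFinM -(integral_gauss_affine 0 c0) -ge0_integralZl_EFin//; last 2 first.
  - by apply/measurable_EFinP; exact: measurable_quad.
  - by rewrite mulr_ge0// exprn_ge0// ltW.
  apply: ge0_le_integral => //.
  - by move=> t _; apply: iter_int_ge0 => y; rewrite lee_fin.
  - apply: (measurableT_comp (measurable_iter_int_env N mg _)).
      by move=> y; rewrite lee_fin.
    apply: measurable_env => i.
    by case: (i == N).
  - by apply/measurable_EFinP; apply: measurable_funM => //; exact: measurable_quad.
  - move=> t _; apply: le_trans (ext_inner_le (t := t) _) _; first by rewrite eqxx.
    rewrite -EFinM lee_fin subr0.
    have [t0|t0] := boolP (0 <= t)%R; last first.
      by rewrite mul0r mulr_ge0 ?expR_ge0// mulr_ge0// exprn_ge0// ltW.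
    have P0 : 0 <= Num.sqrt pi ^+ N :> R by rewrite exprn_ge0// ltW.
    have {}HK := ler_wpM2l P0 (HK t t0).
    rewrite -[true%:R]/(1 : R) [X in X <= _]mul1r; apply: (le_trans HK).
    by rewrite mulrA [_ * K]mulrC.
have [r IrE] : exists r, I = r%:E.
  by exists (fine I); rewrite fineK// ge0_fin_numE ?(ltW I0)//; apply: le_lt_trans Ile _; rewrite ltry.
rewrite DE IrE /=; apply: sqrt_ratio_arith => //.
- by rewrite pi_gt0.
- by rewrite exprn_gt0.
- by rewrite -lte_fin -IrE.
- by rewrite -lee_fin -IrE.
Qed.

End ExternalBound.

#[local] Opaque erf RInt lam.

Lemma RIntN (R : realType) (a b : R) (g : R -> R) : {within `[a, b], continuous g} ->
  RInt a b (fun u => - g u) = - RInt a b g.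
Proof.
move=> cg; have := RInt_comb (-1) 0 cg cg; rewrite mul0r addr0 mulN1r => <-.
by congr (RInt a b _); apply/funext => u; rewrite mul0r addr0 mulN1r.
Qed.

Lemma withinN (R : realType) (a b : R) (g : R -> R) : {within `[a, b], continuous g} ->
  {within `[a, b], continuous (fun u => - g u)}.
Proof. by move=> cg; apply: (within_comp cg (h := fun y => - y)); exact: oppr_continuous. Qed.

Lemma riemann_upper (R : realType) (n i j : nat) (c : nat -> R) (g : R -> R) :
  (0 < n)%N -> (i <= j)%N ->
  {within `[i%:R / n%:R, j%:R / n%:R], continuous g} ->
  (forall m u, (i <= m < j)%N -> m%:R / n%:R <= u <= m.+1%:R / n%:R -> g u <= c m) ->
  n%:R * RInt (i%:R / n%:R) (j%:R / n%:R) g <= \sum_(i <= m < j) c m.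
Proof.
move=> n0 ij cg H.
have := @riemann_lower R n i j (fun m => - c m) (fun u => - g u) n0 ij (withinN cg).
rewrite sumrN RIntN// mulrN lerN2; apply.
by move=> m u mij mu; rewrite lerN2; exact: H.
Qed.

(** * Asymptotics of the external angle *)

Section ExternalAsymptotics.
Variables (R : realType) (f : R -> R) (tau : R).
Hypothesis cf : {within `[0, 1], continuous f}.
Hypothesis mf : forall u v : R, 0 <= u -> u <= v -> v <= 1 -> f u <= f v.
Hypothesis f_ge0 : forall u : R, 0 <= u -> u <= 1 -> 0 <= f u.
Hypothesis f_gt0 : forall u : R, 0 < u -> u <= 1 -> 0 < f u.
Hypotheses (tau0 : 0 < tau) (tau1 : tau < 1).

Let c2 := RInt 0 tau (fun u => f u ^+ 2).
Let G (x u : R) : R := ln (erf (x * f u)).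
Let zeta (x : R) := c2 * x ^+ 2 - RInt tau 1 (G x).

Let f1_gt0 : 0 < f 1. Proof. by rewrite f_gt0. Qed.
Let ftau_gt0 : 0 < f tau. Proof. by rewrite f_gt0// ltW. Qed.

Lemma c2_gt0 : 0 < c2.
Proof.
(* [c1_gt0] is reused with [tau] in the place of [delta]; any point between [tau] and 1 can take the
   place of [tau]. *)
have [a [ta a1]] : exists a, tau < a /\ a < 1.
  by exists ((tau + 1) / 2); rewrite midf_lt// midf_lt.
exact: (c1_gt0 cf mf f_ge0 f_gt0 tau0 ta a1).
Qed.

Let G_le0 x u : G x u <= 0. Proof. by apply: ln_le0; exact: erf_le1. Qed.

Let cG x : 0 < x -> {within `[tau, 1], continuous (G x)}.
Proof.
move=> x0; apply: (@within_continuous_comp _ _ _ _ f (fun y => ln (erf (x * y)))); last first.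
  exact: within_subitv (ltW tau0) (lexx 1) cf.
move=> y; rewrite inE => -[u /=]; rewrite in_itv /= => /andP[tu u1] <-.
have fu : 0 < x * f u by rewrite mulr_gt0// f_gt0// (lt_le_trans tau0).
apply: (@continuous_comp _ _ _ (fun y => erf (x * y)) (@ln R)).
  by apply: continuous_comp; [exact: mulrl_continuous|exact: continuous_erf].
by apply: continuous_ln; exact: erf_gt0.
Qed.

Let le_G x u v : 0 < x -> 0 < u -> u <= v -> v <= 1 -> G x u <= G x v.
Proof.
move=> x0 u0 uv v1; have v0 := lt_le_trans u0 uv.
rewrite /G ler_ln ?posrE ?erf_gt0 ?mulr_gt0 ?f_gt0 ?(le_trans uv)//.
by rewrite le_erf// ler_wpM2l ?(ltW x0)// mf// ltW.
Qed.

Lemma zeta_ge x : 0 < x -> c2 * x ^+ 2 <= zeta x.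
Proof.
move=> x0; rewrite /zeta lerDl oppr_ge0.
have c0 : {within `[tau, 1], continuous (fun _ : R => 0 : R)}.
  by apply: continuous_subspaceT; exact: cst_continuous.
apply: le_trans (le_RInt (cG x0) c0 (fun u _ => G_le0 x u)) _.
by rewrite RInt_cst ?(ltW tau1)// mul0r.
Qed.

(** [zeta] is nonnegative because [erf <= 1], and [zeta 1] bounds the infimum from above, so it is a
    real number. *)
Lemma psi_ext_fin : exists m : R, psi_ext f tau = (- m)%:E /\ forall x, 0 < x -> m <= zeta x.
Proof.
pose E := [set (zeta z)%:E | z in [set z0 : R | (0 < z0)%R]].
have Ele x : 0 < x -> (ereal_inf E <= (zeta x)%:E)%E.
  by move=> x0; apply: ereal_inf_lbound; exists x.
have E0 : (0%:E <= ereal_inf E)%E.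
  apply: le_ereal_inf_tmp => _ [x /= x0 <-]; rewrite lee_fin.
  by apply: le_trans (zeta_ge x0); apply: mulr_ge0; [exact: ltW c2_gt0|exact: sqr_ge0].
have [m mE] : exists m, ereal_inf E = m%:E.
  exists (fine (ereal_inf E)); rewrite fineK// ge0_fin_numE//.
  by apply: le_lt_trans (Ele 1 ltr01) _; exact: ltry.
exists m; split; first by rewrite EFinN -mE.
by move=> x x0; rewrite -lee_fin -mE; exact: Ele.
Qed.

(** Right end points of a non-decreasing function overestimate the integral, and here that is the
    favourable direction. *)
Lemma head_sq_ge (l' N : nat) : l'.+1%:R / (l'.+1 + N)%:R = tau ->
  (l'.+1 + N)%:R * c2 <= head_sq f l' N.
Proof.
move=> lt; set n := (l'.+1 + N)%N in lt *.
have n0 : (0 < n)%N by [].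
rewrite /c2 -lt -[X in RInt X](mul0r (n%:R^-1)).
have -> : head_sq f l' N = \sum_(0 <= i < l'.+1) f (i.+1%:R / n%:R) ^+ 2.
  by rewrite big_mkord.
have cg : {within `[0%:R / n%:R, l'.+1%:R / n%:R], continuous (fun u => f u ^+ 2)}.
  by apply: (within_sq cf); [exact: grid_ge0|rewrite lt ltW].
apply: (riemann_upper n0 (leq0n _) cg) => m u /andP[_ ml] /andP[mu um].
have m1 : m.+1%:R / n%:R <= 1 :> R by rewrite grid_le1// (leq_trans ml) ?leq_addr.
have u0 : 0 <= u := le_trans (grid_ge0 R n m) mu.
by rewrite lerXn2r ?nnegrE ?f_ge0 ?mf ?grid_ge0// (le_trans um).
Qed.

Lemma head_sq_le (l' N : nat) : head_sq f l' N <= (l'.+1 + N)%:R * f 1 ^+ 2.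
Proof.
apply: (@le_trans _ _ (\sum_(i < l'.+1) f 1 ^+ 2)).
  apply: ler_sum => i _; rewrite /wt.
  have i1 : (lshift N i).+1%:R / (l'.+1 + N)%:R <= 1 :> R by rewrite grid_le1.
  by rewrite lerXn2r ?nnegrE ?f_ge0 ?mf// grid_ge0.
by rewrite sumr_const card_ord -[_ *+ _]mulr_natl ler_wpM2r ?sqr_ge0// ler_nat leq_addr.
Qed.

(* Passing from the nodes [(i + 1) / n] to [i / n] costs the telescoping boundary term. *)
Lemma sum_ln_erf_le (l' N : nat) x : l'.+1%:R / (l'.+1 + N)%:R = tau -> 0 < x ->
  \sum_(0 <= j < N) G x ((l'.+1 + j).+1%:R / (l'.+1 + N)%:R) <=
  (l'.+1 + N)%:R * RInt tau 1 (G x) + (G x 1 - G x tau).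
Proof.
move=> lt x0; set n := (l'.+1 + N)%N in lt *.
have n0 : (0 < n)%N by [].
have ln' : (l'.+1 <= n)%N by exact: leq_addr.
have nn : n%:R / n%:R = 1 :> R by rewrite mulfV// pnatr_eq0 -lt0n.
have -> : \sum_(0 <= j < N) G x ((l'.+1 + j).+1%:R / n%:R) =
    \sum_(l'.+1 <= i < n) G x (i.+1%:R / n%:R).
  rewrite -[in RHS](add0n l'.+1) big_addn {2}/n addKn.
  by apply: eq_bigr => j _; rewrite [(j + _)%N]addnC.
have -> : \sum_(l'.+1 <= i < n) G x (i.+1%:R / n%:R) =
    \sum_(l'.+1 <= i < n) G x (i%:R / n%:R) + (G x 1 - G x tau).
  have := telescope_sumr (fun i => G x (i%:R / n%:R)) ln'; rewrite lt nn => <-.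
  rewrite -big_split /=.
  by apply: eq_bigr => i _; rewrite [RHS]addrC subrK.
rewrite lerD2r.
have := @riemann_lower R n l'.+1 n (fun i => G x (i%:R / n%:R)) (G x) n0 ln'.
rewrite lt nn; apply; first exact: cG.
move=> m u /andP[lm mn] /andP[mu um]; apply: le_G => //.
  by rewrite divr_gt0 ?ltr0n// (leq_trans _ lm).
by rewrite (le_trans um)// grid_le1.
Qed.

(** Star-shapedness bounds the boundary term uniformly in [x], even near 0 where both values of
    [G x] tend to [-oo]. *)
Lemma exp_G_ratio x : 0 < x -> expR (G x 1 - G x tau) <= f 1 / f tau.
Proof.
move=> x0; have xt : 0 < x * f tau by rewrite mulr_gt0.
have x1 : 0 < x * f 1 by rewrite mulr_gt0.
have et := erf_gt0 xt; have e1 := erf_gt0 x1.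
rewrite expRB /G !lnK ?posrE// ler_pdivrMr// mulrAC ler_pdivlMr//.
have tle : x * f tau <= x * f 1 by rewrite ler_pM2l// mf// ltW.
have := erf_star xt tle; move: (erf _) (erf _) => a b.
by rewrite -!mulrA ler_pM2l// mulrC.
Qed.

(* One of the [n] factors [exp(- zeta t)] is kept, as [exp(- c2 t^2)], to make the
   integral over [t] converge; the others are bounded through the infimum [m]. *)
Lemma ext_kernel_le (l' N : nat) (m t : R) : (0 < N)%N ->
  l'.+1%:R / (l'.+1 + N)%:R = tau -> (forall x, 0 < x -> m <= zeta x) -> 0 <= t ->
  expR (- (head_sq f l' N * t ^+ 2)) *
    \prod_(0 <= j < N) erf (t * f ((l'.+1 + j).+1%:R / (l'.+1 + N)%:R)) <=
  (f 1 / f tau * expR (- (((l'.+1 + N)%:R - 1) * m))) * expR (- (c2 * t ^+ 2)).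
Proof.
move=> N0 lt mle; have c20 := c2_gt0.
have K0 : 0 <= f 1 / f tau by rewrite divr_ge0// ltW.
rewrite le_eqVlt => /orP[/eqP <-|t0].
  (* At [t = 0] the product contains a factor [erf 0 = 0], since the tail is nonempty. *)
  rewrite big_ltn// mul0r erf0 mul0r mulr0.
  by apply: mulr_ge0; [apply: mulr_ge0 => //; exact: expR_ge0|exact: expR_ge0].
set n := (l'.+1 + N)%N in lt *.
have n1 : (1 : R) <= n%:R by rewrite ler1n.
have fW j : (j < N)%N -> 0 < erf (t * f ((l'.+1 + j).+1%:R / n%:R)).
  move=> jN; apply: erf_gt0; apply: mulr_gt0 => //; apply: f_gt0.
    by rewrite divr_gt0 ?ltr0n.
  by rewrite grid_le1// /n -addnS leq_add2l.
have -> : \prod_(0 <= j < N) erf (t * f ((l'.+1 + j).+1%:R / n%:R)) =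
    expR (\sum_(0 <= j < N) G t ((l'.+1 + j).+1%:R / n%:R)).
  rewrite !big_mkord expR_sum; apply: eq_bigr => j _.
  by rewrite /G lnK// posrE fW.
rewrite -expRD -[X in _ <= X]mulrA -expRD.
apply: (@le_trans _ _ (expR ((G t 1 - G t tau) + (- ((n%:R - 1) * m) + - (c2 * t ^+ 2))))); last first.
  by rewrite expRD; apply: ler_wpM2r; [exact: expR_ge0|exact: exp_G_ratio].
rewrite ler_expR.
have H1 := sum_ln_erf_le lt t0; have H2 := head_sq_ge lt.
have H3 := mle t t0; have H4 := zeta_ge t0.
have t2 : 0 <= t ^+ 2 by exact: sqr_ge0.
have {}H2 := ler_wpM2r t2 H2.
have {}H3 : (n%:R - 1) * m <= (n%:R - 1) * zeta t by rewrite ler_wpM2l// subr_ge0.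
apply: (@le_trans _ _ (- (n%:R * c2 * t ^+ 2) + (n%:R * RInt tau 1 (G t) + (G t 1 - G t tau)))).
  by apply: lerD => //; rewrite lerN2.
have zE : zeta t = c2 * t ^+ 2 - RInt tau 1 (G t) by [].
have EE : - (n%:R * c2 * t ^+ 2) + (n%:R * RInt tau 1 (G t) + (G t 1 - G t tau)) =
    (G t 1 - G t tau) + (- ((n%:R - 1) * zeta t) - zeta t).
  by rewrite zE; move: (RInt _ _ _) (G t 1 - _) => a b; ring.
rewrite EE; move: (zeta t) (G t 1 - _) H3 H4 => z b H3 H4.
by apply: lerD => //; apply: lerD; rewrite lerN2.
Qed.

Lemma ext_angle_asymptotics (eps : R) : 0 < eps ->
  exists n1 : nat, forall n l : nat, (n1 < n)%N -> l%:R = tau * n%:R ->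
    ((ln (ext_angle (face0 f n l) (wl1_ball f n)) / n%:R)%:E < psi_ext f tau + eps%:E)%E.
Proof.
move=> e0.
have [m [-> mle]] := psi_ext_fin; have c20 := c2_gt0.
(* The summand [m] pays for the factor set aside in [ext_kernel_le]: the exponent there is
   [- (n - 1) * m], not [- n * m]. *)
pose A := ln (f 1 / f tau) + m + ln (f 1 ^+ 2 / c2).
have [n1 Hn1] := eventually_ln A e0.
exists n1 => n l nn1 ln_.
have npos : (0 < n)%N by rewrite (leq_ltn_trans _ nn1).
have nR : (0 : R) < n%:R by rewrite ltr0n.
have lt : l%:R / n%:R = tau by rewrite ln_ mulfK// gt_eqF.
have lln : (l < n)%N by rewrite -(ltr_nat R) ln_ gtr_pMl.
have l0 : (0 < l)%N by rewrite -(ltr_nat R) ln_ mulr_gt0.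
case: l ln_ lt lln l0 => [//|l'] ln_ lt lln _.
have [N N0 nE] : exists2 N, (0 < N)%N & n = (l'.+1 + N)%N.
  by exists (n - l'.+1)%N; [rewrite subn_gt0|rewrite subnKC// ltnW].
move: nn1 ln_ lt npos nR; rewrite {}nE {n lln} => nn1 ln_ lt npos nR.
set n := (l'.+1 + N)%N in nn1 ln_ lt npos nR *.
pose K := f 1 / f tau * expR (- ((n%:R - 1) * m)).
have fr0 : 0 < f 1 / f tau by rewrite divr_gt0.
have K0 : 0 < K by rewrite mulr_gt0// expR_gt0.
have w0 (i : 'I_(l'.+1 + N)) : 0 < wt f i by exact: wt_gt0.
have /andP[g0 gle] := ext_angle_bound w0 c20 (ltW K0) (fun t => ext_kernel_le N0 lt mle (t := t)).
set S := head_sq f l' N in gle.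
have C0 : 0 < f 1 ^+ 2 / c2 by rewrite divr_gt0// exprn_gt0.
have Sc1 : 1 <= S / c2.
  rewrite ler_pdivlMr// mul1r; apply: le_trans (head_sq_ge lt).
  by rewrite ler_peMl ?(ltW c20)// ler1n.
have Sc : Num.sqrt (S / c2) <= n%:R * (f 1 ^+ 2 / c2).
  (* As [S / c2 >= 1], its square root may be replaced by the quotient itself, which is at most
     linear in [n]. *)
  apply: (@le_trans _ _ (S / c2)).
    have s0 : 0 <= S / c2 := le_trans ler01 Sc1.
    have s1 : 1 <= Num.sqrt (S / c2) by rewrite -[X in X <= _]sqrtr1 ler_wsqrtr.
    rewrite -[X in _ <= X](sqr_sqrtr s0) expr2.
    by rewrite ler_peMl// sqrtr_ge0.
  rewrite mulrA ler_wpM2r ?invr_ge0 ?(ltW c20)//; exact: head_sq_le.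
set g := ext_angle _ _ in g0 gle *.
have lnb : ln g <= ln (f 1 / f tau) - (n%:R - 1) * m + (ln n%:R + ln (f 1 ^+ 2 / c2)).
  have nC0 : 0 < n%:R * (f 1 ^+ 2 / c2) by rewrite mulr_gt0.
  have -> : ln (f 1 / f tau) - (n%:R - 1) * m + (ln n%:R + ln (f 1 ^+ 2 / c2)) =
      ln (K * (n%:R * (f 1 ^+ 2 / c2))).
    rewrite [RHS]lnM ?posrE// [X in _ = _ + X]lnM ?posrE// /K.
    by rewrite [X in _ = X + _]lnM ?posrE ?expR_gt0// expRK.
  rewrite ler_ln ?posrE//; last by rewrite mulr_gt0.
  by apply: le_trans gle _; rewrite ler_wpM2l// ltW.
apply: (@lt_le_trans _ _ ((- m)%:E + eps%:E)%E) => //.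
rewrite -EFinD lte_fin ltr_pdivrMr//.
have := Hn1 n nn1; rewrite /A; move: lnb.
move: (ln _) (ln _) (ln _) (ln _) => x y z w H1 H2.
rewrite mulrC; nra.
Qed.

End ExternalAsymptotics.

Unset Implicit Arguments.

Theorem theorem2 (R : realType) (f : R -> R) (delta tau : R) :
  {within `[0, 1], continuous f} ->
  (forall u v : R, 0 <= u -> u <= v -> v <= 1 -> f u <= f v) ->
  (forall u : R, 0 <= u -> u <= 1 -> 0 <= f u) ->
  (forall u : R, 0 < u -> u <= 1 -> 0 < f u) ->
  0 < delta -> delta < tau -> tau < 1 ->
  forall eps : R, 0 < eps ->
    (exists n0 : nat, forall n k l : nat, (n0 < n)%N ->
       k%:R = delta * n%:R -> l%:R = tau * n%:R ->
       ((ln (int_angle (face0 f n k) (face0 f n l)) / n%:R)%:E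
          < psi_int f delta tau + eps%:E)%E) /\
    (exists n1 : nat, forall n l : nat, (n1 < n)%N ->
       l%:R = tau * n%:R ->
       ((ln (ext_angle (face0 f n l) (wl1_ball f n)) / n%:R)%:E
          < psi_ext f tau + eps%:E)%E).
Proof.
move=> cf mf f_ge0 f_gt0 delta0 dt tau1 eps e0; split.
  exact: (int_angle_asymptotics cf mf f_ge0 f_gt0 delta0 dt tau1 e0).
exact: (ext_angle_asymptotics cf mf f_ge0 f_gt0 (lt_trans delta0 dt) tau1 e0).
Qed.
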